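(* Suppose $\{(x_i,y_i)\}_{i=1}^{2n}$ are $2n$ i.i.d. samples from the model $y_i=x_i^T\beta^*+z_i$, where $\beta^*\in\mathbb{R}^p$, the covariates $x_i\in\mathbb{R}^p$ satisfy $\mathbb{E}x_i=0$, $\mathbb{E}x_ix_i^T=I$ and $(4,2)$-hypercontractivity with parameter $\sigma_{x,4}\le C$ for a known constant $C$, and the noise variables $z_i$ are i.i.d., independent of the covariates, with $\mathbb{E}z_i=0$. Let $\tau\in(0,1)$ be such that $\frac{\log(1/\tau)}{n}=O(1)$. Suppose $\gamma>0$ is such that $\mathbb{P}\left(|z_1-z_2|\ge\frac{\gamma}{\sqrt2}\right)\le c^*$ for a small enough constant $c^*>0$, and suppose $\epsilon'$ is equal to a sufficiently small constant. Then running the algorithm Huber Regression with Filtering (defined in the context) on the data with parameters $\gamma$ and $\epsilon'$ produces an estimator $\widehat\beta$ that, with probability at least $1-2\tau$, satisfies $$\|\widehat\beta-\beta^*\|_2\lesssim\gamma\left(\sqrt{\frac pn}+\sqrt{\frac{\log(1/\tau)}{n}}\right),\quad\text{as long as } n=\Omega(p\log p).$$ Moreover, on the same event, the loss function $\beta\mapsto\frac1{|S_1|}\sum_{i\in S_1}\ell_\gamma(y_i'-x_i'^T\beta)$ minimized in the last step of the algorithm is $\Omega(1)$-strongly convex in a ball of radius $\Omega(\gamma)$ around $\widehat\beta$.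
   Context: Hypercontractivity: a random vector $X\in\mathbb{R}^p$ satisfies $(k,2)$-hypercontractivity with parameter $\sigma_k$ if $(\mathbb{E}|v^TX|^k)^{1/k}\le\sigma_k(\mathbb{E}(v^TX)^2)^{1/2}$ for all unit vectors $v$. Huber loss: $\ell_\gamma(x)=x^2/2$ if $|x|\le\gamma$ and $\gamma|x|-\gamma^2/2$ if $|x|>\gamma$. A continuously differentiable $f$ on a convex set is $\alpha$-strongly convex if $f(y)\ge f(x)+\langle\nabla f(x),y-x\rangle+\frac\alpha2\|y-x\|_2^2$ for all $x,y$ in the set. Stability: for $0<\epsilon<1/2$ and $\delta\ge\epsilon$, a finite multiset $S\subset\mathbb{R}^p$ is $(\epsilon,\delta)$-stable with respect to $\mu$ and $\sigma^2$ if for all $S'\subseteq S$ with $|S'|\ge(1-\epsilon)|S|$: $\left\|\frac1{|S'|}\sum_{x\in S'}x-\mu\right\|_2\le\sigma\delta$ and $\left\|\frac1{|S'|}\sum_{x\in S'}(x-\mu)(x-\mu)^T-\sigma^2I\right\|_2\le\frac{\sigma^2\delta^2}{\epsilon}$. Corruption: $T$ is an $\epsilon$-corrupted version of $S$ if $|T|=|S|$ and $|T\cap S|\ge(1-\epsilon)|S|$ (no restriction on how $T$ depends on $S$). Filter: FilteredCovariates$(T,\epsilon')$ is the iterative filtering algorithm from robust mean estimation, a computationally efficient randomized algorithm which takes a finite multiset $T\subset\mathbb{R}^p$ and $\epsilon'<1/2$ and outputs $T'\subseteq T$ (identified with the set of retained indices), with the following guarantee, for absolute constants $c_1,c_2,c_3>0$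 and any large enough constant $C_0>1$: if $T$ is an $\epsilon'$-corrupted version of a multiset $S$ of $n$ points containing $S'\subseteq S$ with $|S'|\ge(1-\epsilon')|S|$ that is $(C_0\epsilon',\delta)$-stable with respect to $\mu$ and $\sigma^2$, then with probability at least $1-O(\exp(-\Omega(n\epsilon')))$ over its internal randomness, $|T'|\ge(1-c_1\epsilon')|T|$ and $T'$ is $(c_2C_0\epsilon',c_3\delta)$-stable with respect to $\mu$ and $\sigma^2$. Algorithm Huber Regression with Filtering, input $(x_i,y_i)_{i\in[2n]},\gamma,\epsilon'$: (1) for $i=1,\dots,n$ set $(x_i',y_i')=\left(\frac{x_i-x_{n+i}}{\sqrt2},\frac{y_i-y_{n+i}}{\sqrt2}\right)$; (2) $S_1\leftarrow$ FilteredCovariates$((x_i')_{i\in[n]},\epsilon')$; (3) return $\widehat\beta\in\arg\min_\beta\frac1{|S_1|}\sum_{i\in S_1}\ell_\gamma(y_i'-x_i'^T\beta)$. Constants: implied constants are positive and may depend only on $C$ and on the constants $c^*$ and $\epsilon'$. In hypotheses, $A=O(B)$ means $A\le cB$ with $c$ sufficiently small, and $A=\Omega(B)$ means $A\ge C'B$ with $C'$ sufficiently large; in conclusions, $\lesssim$ and $\Omega(\cdot)$ mean up to some constant. *)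

(* Defs.v *)
From mathcomp Require Import all_boot all_order all_algebra.
From mathcomp Require Import perm.
From mathcomp Require Import all_classical all_reals all_analysis.

Set Implicit Arguments.
Unset Strict Implicit.
Unset Printing Implicit Defensive.

Import Order.TTheory GRing.Theory Num.Theory.
Import numFieldNormedType.Exports.

Local Open Scope classical_set_scope.
Local Open Scope ring_scope.

(* The norm that the library puts on matrices is the sup norm, hence the
   explicit Euclidean norm and spectral norm below. *)

Definition dot (R : realType) (p : nat) (u v : 'cV[R]_p) : R :=
  (u^T *m v) 0 0.

Definition norm2 (R : realType) (p : nat) (u : 'cV[R]_p) : R :=
  Num.sqrt (dot u u).

Definition opnorm (R : realType) (p : nat) (M : 'M[R]_p) : R :=
  sup [set norm2 (M *m v) | v in [set v : 'cV[R]_p | norm2 v <= 1]].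

Definition eball (R : realType) (p : nat) (c : 'cV[R]_p) (r : R) :
  set 'cV[R]_p := [set b | norm2 (b - c) <= r].

(** Measurable structures and independence *)

Definition cylinders (U I : Type) (d : measure_display) (S : measurableType d)
    (f : I -> U -> S) : set (set U) :=
  [set A | exists i, exists2 B, measurable B & A = f i @^-1` B].

(* R^p and (R^p)^n with the sigma-algebra generated by the real coordinates,
   i.e. the Borel sigma-algebra. *)
Notation vec R p :=
  (g_sigma_algebraType
     (cylinders (fun (j : 'I_p) (v : 'cV[R]_p) => v j 0 : R))).

Notation points R n p :=
  (g_sigma_algebraType
     (cylinders (fun (k : 'I_n * 'I_p) (T : 'I_n -> 'cV[R]_p) =>
                   T k.1 k.2 0 : R))).

Section independence.
Context {d d' d'' : measure_display} {Omega : measurableType d}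
  {R : realType} (P : probability Omega R)
  {S : measurableType d'} {S' : measurableType d''}.

Definition mutually_independent (I : finType) (X : I -> Omega -> S) : Prop :=
  forall (J : {set I}) (B : I -> set S), (forall i, measurable (B i)) ->
    P (\bigcap_(i in [set` J]) (X i @^-1` B i)) =
    (\prod_(i in J) P (X i @^-1` B i))%E.

Definition identically_distributed (I : finType) (X : I -> Omega -> S) : Prop :=
  forall (i j : I) (B : set S), measurable B ->
    P (X i @^-1` B) = P (X j @^-1` B).

Definition iid (I : finType) (X : I -> Omega -> S) : Prop :=
  [/\ forall i, measurable_fun setT (X i),
      mutually_independent X & identically_distributed X].

Definition independent_families (I J : finType)
    (X : I -> Omega -> S) (Z : J -> Omega -> S') : Prop :=
  forall A B : set Omega, <<s cylinders X >> A -> <<s cylinders Z >> B ->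
    P (A `&` B) = (P A * P B)%E.

End independence.

Definition hypercontractive (d : measure_display) (Omega : measurableType d)
    (R : realType) (P : probability Omega R) (p k : nat) (sigma : R)
    (X : Omega -> 'cV[R]_p) : Prop :=
  forall v : 'cV[R]_p, norm2 v = 1 ->
    ('N[P]_(k%:R)%:E[EFin \o (fun w => dot v (X w))] <=
     sigma%:E * 'N[P]_2%:E[EFin \o (fun w => dot v (X w))])%E.

(** Huber loss and strong convexity *)

Definition huber (R : realType) (gamma x : R) : R :=
  if `|x| <= gamma then x ^+ 2 / 2 else gamma * `|x| - gamma ^+ 2 / 2.

Definition grad (R : realType) (p : nat) (f : 'cV[R]_p -> R) (x : 'cV[R]_p) :
    'cV[R]_p :=
  \col_j 'D_(delta_mx j 0) (f : 'cV[R]_p -> R^o) x.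

Definition continuously_differentiable_on (R : realType) (p : nat)
    (D : set 'cV[R]_p) (f : 'cV[R]_p -> R) : Prop :=
  (forall x, D x -> differentiable (f : 'cV[R]_p -> R^o) x) /\
  {within D, continuous (grad f)}.

Definition strongly_convex_on (R : realType) (p : nat) (alpha : R)
    (D : set 'cV[R]_p) (f : 'cV[R]_p -> R) : Prop :=
  continuously_differentiable_on D f /\
  (forall x y, D x -> D y ->
     f x + dot (grad f x) (y - x) + alpha / 2 * norm2 (y - x) ^+ 2 <= f y).

Definition argmin (R : realType) (U : Type) (f : U -> R) : set U :=
  [set b | forall b', f b <= f b'].

(** Stability, corruption and filtering.
    A finite multiset of points is a finite family of points; its submultisets
    are given by sets of indices. *)

Section stability.
Context {R : realType} {n p : nat}.
Implicit Types (T S : 'I_n -> 'cV[R]_p) (A : {set 'I_n}).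

Definition emp_mean T A : 'cV[R]_p := #|A|%:R^-1 *: \sum_(i in A) T i.

Definition emp_second_moment (mu : 'cV[R]_p) T A : 'M[R]_p :=
  #|A|%:R^-1 *: \sum_(i in A) (T i - mu) *m (T i - mu)^T.

(* The multiset { T i | i in A } is (eps, delta)-stable w.r.t. mu and sigma^2. *)
Definition stable (eps delta : R) (mu : 'cV[R]_p) (sigma : R) T A : Prop :=
  [/\ 0 < eps, eps < 1 / 2, eps <= delta &
      forall A' : {set 'I_n}, A' \subset A ->
        (1 - eps) * #|A|%:R <= #|A'|%:R ->
        norm2 (emp_mean T A' - mu) <= sigma * delta /\
        opnorm (emp_second_moment mu T A' - (sigma ^+ 2)%:M)
          <= sigma ^+ 2 * delta ^+ 2 / eps].

(* The multiset intersection of the families T and S has at least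
   (1 - eps) n elements iff some matching of the indices makes that many
   points agree. *)
Definition corrupted (eps : R) T S : Prop :=
  exists s : {perm 'I_n},
    (1 - eps) * n%:R <= #|[set i | T i == S (s i)]|%:R.

End stability.

(* A randomized filter: given eps, the points T and an internal random seed w,
   it returns the set of retained indices. *)
Definition filter_type (R : realType) (n p : nat) (W : Type) : Type :=
  R -> ('I_n -> 'cV[R]_p) -> W -> {set 'I_n}.

Section filter.
Context {R : realType} {n p : nat} {d : measure_display}
  {W : measurableType d} (Q : probability W R).

Definition filter_measurable (F : filter_type R n p W) : Prop :=
  forall (eps : R) (A : {set 'I_n}),
    measurable [set Tw : points R n p * W | F eps Tw.1 Tw.2 = A].

(* c4 and c5 are the implied constants of the failure probability and C0min is
   the threshold of "large enough C0".  The guarantee is only asked for when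
   (c2 * C0 * eps, c3 * delta) are admissible stability parameters; otherwise
   its conclusion would be contradictory. *)
Definition filter_guarantee (c1 c2 c3 c4 c5 C0min : R)
    (F : filter_type R n p W) : Prop :=
  forall (C0 eps delta : R) (mu : 'cV[R]_p) (sigma : R)
      (T S : 'I_n -> 'cV[R]_p) (S' : {set 'I_n}),
    1 < C0 -> C0min <= C0 -> 0 < eps -> eps < 1 / 2 -> 0 < sigma ->
    c2 * C0 * eps < 1 / 2 -> c2 * C0 * eps <= c3 * delta ->
    corrupted eps T S ->
    (1 - eps) * n%:R <= #|S'|%:R ->
    stable (C0 * eps) delta mu sigma S S' ->
    ((1 - c4 * expR (- (c5 * (n%:R * eps))))%:E <=
     Q [set w | ((1 - c1 * eps) * n%:R <= #|F eps T w|%:R)%R /\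
                stable (c2 * C0 * eps)%R (c3 * delta)%R mu sigma T (F eps T w)])%E.

End filter.

(** Huber regression with filtering *)

Section algorithm.
Context {R : realType} {n p : nat} {W : Type}.

Definition diff_covariates (x : 'I_(n + n) -> 'cV[R]_p) (i : 'I_n) : 'cV[R]_p :=
  (Num.sqrt 2)^-1 *: (x (lshift n i) - x (rshift n i)).

Definition diff_responses (y : 'I_(n + n) -> R) (i : 'I_n) : R :=
  (y (lshift n i) - y (rshift n i)) / Num.sqrt 2.

Definition empirical_huber (gamma : R) (x : 'I_n -> 'cV[R]_p) (y : 'I_n -> R)
    (A : {set 'I_n}) (b : 'cV[R]_p) : R :=
  #|A|%:R^-1 * \sum_(i in A) huber gamma (y i - dot (x i) b).

(* The function of b minimized in the last step, for the seed w. *)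
Definition filtered_huber_loss (F : filter_type R n p W) (gamma eps : R)
    (x : 'I_(n + n) -> 'cV[R]_p) (y : 'I_(n + n) -> R) (w : W) :
    'cV[R]_p -> R :=
  empirical_huber gamma (diff_covariates x) (diff_responses y)
    (F eps (diff_covariates x) w).

(* The outputs the algorithm may return for the seed w. *)
Definition huber_regression_with_filtering (F : filter_type R n p W)
    (gamma eps : R) (x : 'I_(n + n) -> 'cV[R]_p) (y : 'I_(n + n) -> R) (w : W) :
    set 'cV[R]_p :=
  argmin (filtered_huber_loss F gamma eps x y w).

End algorithm.

(* Main.v *)
(** Read the differenced covariates one at a time and keep a covariate only if
    it does not increase the trace of the inverse of (barrier - moment matrix of
    the kept covariates), where the barrier b n + b k grows with the number k of
    covariates read.  By isotropy each covariate is discarded with conditional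
    probability O(1 / b), so by freezing the past and a Chernoff bound all but a
    small fraction are kept, and the kept ones have second moments bounded by
    2 b n by construction: no matrix concentration is needed.  Bounded moments
    give stability around 0 with variance 1 for a large constant radius, so the
    filter guarantee applies, with no corruption at all, and yields the same kind
    of moment bound on the retained set S1.

    On S1 the Huber loss is strongly convex near betastar: the fourth moments
    give a small-ball estimate (Paley-Zygmund), made uniform over directions by a
    net and the moment bound, while large noises and large products
    <x_i, beta - betastar> occupy few indices.  The gradient at betastar is
    controlled by a net and, with the covariates and hence S1 frozen, by the
    symmetry and boundedness of the clipped noise.  The loss being globally
    convex, its minimizers lie in the strongly convex ball, at a distance
    comparable to the norm of the gradient at betastar. *)

From HB Require Import structures.
Require Import Defs.
From mathcomp Require Import all_boot all_order all_algebra.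
From mathcomp Require Import perm.
From mathcomp Require Import ring lra.
From mathcomp Require Import all_classical all_reals all_analysis.
From mathcomp Require Import measurable_realfun.

Set Implicit Arguments.
Unset Strict Implicit.
Unset Printing Implicit Defensive.

Import Order.TTheory GRing.Theory Num.Theory.
Import numFieldNormedType.Exports.

Local Open Scope classical_set_scope.
Local Open Scope ring_scope.

(** * Independence and freezing *)

(** The order of the constants matters. The small-ball probability [c0] depends on the
    hypercontractivity constant alone, so the loss [c1 * e] of the filter and the frequency of large
    noises can be made small multiples of [c0]. The moment constant [B] of the retained set comes
    later and grows as [e] shrinks; its size is absorbed by the radius [rho = alpha / B], since the
    number of indices with a large product and the error of the net are bounded through [B * rho].
    The retained set depends on all covariates and on the seed, so sums over it do not have
    independent terms. Two devices get around this. Small-ball and noise counts are taken over all n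
    pairs, and the few lost indices are subtracted afterwards. In the gradient the covariates and
    the seed are frozen, which fixes the retained set and leaves the noise with its law. Each of the
    five bad events receives probability tau^3, so that no constant is lost in the final 2 tau. *)

Section independence_pi_lambda.
Context {d : measure_display} {Omega : measurableType d} {R : realType}
  (P : probability Omega R).
Local Open Scope ereal_scope.

(** The events of <<s G>> that are independent of the fixed A form a Dynkin system, and this system
    contains the pi-system G. *)
Lemma independent_g_sigma_algebra (A : set Omega) (G : set (set Omega)) :
  measurable A -> setI_closed G -> G `<=` measurable ->
  (forall B, G B -> P (A `&` B) = P A * P B) ->
  forall B, <<s G >> B -> P (A `&` B) = P A * P B.
Proof.
move=> mA GI Gm GA B sGB.
have sGm : <<s G >> `<=` @measurable d Omega.
  by apply: smallest_sub => //; exact: sigma_algebra_measurable.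
pose T : measurableType _ := g_sigma_algebraType G.
suff : <<s G >> `<=` [set B | <<s G >> B /\ P (A `&` B) = P A * P B].
  by move=> /(_ _ sGB)[].
apply: lambda_system_subset => //; last first.
  by move=> C GC; split; [exact: sub_sigma_algebra|exact: GA].
apply/dynkin_lambda_system; split.
- split; first exact: (@measurableT _ T).
  by rewrite setIT probability_setT mule1.
- move=> C [sC AC]; split; first exact: (@measurableC _ T).
  have mC := sGm _ sC.
  have fAC : P (A `&` C) \is a fin_num by apply: fin_num_measure; exact: measurableI.
  have fA : P A \is a fin_num by exact: fin_num_measure.
  have AE : P A = P (A `&` C) + P (A `&` ~` C).
    rewrite -measureU -?setIUr ?setUv ?setIT//.
    - exact: measurableI.
    - by apply: measurableI => //; exact: measurableC.
    - by rewrite setIACA setICr setI0.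
  rewrite probability_setC// muleBr// mule1 -[in RHS]AC.
  by rewrite [in RHS]AE addeAC subee// add0e.
- move=> F tF FP; split.
    by apply: (@bigcupT_measurable _ T) => k; have [] := FP k.
  have mF k : measurable (F k) by apply: sGm; have [] := FP k.
  rewrite setI_bigcupr measure_bigcup//=; last 2 first.
    by move=> k _; apply: measurableI.
    exact: trivIset_setIl.
  rewrite measure_bigcup//=.
  have fA : P A \is a fin_num by exact: fin_num_measure.
  rewrite -(fineK fA) -nneseriesZl//.
  by apply: eq_eseriesr => k _; rewrite fineK//; have [] := FP k.
Qed.

(** One side is enlarged at a time: first H against a generator in G, then G against an event of <<s
    H>>. *)
Lemma independent_g_sigma_algebra2 (G H : set (set Omega)) :
  setI_closed G -> setI_closed H -> G `<=` measurable -> H `<=` measurable ->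
  (forall A B, G A -> H B -> P (A `&` B) = P A * P B) ->
  forall A B, <<s G >> A -> <<s H >> B -> P (A `&` B) = P A * P B.
Proof.
move=> GI HI Gm Hm GH A B sA sB.
have sHm : <<s H >> `<=` @measurable d Omega.
  by apply: smallest_sub => //; exact: sigma_algebra_measurable.
rewrite setIC muleC.
apply: (independent_g_sigma_algebra (sHm _ sB) GI Gm) => // A' GA'.
rewrite setIC muleC.
apply: (independent_g_sigma_algebra (Gm _ GA') HI Hm) => // B' HB'.
exact: GH.
Qed.

End independence_pi_lambda.

Definition independent_maps (d d1 d2 : measure_display)
    (Omega : measurableType d) (R : realType) (P : probability Omega R)
    (T1 : measurableType d1) (T2 : measurableType d2)
    (X : Omega -> T1) (Y : Omega -> T2) : Prop :=
  forall A B, measurable A -> measurable B ->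
    P (X @^-1` A `&` Y @^-1` B) = (P (X @^-1` A) * P (Y @^-1` B))%E.

Section freezing.
Context {d d1 d2 : measure_display} {Omega : measurableType d}
  {R : realType} (P : probability Omega R)
  {T1 : measurableType d1} {T2 : measurableType d2}.
Local Open Scope ereal_scope.

(** Independence says that the joint law of (X, Y) is the product of the marginal laws; Tonelli then
    integrates Y first, with X held fixed. *)
Lemma freezing (X : {mfun Omega >-> T1}) (Y : {mfun Omega >-> T2})
    (f : T1 * T2 -> \bar R) :
  independent_maps P X Y ->
  measurable_fun [set: T1 * T2] f -> (forall u, 0 <= f u) ->
  \int[P]_w f (X w, Y w) = \int[P]_w \int[P]_w' f (X w, Y w').
Proof.
move=> XY mf f0.
have mXY : measurable_fun setT (fun w => (X w, Y w)).
  by apply/measurable_fun_pair; exact: measurable_funP.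
pose XYm := @isMeasurableFun.Build _ _ _ _ _ mXY.
pose Z : {mfun Omega >-> (T1 * T2)%type} := HB.pack (fun w => (X w, Y w)) XYm.
have E C : measurable C ->
    (distribution P X \x distribution P Y) C = distribution P Z C.
  apply: product_measure_unique => A B mA mB /=.
  rewrite /distribution /pushforward -XY//.
have -> : \int[P]_w f (X w, Y w) = \int[distribution P Z]_u f u.
  by rewrite ge0_integral_distribution.
rewrite (eq_measure_integral (distribution P X \x distribution P Y)%E); last first.
  by move=> C mC _; apply/esym; exact: E.
rewrite fubini_tonelli1//.
rewrite ge0_integral_distribution//; last 2 first.
- exact: measurable_fun_fubini_tonelli_F.
- by move=> u; exact: integral_ge0.
apply: eq_integral => w _; rewrite /= /fubini_F.
rewrite ge0_integral_distribution//.
exact: measurable_fun_pair2.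
Qed.

Lemma measurable_frozen_integral (Y : {mfun Omega >-> T2})
    (f : T1 * T2 -> \bar R) :
  measurable_fun [set: T1 * T2] f -> (forall u, 0 <= f u) ->
  measurable_fun [set: T1] (fun u => \int[P]_w f (u, Y w)).
Proof.
move=> mf f0.
have -> : (fun u => \int[P]_w f (u, Y w)) = fubini_F (distribution P Y) f.
  apply/funext => u; rewrite /fubini_F ge0_integral_distribution//.
  exact: measurable_fun_pair2.
exact: measurable_fun_fubini_tonelli_F.
Qed.

End freezing.

Section blocks.
Context {d d' : measure_display} {Omega : measurableType d} {R : realType}
  (P : probability Omega R) {S : measurableType d'} {I : finType}.
Implicit Types (X : I -> Omega -> S) (J K : {set I}).

Definition generated_by X J : set (set Omega) :=
  [set A | exists2 i, i \in J & exists2 B, measurable B & A = X i @^-1` B].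

Lemma generated_by_measurable X J : (forall i, measurable_fun setT (X i)) ->
  generated_by X J `<=` measurable.
Proof.
move=> mX _ [i iJ [B mB ->]].
by rewrite -(setTI (_ @^-1` _)); exact: mX.
Qed.

(** The family [generated_by] is not stable under intersection, so the pi-lambda argument runs on
    rectangles, which are stable and contain the generators. *)
Lemma mutually_independent_blocks X J K :
  (forall i, measurable_fun setT (X i)) -> mutually_independent P X ->
  (J :&: K)%SET = finset.set0 ->
  forall A B, <<s generated_by X J >> A -> <<s generated_by X K >> B ->
    P (A `&` B) = (P A * P B)%E.
Proof.
move=> mX iX JK.
pose rects (L : {set I}) : set (set Omega) := [set A | exists2 B : I -> set S,
   forall i, measurable (B i) & A = \bigcap_(i in [set` L]) (X i @^-1` B i)].
have mXB i C : measurable C -> measurable (X i @^-1` C).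
  by move=> mC; rewrite -(setTI (_ @^-1` _)); exact: mX.
have rectsI L : setI_closed (rects L).
  move=> _ _ [B mB ->] [B' mB' ->]; exists (fun i => B i `&` B' i).
    by move=> i; exact: measurableI.
  by rewrite -bigcapI.
have rectsm L : rects L `<=` measurable.
  by move=> _ [B mB ->]; apply: fin_bigcap_measurable => // i _; exact: mXB.
have grects L : <<s generated_by X L >> `<=` <<s rects L >>.
  apply: sub_sigma_algebra2 => _ [i iL [B mB ->]].
  exists (fun j => if j == i then B else setT).
    by move=> j; case: ifP.
  apply/seteqP; split => [w XB j /= jL|w /(_ i iL)]; last by rewrite eqxx.
  by case: eqP => // ->.
move=> A B /grects sA /grects sB.
apply: (independent_g_sigma_algebra2 (rectsI J) (rectsI K) (@rectsm _) (@rectsm _)) => //.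
move=> _ _ [B1 mB1 ->] [B2 mB2 ->].
(* Glues the rectangles over the disjoint J and K into one over their union, so that mutual
   independence factorizes it at once. *)
pose B3 i := if i \in J then B1 i else B2 i.
have mB3 i : measurable (B3 i) by rewrite /B3; case: ifP.
have JKF i : i \in J -> i \in K -> False.
  by move=> iJ iK; have : i \in (J :&: K)%SET by [rewrite inE iJ]; rewrite JK inE.
rewrite [X in P X](_ : _ = \bigcap_(i in [set` (J :|: K)%SET]) (X i @^-1` B3 i)); last first.
  apply/seteqP; split => [w [w1 w2] i /=|w H].
    rewrite inE /B3 => /orP[iJ|iK]; first by rewrite iJ; exact: w1.
    case: ifPn => iJ; [exact: w1|exact: w2].
  split=> i /= iL; have := H i; rewrite /= inE iL ?orbT /B3 => /(_ isT).
    by rewrite iL.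
  by case: ifPn => // iJ; exfalso; exact: (JKF i).
rewrite !iX// (eq_bigl [predU J & K]); last by move=> i; rewrite !inE.
rewrite bigU/=; last by rewrite -finset.setI_eq0 JK.
congr (_ * _)%E; apply: eq_bigr => i iL; rewrite /B3 ?iL//.
by case: ifPn => // iJ; exfalso; exact: (JKF i).
Qed.

End blocks.

Lemma measurable_fun_sub_sigma_algebra (d : measure_display)
  (Omega : measurableType d) (C1 C2 : set (set Omega)) : <<s C2 >> `<=` <<s C1 >> ->
  measurable_fun [set: g_sigma_algebraType C1]
    (id : g_sigma_algebraType C1 -> g_sigma_algebraType C2).
Proof. by move=> C21 _ B mB; rewrite setTI; exact: C21. Qed.

Section sub_sigma_algebra_mfun.
Context {d : measure_display} {Omega : measurableType d}
  (C : set (set Omega)) (mC : C `<=` measurable).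

Lemma measurable_sub_sigma_algebra :
  measurable_fun [set: Omega] (id : Omega -> g_sigma_algebraType C).
Proof.
move=> _ B mB; rewrite setTI; move: B mB; apply: smallest_sub => //.
exact: sigma_algebra_measurable.
Qed.

(** The identity, read as a map onto the same set with a coarser sigma-algebra. Independence of two
    sub-sigma-algebras becomes independence of two such maps. *)
Definition to_sub_sigma_algebra (w : Omega) : g_sigma_algebraType C := w.

HB.instance Definition _ := @isMeasurableFun.Build _ _ _ _
  to_sub_sigma_algebra measurable_sub_sigma_algebra.

Definition coarsen : {mfun Omega >-> g_sigma_algebraType C} :=
  to_sub_sigma_algebra.

End sub_sigma_algebra_mfun.

Section freezing_sub_sigma_algebras.
Context {d : measure_display} {Omega : measurableType d} {R : realType}
  (P : probability Omega R) (C1 C2 : set (set Omega)).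
Hypotheses (mC1 : C1 `<=` measurable) (mC2 : C2 `<=` measurable).
Variable f : g_sigma_algebraType C1 * g_sigma_algebraType C2 -> \bar R.
Hypothesis mf :
  measurable_fun [set: g_sigma_algebraType C1 * g_sigma_algebraType C2] f.
Hypothesis f0 : (forall u, 0 <= f u)%E.
Local Open Scope ereal_scope.

(** Here f takes two copies of the sample point, each seen through one sigma-algebra only. The
    random variable of interest is its value on the diagonal, and freezing decouples the copies. *)
Lemma freezing_sub :
  (forall A B, <<s C1 >> A -> <<s C2 >> B -> P (A `&` B) = P A * P B) ->
  \int[P]_w f (w, w) = \int[P]_w \int[P]_w' f (w, w').
Proof.
by move=> indep; exact: (@freezing _ _ _ _ _ P _ _ (coarsen mC1) (coarsen mC2) f).
Qed.

Lemma measurable_frozen_integral_sub :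
  measurable_fun [set: g_sigma_algebraType C1] (fun u => \int[P]_w f (u, w)).
Proof. exact: (@measurable_frozen_integral _ _ _ _ _ P _ _ (coarsen mC2) f). Qed.

End freezing_sub_sigma_algebras.

(** * Products of factors adapted to a filtration *)

Section sequential_product.
Context {d d' : measure_display} {Omega : measurableType d} {R : realType}
  (P : probability Omega R) {S : measurableType d'} {I : finType}.
Variables (X : I -> Omega -> S) (l : I -> nat).
Hypotheses (mX : forall i, measurable_fun setT (X i))
  (iX : mutually_independent P X).

(** [l i] is the time at which the sample [X i] is read; several samples may be read at the same
    time. *)
Definition past k := generated_by X [set i | (l i < k)%N]%SET.
Definition present k := generated_by X [set i | l i == k]%SET.

Lemma past_measurable k : past k `<=` measurable.
Proof. exact: generated_by_measurable. Qed.

Lemma present_measurable k : present k `<=` measurable.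
Proof. exact: generated_by_measurable. Qed.

Lemma sub_past j k : (j <= k)%N -> past j `<=` past k.
Proof.
move=> jk _ [i ij [B mB ->]]; exists i; last by exists B.
by move: ij; rewrite !inE => /leq_trans; exact.
Qed.

Lemma present_sub_past k : present k `<=` past k.+1.
Proof.
move=> _ [i ik [B mB ->]]; exists i; last by exists B.
by move: ik; rewrite !inE => /eqP ->.
Qed.

Lemma past_present_independent k A B :
  <<s past k >> A -> <<s present k >> B -> P (A `&` B) = (P A * P B)%E.
Proof.
apply: mutually_independent_blocks => //.
by apply/finset.setP => i; rewrite !inE; case: ltngtP.
Qed.

Variable g : forall k, g_sigma_algebraType (past k) * g_sigma_algebraType (present k) -> R.
Hypothesis mg : forall k,
  measurable_fun [set: g_sigma_algebraType (past k) * g_sigma_algebraType (present k)] (@g k).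
Hypothesis g_ge0 : forall k u, 0 <= @g k u.

Lemma measurable_sequential_product k :
  measurable_fun [set: g_sigma_algebraType (past k)]
    (fun w => \prod_(j < k) @g j (w, w) : R).
Proof.
apply: measurable_prod => -[j jk] _ /=.
apply: (@measurableT_comp _ _ _ _ _ _ (@g j)); first exact: mg.
apply/measurable_fun_pair.
  apply: measurable_fun_sub_sigma_algebra; apply: sub_sigma_algebra2.
  exact/sub_past/ltnW.
apply: measurable_fun_sub_sigma_algebra; apply: sub_sigma_algebra2.
exact: (subset_trans (@present_sub_past j) (sub_past jk)).
Qed.

(** A supermartingale-type bound by induction: freeze the past of the last step, pull out the
    earlier factors, and bound the integral of the fresh factor by a constant valid for every
    past. *)
Lemma sequential_product_le (m : nat -> R) (n : nat) :
  (forall k, (k < n)%N -> forall w, (\int[P]_w' (@g k (w, w'))%:E <= (m k)%:E)%E) ->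
  (\int[P]_w (\prod_(k < n) @g k (w, w))%:E <= (\prod_(k < n) m k)%:E)%E.
Proof.
elim: n => [_|n IH gm].
  rewrite big_ord0; under eq_integral do rewrite big_ord0.
  by rewrite integral_cst//= mul1e probability_setT.
rewrite [in leRHS]big_ord_recr /=.
under eq_integral do rewrite big_ord_recr /=.
have m0 k : (k < n.+1)%N -> 0 <= m k.
  move=> kn; rewrite -lee_fin; apply: le_trans (gm k kn point).
  by apply: integral_ge0 => w _; rewrite lee_fin.
have mM := measurable_sequential_product (k:=n).
have mMO : measurable_fun [set: Omega] (fun w => \prod_(j < n) @g j (w, w) : R).
  apply: (measurable_comp _ _ mM (measurable_sub_sigma_algebra (past_measurable (k:=n)))) => //.
pose f (u : g_sigma_algebraType (past n) * g_sigma_algebraType (present n)) : \bar R :=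
  ((\prod_(j < n) @g j (u.1, u.1)) * @g n u)%:E.
have mf : measurable_fun
    [set: g_sigma_algebraType (past n) * g_sigma_algebraType (present n)] f.
  apply/measurable_EFinP; apply: measurable_funM => //.
  exact: (measurableT_comp mM measurable_fst).
have f0 u : (0 <= f u)%E by rewrite lee_fin mulr_ge0// prodr_ge0.
rewrite (freezing_sub (@past_measurable n) (@present_measurable n) mf f0
  (@past_present_independent n)) /f/=.
have mgw w : measurable_fun [set: Omega] (fun w' => @g n (w, w')).
  have := measurable_fun_pair2 w (mg (k:=n)) => h.
  exact: (measurable_comp _ _ h (measurable_sub_sigma_algebra (present_measurable (k:=n)))).
pose M (w : Omega) : R := \prod_(k < n) @g k (w, w).
apply: (@le_trans _ _ (\int[P]_w ((m n)%:E * (M w)%:E))%E).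
  apply: ge0_le_integral => //.
  - move=> w _; apply: integral_ge0 => w' _; exact: (f0 (w, w')).
  - have mF := measurable_frozen_integral_sub P (@present_measurable n) mf f0.
    exact: (measurable_comp _ _ mF (measurable_sub_sigma_algebra (past_measurable (k:=n)))).
  - by apply/measurable_EFinP; apply: measurable_funM => //; exact: measurable_cst.
  - move=> w _; under eq_integral do rewrite EFinM.
    rewrite ge0_integralZl//; last 3 first.
    + exact/measurable_EFinP.
    + by move=> w' _; rewrite lee_fin.
    + by rewrite lee_fin prodr_ge0.
    rewrite muleC; apply: lee_wpmul2r; first by rewrite lee_fin prodr_ge0.
    exact: gm.
rewrite ge0_integralZl//; last 3 first.
- exact/measurable_EFinP.
- by move=> w _; rewrite lee_fin prodr_ge0.
- by rewrite lee_fin m0.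
rewrite EFinM muleC; apply: lee_wpmul2r; first by rewrite lee_fin m0.
by apply: IH => k kn w; apply: gm; exact: ltnW.
Qed.

End sequential_product.

(** * Barrier argument *)

Section euclidean.
Context {R : realType} {p : nat}.
Implicit Types (u v w x : 'cV[R]_p) (M V : 'M[R]_p) (a b : R).

Lemma dotE u v : dot u v = \sum_j u j 0 * v j 0.
Proof. by rewrite /dot mxE; apply: eq_bigr => j _; rewrite mxE. Qed.

Lemma dotC u v : dot u v = dot v u.
Proof. by rewrite !dotE; apply: eq_bigr => j _; rewrite mulrC. Qed.

Lemma dotDr u v w : dot u (v + w) = dot u v + dot u w.
Proof. by rewrite /dot mulmxDr mxE. Qed.

Lemma dotDl u v w : dot (v + w) u = dot v u + dot w u.
Proof. by rewrite dotC dotDr !(dotC u). Qed.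

Lemma dotZr a u v : dot u (a *: v) = a * dot u v.
Proof. by rewrite /dot -scalemxAr mxE. Qed.

Lemma dotZl a u v : dot (a *: u) v = a * dot u v.
Proof. by rewrite dotC dotZr dotC. Qed.

Lemma dotNr u v : dot u (- v) = - dot u v.
Proof. by rewrite -scaleN1r dotZr mulN1r. Qed.

Lemma dotNl u v : dot (- u) v = - dot u v.
Proof. by rewrite dotC dotNr dotC. Qed.

Lemma dotBr u v w : dot u (v - w) = dot u v - dot u w.
Proof. by rewrite dotDr dotNr. Qed.

Lemma dotBl u v w : dot (v - w) u = dot v u - dot w u.
Proof. by rewrite dotDl dotNl. Qed.

Lemma dot0r u : dot u 0 = 0.
Proof. by rewrite /dot mulmx0 mxE. Qed.

Lemma dot0l u : dot 0 u = 0.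
Proof. by rewrite dotC dot0r. Qed.

Lemma dot_sumr (I : finType) (Q : pred I) u (f : I -> 'cV[R]_p) :
  dot u (\sum_(i | Q i) f i) = \sum_(i | Q i) dot u (f i).
Proof. by apply: (big_morph _ (dotDr u)); rewrite dot0r. Qed.

Lemma dot_ge0 u : 0 <= dot u u.
Proof. by rewrite dotE; apply: sumr_ge0 => j _; rewrite -expr2 sqr_ge0. Qed.

Lemma dot_eq0 u : dot u u = 0 -> u = 0.
Proof.
rewrite dotE => /psumr_eq0P H; apply/colP => j; rewrite mxE.
have /eqP := H (fun i _ => sqr_ge0 (u i 0)) j isT.
by rewrite mulf_eq0 orbb => /eqP.
Qed.

Lemma dot_gt0 u : u != 0 -> 0 < dot u u.
Proof.
by move=> u0; rewrite lt_def dot_ge0 andbT; apply: contra_neq u0; exact: dot_eq0.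
Qed.

Lemma norm2_ge0 u : 0 <= norm2 u.
Proof. exact: sqrtr_ge0. Qed.

Lemma norm2_sq u : norm2 u ^+ 2 = dot u u.
Proof. by rewrite sqr_sqrtr// dot_ge0. Qed.

Lemma norm2_0 : norm2 (0 : 'cV[R]_p) = 0.
Proof. by rewrite /norm2 dot0l sqrtr0. Qed.

Lemma norm2_le u a : 0 <= a -> (norm2 u <= a) = (dot u u <= a ^+ 2).
Proof. by move=> a0; rewrite -norm2_sq ler_sqr ?nnegrE ?norm2_ge0. Qed.

Lemma norm2Z a u : norm2 (a *: u) = `|a| * norm2 u.
Proof. by rewrite /norm2 dotZl dotZr mulrA -expr2 sqrtrM ?sqr_ge0// sqrtr_sqr. Qed.

Lemma norm2N u : norm2 (- u) = norm2 u.
Proof. by rewrite -scaleN1r norm2Z normrN1 mul1r. Qed.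

Lemma norm2_gt0 u : u != 0 -> 0 < norm2 u.
Proof. by move=> /dot_gt0; rewrite sqrtr_gt0. Qed.

Lemma dot_mulmx u M v : dot u (M *m v) = dot (M^T *m u) v.
Proof. by rewrite /dot trmx_mul trmxK mulmxA. Qed.

Definition posdef M := M^T = M /\ forall u, u != 0 -> 0 < dot u (M *m u).

Definition possemidef M := M^T = M /\ forall u, 0 <= dot u (M *m u).

Lemma posdefW M : posdef M -> possemidef M.
Proof.
move=> [sM pM]; split=> // u; have [->|/pM/ltW//] := eqVneq u 0.
by rewrite dot0l.
Qed.

Lemma cauchy_schwarz_form M u v : possemidef M ->
  dot u (M *m v) ^+ 2 <= dot u (M *m u) * dot v (M *m v).
Proof.
move=> [sM pM].
set a := dot u (M *m u); set b := dot u (M *m v); set c := dot v (M *m v).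
have E t : 0 <= a + 2 * t * b + t ^+ 2 * c.
  have := pM (u + t *: v); rewrite mulmxDr -scalemxAr !(dotDr, dotDl, dotZl, dotZr).
  rewrite (dot_mulmx v M u) sM (dotC (M *m v) u).
  by rewrite -/a -/b -/c; congr (0 <= _); ring.
have c0 : 0 <= c by exact: pM.
have a0 : 0 <= a by exact: pM.
have [c1|cn] := eqVneq c 0.
  rewrite c1 mulr0; have [->|bn] := eqVneq b 0; first by rewrite expr0n.
  (* With c = 0 the nonnegative polynomial is affine in t, and at this t it equals -1. *)
  have := E (- (a + 1) / (2 * b)); rewrite c1 mulr0 addr0.
  have -> : 2 * (- (a + 1) / (2 * b)) * b = - (a + 1) by field.
  by lra.
have := E (- b / c).
have -> : a + 2 * (- b / c) * b + (- b / c) ^+ 2 * c = a - b ^+ 2 / c by field.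
by rewrite subr_ge0 ler_pdivrMr// lt_def cn.
Qed.

Lemma possemidef1 : possemidef 1%:M.
Proof. by split => [|u]; rewrite ?trmx1 ?mul1mx ?dot_ge0. Qed.

Lemma cauchy_schwarz u v : dot u v ^+ 2 <= dot u u * dot v v.
Proof. by have := cauchy_schwarz_form u v possemidef1; rewrite !mul1mx. Qed.

Lemma cauchy_schwarz_norm2 u v : `|dot u v| <= norm2 u * norm2 v.
Proof.
rewrite -ler_sqr ?nnegrE ?mulr_ge0 ?norm2_ge0//.
by rewrite real_normK ?num_real// exprMn !norm2_sq cauchy_schwarz.
Qed.

Lemma norm2_triangle u v : norm2 (u + v) <= norm2 u + norm2 v.
Proof.
rewrite norm2_le ?addr_ge0 ?norm2_ge0// sqrrD !norm2_sq !(dotDr, dotDl).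
have := cauchy_schwarz_norm2 u v; have := ler_norm (dot u v).
by rewrite (dotC v u); lra.
Qed.

Lemma posdef_unitmx M : posdef M -> M \in unitmx.
Proof.
move=> [sM pM]; rewrite -row_free_unit; apply: inj_row_free => v vM.
have : M *m v^T = 0 by rewrite -sM -trmx_mul vM trmx0.
move=> Mv; have [/eqP|/pM] := eqVneq v^T 0; last by rewrite Mv dot0r ltxx.
by rewrite -(inj_eq trmx_inj) trmxK trmx0 => /eqP.
Qed.

Lemma posdef_inv M : posdef M -> posdef (invmx M).
Proof.
move=> pM; have uM := posdef_unitmx pM; case: pM => sM pM.
have sV : (invmx M)^T = invmx M by rewrite trmx_inv sM.
split=> // u u0; set v := invmx M *m u.
have uE : u = M *m v by rewrite /v mulKVmx.
have v0 : v != 0 by apply: contra_neq u0 => v0; rewrite uE v0 mulmx0.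
by rewrite dotC uE; exact: pM.
Qed.

Lemma mxtrace_possemidef M : possemidef M -> 0 <= \tr M.
Proof.
move=> [_ pM]; apply: sumr_ge0 => i _.
have := pM (delta_mx i 0); rewrite -colE dotE (bigD1 i)//= big1 => [|j ji].
  by rewrite addr0 !mxE !eqxx mul1r.
by rewrite !mxE (negbTE ji) mul0r.
Qed.

Lemma mxtrace_outer u : \tr (u *m u^T) = dot u u.
Proof. by rewrite mxtrace_mulC /mxtrace big_ord1. Qed.

Lemma mxtrace_sqr_ge0 V : V^T = V -> 0 <= \tr (V *m V).
Proof.
move=> sV; apply: sumr_ge0 => i _; rewrite mxE; apply: sumr_ge0 => j _.
by rewrite -{2}sV mxE -expr2 sqr_ge0.
Qed.

Lemma posdefD_scalar M b : 0 <= b -> posdef M -> posdef (M + b%:M).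
Proof.
move=> b0 [sM pM]; split; first by rewrite linearD /= tr_scalar_mx sM.
move=> u u0; rewrite mulmxDl dotDr mul_scalar_mx dotZr.
by rewrite ltr_wpDr ?pM// mulr_ge0// dot_ge0.
Qed.

(** With W and V the inverses before and after the shift, the resolvent identity W - V = b W V used
    twice gives W = V + b V^2 + b^2 W V^2, and the last term has nonnegative trace, being cyclically
    V W V. *)
Lemma mxtrace_inv_shift M b : 0 <= b -> posdef M ->
  \tr (invmx (M + b%:M)) + b * \tr (invmx (M + b%:M) *m invmx (M + b%:M)) <=
  \tr (invmx M).
Proof.
move=> b0 pM; set N := M + b%:M; set V := invmx N.
have pN : posdef N by exact: posdefD_scalar.
have uM := posdef_unitmx pM; have uN := posdef_unitmx pN.
have pV : posdef V := posdef_inv pN.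
have pW : posdef (invmx M) := posdef_inv pM.
set W := invmx M in pW *.
have E1 : W - V = b *: (W *m V).
  have -> : b *: (W *m V) = W *m (N - M) *m V.
    by rewrite /N addrAC subrr add0r mul_mx_scalar scalemxAl.
  by rewrite mulmxBr mulmxBl mulVmx// mul1mx -mulmxA mulmxV// mulmx1.
have E2 : W = V + b *: (V *m V) + b *: (b *: (W *m V *m V)).
  have EW : W = V + b *: (W *m V) by rewrite -E1 addrCA subrr addr0.
  rewrite {1}EW -addrA; congr (_ + _); rewrite -scalerDr; congr (_ *: _).
  by rewrite {1}EW mulmxDl -scalemxAl.
rewrite {1}E2 !linearD /= !linearZ /= lerDl !mulr_ge0//.
rewrite mxtrace_mulC mulmxA; apply: mxtrace_possemidef; split.
  by rewrite !trmx_mul (proj1 pV) (proj1 pW) mulmxA.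
move=> u; rewrite -!mulmxA dot_mulmx (proj1 pV).
exact: (proj2 (posdefW pW)).
Qed.

(** Positivity: (x.u)^2 = (Vx . Mu)^2 <= (x.Vx)(u.Mu) < u.Mu by Cauchy-Schwarz for the form M. The
    inverse is then checked by multiplication. *)
Lemma sherman_morrison M x : posdef M ->
  let V := invmx M in dot x (V *m x) < 1 ->
  posdef (M - x *m x^T) /\
  \tr (invmx (M - x *m x^T)) = \tr V + dot x (V *m V *m x) / (1 - dot x (V *m x)).
Proof.
move=> pM V; set s := dot x (V *m x) => s1.
have uM := posdef_unitmx pM; have pV : posdef V := posdef_inv pM.
have sV := proj1 pV.
have pD : posdef (M - x *m x^T).
  split; first by rewrite linearB /= trmx_mul trmxK (proj1 pM).
  move=> u u0; rewrite mulmxBl dotBr subr_gt0.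
  have -> : dot u (x *m x^T *m u) = dot x u ^+ 2.
    by rewrite -mulmxA (mx11_scalar (x^T *m u)) mul_mx_scalar dotZr -/(dot x u) (dotC u x) -expr2.
  have -> : dot x u = dot (V *m x) (M *m u).
    by rewrite dot_mulmx (proj1 pM) mulKVmx.
  apply: le_lt_trans (cauchy_schwarz_form (V *m x) u (posdefW pM)) _.
  rewrite mulKVmx// (dotC (V *m x)) -/s.
  by rewrite gtr_pMl// (proj2 pM).
split=> //.
have s1' : 1 - s != 0 by rewrite subr_eq0 eq_sym lt_eqF.
set a := V *m x.
have aT : x^T *m V = a^T by rewrite trmx_mul sV.
have E : invmx (M - x *m x^T) = V + (1 - s)^-1 *: (a *m a^T).
  have uD := posdef_unitmx pD.
  apply: (can_inj (mulKmx uD)); rewrite mulmxV//.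
  rewrite mulmxDr mulmxBl mulmxV// -mulmxA aT -scalemxAr mulmxBl.
  rewrite mulmxA /a mulKVmx// -/a -[x *m x^T *m _]mulmxA (mulmxA x^T).
  rewrite (mx11_scalar (x^T *m a)) -/(dot x a) -/s mul_scalar_mx -scalemxAr.
  rewrite -addrA -[LHS]addr0; congr (_ + _).
  rewrite -{1}[x *m a^T]scale1r -scaleNr -{2}[x *m a^T]scale1r -scalerBl scalerA -scalerDl.
  rewrite (_ : - 1 + _ = 0) ?scale0r//.
  by rewrite mulVf// addNr.
rewrite E linearD linearZ /= mxtrace_outer mulrC; congr (_ + _ / _).
by rewrite /a -mulmxA (dot_mulmx x) sV.
Qed.

End euclidean.

Section barrier.
Context {R : realType} {p : nat}.
Implicit Types (x : 'cV[R]_p) (M : 'M[R]_p).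

(* With N := M + b I, Sherman-Morrison bounds the increase of tr N^-1 caused by
   removing x x^T by 2 x^T N^-2 x, and raising M to N decreases the trace by at
   least b tr N^-2: the test asks that the former not exceed the latter. *)
Definition keep (b : R) M x : bool :=
  let V := invmx M in
  (dot x (V *m x) <= 1 / 2) && (2 * dot x (V *m V *m x) <= b * \tr (V *m V)).

Lemma keep_barrier b M x : 0 <= b -> posdef M -> keep b (M + b%:M) x ->
  posdef (M + b%:M - x *m x^T) /\
  \tr (invmx (M + b%:M - x *m x^T)) <= \tr (invmx M).
Proof.
move=> b0 pM /andP[]; set N := M + b%:M; set V := invmx N => h1 h2.
have pN : posdef N by exact: posdefD_scalar.
have s1 : dot x (V *m x) < 1 by apply: le_lt_trans h1 _; lra.
have [pD ->] := sherman_morrison pN s1.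
split=> //; apply: le_trans (mxtrace_inv_shift b0 pM); rewrite -/N -/V lerD2l.
apply: le_trans h2; rewrite mulrC; apply: ler_wpM2r.
  rewrite -mulmxA dot_mulmx (proj1 (posdef_inv pN)); exact: dot_ge0.
by rewrite -[leRHS]invrK lef_pV2 ?posrE//; lra.
Qed.

Lemma skip_barrier b M : 0 <= b -> posdef M ->
  posdef (M + b%:M) /\ \tr (invmx (M + b%:M)) <= \tr (invmx M).
Proof.
move=> b0 pM; have pN := posdefD_scalar b0 pM; split=> //.
apply: le_trans (mxtrace_inv_shift b0 pM); rewrite lerDl mulr_ge0//.
by apply: mxtrace_sqr_ge0; exact: (proj1 (posdef_inv pN)).
Qed.

Variables (b0 b : R) (xs : nat -> 'cV[R]_p).

(** The barrier is raised before the test: vector k' meets the level b0 + b (k' + 1), and the level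
    stays raised whether or not the vector is kept. *)
Fixpoint kept_moment k : 'M[R]_p :=
  if k is k'.+1 then
    let A := kept_moment k' in
    if keep b ((b0 + b * k'.+1%:R)%:M - A) (xs k')
    then A + xs k' *m (xs k')^T else A
  else 0.

Definition barrier k : 'M[R]_p := (b0 + b * k.+1%:R)%:M - kept_moment k.

Definition kept k : bool := keep b (barrier k) (xs k).

Lemma kept_momentE k :
  kept_moment k = \sum_(j < k | kept j) xs j *m (xs j)^T.
Proof.
elim: k => [|k IH]; first by rewrite big_ord0.
rewrite big_mkcond big_ord_recr /= -big_mkcond /= -IH.
by rewrite -/(barrier k) -/(kept k); case: ifP => // _; rewrite addr0.
Qed.

Lemma barrierE k :
  barrier k = (b0 + b * k%:R)%:M - kept_moment k + b%:M.
Proof.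
by rewrite /barrier -natr1 mulrDr mulr1 addrA raddfD /= addrAC.
Qed.

Hypotheses (b0_gt0 : 0 < b0) (b_ge0 : 0 <= b).

(** The potential starts at tr (b0 I)^-1 = p / b0 and neither branch increases it: the test
    guarantees this for a kept vector, and raising the barrier alone lowers the trace. *)
Lemma barrier_invariant k :
  let M := (b0 + b * k%:R)%:M - kept_moment k in
  posdef M /\ \tr (invmx M) <= p%:R / b0.
Proof.
elim: k => [|k [pM tM]] /=.
  rewrite mulr0 addr0 subr0; split.
    split; first by rewrite tr_scalar_mx.
    by move=> u u0; rewrite mul_scalar_mx dotZr mulr_gt0 ?dot_gt0.
  by rewrite invmx_scalar mxtrace_scalar mulr_natl.
rewrite -/(barrier k) -/(kept k).
case: ifPn => [|_].
  rewrite /kept opprD addrA -/(barrier k) barrierE.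
  by move=> /(keep_barrier b_ge0 pM)[? h]; split=> //; exact: le_trans tM.
rewrite -/(barrier k) barrierE.
by have [? h] := skip_barrier b_ge0 pM; split=> //; exact: le_trans tM.
Qed.

Lemma posdef_barrier k : posdef (barrier k).
Proof.
have [pM _] := barrier_invariant k; have [+ _] := skip_barrier b_ge0 pM.
by rewrite barrierE.
Qed.

Lemma mxtrace_inv_barrier k : \tr (invmx (barrier k)) <= p%:R / b0.
Proof.
have [pM tM] := barrier_invariant k; have [_ +] := skip_barrier b_ge0 pM.
by rewrite barrierE => h; exact: le_trans tM.
Qed.

(** This is the positivity half of the invariant; the trace half only serves to control how often
    the test fails. *)
Lemma kept_moment_le k v :
  \sum_(j < k | kept j) dot (xs j) v ^+ 2 <= (b0 + b * k%:R) * dot v v.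
Proof.
have [/posdefW[_ /(_ v) +] _] := barrier_invariant k.
rewrite mulmxBl dotBr mul_scalar_mx dotZr subr_ge0; apply: le_trans.
rewrite kept_momentE mulmx_suml dot_sumr; apply: ler_sum => j _.
by rewrite -mulmxA (mx11_scalar (_^T *m v)) mul_mx_scalar dotZr -/(dot (xs j) v) (dotC v) expr2.
Qed.

End barrier.

(** * Measurability and moments *)

Section measurable_matrices.
Context {d : measure_display} {T : measurableType d} {R : realType}.

Definition measurable_mx m n (A : T -> 'M[R]_(m, n)) : Prop :=
  forall i j, measurable_fun [set: T] (fun t => A t i j : R).

Lemma measurable_invr (f : T -> R) : measurable_fun [set: T] f ->
  measurable_fun [set: T] (fun t => (f t)^-1 : R).
Proof.
move=> mf.
(* The identity r^-1 = r (r^2)^-1 also holds at 0, where the inverse is 0 by convention, and leads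
   to the measurable [powR]. *)
have -> : (fun t => (f t)^-1) = (fun t => f t * powR (f t ^+ 2) (-1)).
  apply/funext => t; rewrite powR_inv1 ?sqr_ge0//.
  have [->|f0] := eqVneq (f t) 0; first by rewrite invr0 mul0r.
  by field.
apply: measurable_funM => //.
apply: (@measurableT_comp _ _ _ _ _ _ (fun r : R => powR r (-1))).
  exact: measurable_powR.
exact: measurable_funX.
Qed.

Lemma measurable_mx_cst m n (A : 'M[R]_(m, n)) : measurable_mx (fun=> A).
Proof. by move=> i j; exact: measurable_cst. Qed.

Lemma measurable_mxD m n (A B : T -> 'M[R]_(m, n)) :
  measurable_mx A -> measurable_mx B -> measurable_mx (fun t => A t + B t).
Proof.
move=> mA mB i j; under eq_fun do rewrite mxE.
by apply: measurable_funD.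
Qed.

Lemma measurable_mxB m n (A B : T -> 'M[R]_(m, n)) :
  measurable_mx A -> measurable_mx B -> measurable_mx (fun t => A t - B t).
Proof.
move=> mA mB i j; under eq_fun do rewrite !mxE.
by apply: measurable_funB.
Qed.

Lemma measurable_mxZ m n (a : R) (A : T -> 'M[R]_(m, n)) :
  measurable_mx A -> measurable_mx (fun t => a *: A t).
Proof.
move=> mA i j; under eq_fun do rewrite mxE.
by apply: measurable_funM => //; exact: measurable_cst.
Qed.

Lemma measurable_mx_tr m n (A : T -> 'M[R]_(m, n)) :
  measurable_mx A -> measurable_mx (fun t => (A t)^T).
Proof. by move=> mA i j; under eq_fun do rewrite mxE; exact: mA. Qed.

Lemma measurable_mxM m n k (A : T -> 'M[R]_(m, n)) (B : T -> 'M[R]_(n, k)) :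
  measurable_mx A -> measurable_mx B -> measurable_mx (fun t => A t *m B t).
Proof.
move=> mA mB i j; under eq_fun do rewrite mxE.
by apply: measurable_sum => l; exact: measurable_funM.
Qed.

Lemma measurable_mx_if m n (b : T -> bool) (A B : T -> 'M[R]_(m, n)) :
  measurable_fun [set: T] b -> measurable_mx A -> measurable_mx B ->
  measurable_mx (fun t => if b t then A t else B t).
Proof.
move=> mb mA mB i j; under eq_fun do rewrite (fun_if (fun M : 'M[R]_(m, n) => M i j)).
exact: measurable_fun_ifT.
Qed.

Lemma measurable_det n (A : T -> 'M[R]_n) :
  measurable_mx A -> measurable_fun [set: T] (fun t => \det (A t) : R).
Proof.
move=> mA; apply: measurable_sum => s.
by apply: measurable_funM; [exact: measurable_cst|apply: measurable_prod].
Qed.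

Lemma measurable_mxtrace n (A : T -> 'M[R]_n) :
  measurable_mx A -> measurable_fun [set: T] (fun t => \tr (A t) : R).
Proof. by move=> mA; apply: measurable_sum. Qed.

Lemma measurable_dot p (u v : T -> 'cV[R]_p) : measurable_mx u ->
  measurable_mx v -> measurable_fun [set: T] (fun t => dot (u t) (v t) : R).
Proof.
move=> mu mv; under eq_fun do rewrite dotE.
by apply: measurable_sum => j; exact: measurable_funM.
Qed.

(** Cramer's rule: the entries are cofactors divided by the determinant, hence rational functions of
    the entries. *)
Lemma measurable_invmx n (A : T -> 'M[R]_n) : (forall t, A t \in unitmx) ->
  measurable_mx A -> measurable_mx (fun t => invmx (A t)).
Proof.
move=> uA mA i j; under eq_fun do rewrite /invmx uA !mxE /cofactor.
apply: measurable_funM; first exact/measurable_invr/measurable_det.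
apply: measurable_funM; first exact: measurable_cst.
apply: measurable_det => k l; under eq_fun do rewrite !mxE.
exact: mA.
Qed.

End measurable_matrices.

Lemma measurable_coord (R : realType) p j :
  measurable_fun [set: vec R p] (fun v : vec R p => v j 0 : R).
Proof.
move=> _ B mB; rewrite setTI; apply: sub_sigma_algebra.
by exists j; exists B.
Qed.

Lemma measurable_vec_mx (d : measure_display) (T : measurableType d)
    (R : realType) p (x : T -> vec R p) :
  measurable_fun [set: T] x -> measurable_mx (x : T -> 'cV[R]_p).
Proof.
move=> mx j i; rewrite (ord1 i).
exact: (measurableT_comp (@measurable_coord R p j) mx).
Qed.

Section tail_bounds.
Context {d : measure_display} {Omega : measurableType d} {R : realType}
  (P : probability Omega R).

Lemma measurable_ge_set (f : Omega -> R) (c : R) : measurable_fun [set: Omega] f ->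
  measurable [set w | c <= f w].
Proof.
move=> mf; have := measurable_fun_ler (measurable_cst c) mf.
move=> h; have := h measurableT [set true]; rewrite setTI; exact.
Qed.

Lemma measurable_le_set (f : Omega -> R) (c : R) : measurable_fun [set: Omega] f ->
  measurable [set w | f w <= c].
Proof.
move=> mf; have := measurable_fun_ler mf (measurable_cst c).
move=> h; have := h measurableT [set true]; rewrite setTI; exact.
Qed.

Lemma markov_real (f : Omega -> R) (a c : R) :
  measurable_fun [set: Omega] f -> (forall w, 0 <= f w) -> 0 < c ->
  (\int[P]_w (f w)%:E <= a%:E)%E ->
  (P [set w | (c <= f w)%R] <= (a / c)%:E)%E.
Proof.
move=> mf f0 c0 fa; rewrite EFinM lee_pdivlMr//.
apply: le_trans fa.
have mD := measurable_ge_set c mf.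
have -> : (P [set w | (c <= f w)%R] * c%:E =
    \int[P]_w (c%:E * (\1_[set w | (c <= f w)%R] w)%:E))%E.
  rewrite ge0_integralZl//; last 2 first.
  - exact/measurable_EFinP/measurable_indic.
  - by rewrite lee_fin ltW.
  by rewrite integral_indic// setIT muleC.
apply: ge0_le_integral => //.
- by move=> w _; rewrite -EFinM lee_fin mulr_ge0// ltW.
- apply/measurable_EFinP; apply: measurable_funM; first exact: measurable_cst.
  exact: measurable_indic.
- exact/measurable_EFinP.
- move=> w _; rewrite -EFinM lee_fin indicE; case: (boolP (w \in _)).
    by rewrite inE mulr1.
  by rewrite mulr0.
Qed.

Lemma chernoff_bound (f : Omega -> R) (a t : R) : measurable_fun [set: Omega] f ->
  (\int[P]_w (expR (f w))%:E <= a%:E)%E ->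
  (P [set w | (t <= f w)%R] <= (a * expR (- t))%:E)%E.
Proof.
move=> mf fa.
have -> : [set w | t <= f w] = [set w | expR t <= expR (f w)].
  by apply/seteqP; split => w /=; rewrite ler_expR.
rewrite expRN; apply: markov_real => //.
- apply: measurableT_comp => //; exact: measurable_expR.
- exact: expR_gt0.
Qed.

End tail_bounds.

Lemma expR1_le4 (R : realType) : expR 1 <= 4 :> R.
Proof.
have h : expR (- (1 / 2)) * expR (1 / 2) = 1 :> R by rewrite -expRD addNr expR0.
have : 1 / 2 <= expR (- (1 / 2)) :> R.
  by apply: le_trans (expR_ge1Dx _); lra.
have : expR 1 = expR (1 / 2) * expR (1 / 2) :> R.
  by rewrite -expRD; congr expR; lra.
have := @expR_gt0 R (1 / 2); nra.
Qed.

Section second_moments.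
Context {d : measure_display} {Omega : measurableType d} {R : realType}
  (P : probability Omega R) {p : nat}.

Definition isotropic (x : Omega -> 'cV[R]_p) : Prop :=
  forall j k, (\int[P]_w (x w j 0 * x w k 0)%:E = ((1%:M : 'M[R]_p) j k)%:E)%E.

Variable x : Omega -> 'cV[R]_p.
Hypotheses (mx : measurable_mx x) (ix : isotropic x).

Lemma integrable_coordM j k : P.-integrable setT (EFin \o (fun w => x w j 0 * x w k 0)).
Proof.
have isq i : P.-integrable setT (EFin \o (fun w => x w i 0 * x w i 0)).
  apply/integrableP; split.
    by apply/measurable_EFinP; exact: measurable_funM.
  under eq_integral do rewrite /= ger0_norm -?expr2 ?sqr_ge0// expr2.
  by rewrite ix ltry.
have h := integrableD measurableT (isq j) (isq k).
apply: le_integrable h => //.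
  by apply/measurable_EFinP; exact: measurable_funM.
move=> w _ /=; rewrite lee_fin -!expr2 normrM.
rewrite [leRHS]ger0_norm ?addr_ge0 ?sqr_ge0//.
rewrite -(real_normK (num_real (x w j 0))) -(real_normK (num_real (x w k 0))).
have := sqr_ge0 (`|x w j 0| - `|x w k 0|).
have := normr_ge0 (x w j 0); have := normr_ge0 (x w k 0).
by move: `|x w j 0| `|x w k 0| => a b; nra.
Qed.

Lemma integral_quadratic_form (M : 'M[R]_p) :
  (\int[P]_w (dot (x w) (M *m x w))%:E = (\tr M)%:E)%E.
Proof.
have E w : ((dot (x w) (M *m x w))%:E =
    \sum_j \sum_k (M j k)%:E * (x w j 0 * x w k 0)%:E)%E.
  rewrite dotE -sumEFin; apply: eq_bigr => j _; rewrite mxE mulr_sumr -sumEFin.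
  by apply: eq_bigr => k _; rewrite -EFinM; congr EFin; ring.
under eq_integral do rewrite E.
have iM j k : P.-integrable setT (fun w => (M j k)%:E * (x w j 0 * x w k 0)%:E)%E.
  by apply: integrableZl => //; exact: integrable_coordM.
rewrite integral_sum//=; last by move=> j; apply: integrable_sum => // k _; exact: iM.
rewrite /mxtrace -sumEFin; apply: eq_bigr => j _.
rewrite integral_sum// (bigD1 j)//= big1 ?adde0 => [|k kj].
  rewrite integralZl//; last exact: integrable_coordM.
  by rewrite ix mxE eqxx mule1.
rewrite integralZl//; last exact: integrable_coordM.
by rewrite ix mxE eq_sym (negbTE kj) mule0.
Qed.

Lemma integral_dot_sqr v : (\int[P]_w (dot v (x w) ^+ 2)%:E = (dot v v)%:E)%E.
Proof.
rewrite -mxtrace_outer -integral_quadratic_form; apply: eq_integral => w _.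
congr EFin; rewrite -mulmxA (mx11_scalar (v^T *m x w)) mul_mx_scalar dotZr.
by rewrite -/(dot v (x w)) (dotC (x w)) expr2.
Qed.

End second_moments.

Section barrier_probability.
Context {d : measure_display} {Omega : measurableType d} {R : realType}
  (P : probability Omega R) {p : nat}.

(** From (x1 - x2)'M(x1 - x2) <= 2 x1'M x1 + 2 x2'M x2, halved by the normalization; each form has
    mean tr M. *)
Lemma integral_quadratic_form_diff (x1 x2 : Omega -> 'cV[R]_p) (M : 'M[R]_p) :
  measurable_mx x1 -> measurable_mx x2 -> isotropic P x1 -> isotropic P x2 ->
  possemidef M ->
  (\int[P]_w (dot ((Num.sqrt 2)^-1 *: (x1 w - x2 w))
     (M *m ((Num.sqrt 2)^-1 *: (x1 w - x2 w))))%:E <= (2 * \tr M)%:E)%E.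
Proof.
move=> m1 m2 i1 i2 [sM pM].
have mq (x : Omega -> 'cV[R]_p) : measurable_mx x ->
    measurable_fun [set: Omega] (fun w => (dot (x w) (M *m x w))%:E).
  move=> mx; apply/measurable_EFinP/measurable_dot => //.
  by apply: measurable_mxM => //; exact: measurable_mx_cst.
apply: (@le_trans _ _ (\int[P]_w ((dot (x1 w) (M *m x1 w))%:E +
    (dot (x2 w) (M *m x2 w))%:E))%E).
  apply: ge0_le_integral => //.
  - by move=> w _; rewrite lee_fin.
  - apply: (mq (fun w => (Num.sqrt 2)^-1 *: (x1 w - x2 w))).
    by apply: measurable_mxZ; exact: measurable_mxB.
  - by apply: emeasurable_funD; exact: mq.
  - move=> w _; rewrite -EFinD lee_fin.
    have := pM (x1 w + x2 w); rewrite -scalemxAr dotZl dotZr mulrA -expr2 exprVn.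
    rewrite sqr_sqrtr// mulmxDr mulmxBr !(dotDr, dotDl, dotBr, dotBl, dotNr, dotNl).
    lra.
rewrite ge0_integralD//; last 4 first.
- by move=> w _; rewrite lee_fin.
- exact: mq.
- by move=> w _; rewrite lee_fin.
- exact: mq.
by rewrite !integral_quadratic_form// -EFinD lee_fin; lra.
Qed.

End barrier_probability.

(** * Few covariates are discarded *)

Lemma measurable_mx_comp (d1 d2 : measure_display) (T1 : measurableType d1)
    (T2 : measurableType d2) (R : realType) m n (A : T2 -> 'M[R]_(m, n))
    (f : T1 -> T2) :
  measurable_mx A -> measurable_fun [set: T1] f -> measurable_mx (fun t => A (f t)).
Proof. by move=> mA mf i j; exact: (measurableT_comp (mA i j) mf). Qed.

Lemma measurable_generated_by (d d' : measure_display)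
    (Omega : measurableType d) (S : measurableType d') (I : finType)
    (X : I -> Omega -> S) (J : {set I}) i : i \in J ->
  measurable_fun [set: g_sigma_algebraType (generated_by X J)] (X i).
Proof.
move=> iJ _ B mB; rewrite setTI; apply: sub_sigma_algebra.
by exists i => //; exists B.
Qed.

Lemma measurable_keep (d : measure_display) (T : measurableType d)
    (R : realType) p (b : R) (M : T -> 'M[R]_p) (y : T -> 'cV[R]_p) :
  (forall t, M t \in unitmx) -> measurable_mx M -> measurable_mx y ->
  measurable_fun [set: T] (fun t => keep b (M t) (y t)).
Proof.
move=> uM mM my; have mV := measurable_invmx uM mM.
have mVV := measurable_mxM mV mV.
apply: measurable_and; apply: measurable_fun_ler; try exact: measurable_cst.
- by apply: measurable_dot => //; exact: measurable_mxM.
- apply: measurable_funM; first exact: measurable_cst.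
  by apply: measurable_dot => //; exact: measurable_mxM.
- apply: measurable_funM; first exact: measurable_cst.
  exact: measurable_mxtrace.
Qed.

(** For a symmetric V this trace is the squared Frobenius norm. It becomes a denominator when the
    second half of the test is normalized. *)
Lemma mxtrace_sqr_gt0 (R : realType) p (V : 'M[R]_p) : (0 < p)%N -> posdef V ->
  0 < \tr (V *m V).
Proof.
case: p V => // p V _ [sV pV]; rewrite lt_def mxtrace_sqr_ge0// andbT.
apply/eqP => tV0.
have d0 : delta_mx ord0 0 != 0 :> 'cV[R]_p.+1.
  by apply/eqP => /colP /(_ ord0); rewrite !mxE !eqxx => /eqP; rewrite oner_eq0.
have := pV _ d0; rewrite -colE dotE big1 ?ltxx// => i _.
have : \sum_i (V *m V) i i = 0 by exact: tV0.
have E k : (V *m V) k k = \sum_j V j k ^+ 2.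
  by rewrite mxE; apply: eq_bigr => j _; rewrite -{1}sV mxE expr2.
move=> /psumr_eq0P -/(_ _ ord0 isT); rewrite E => H.
have /psumr_eq0P /(_ i isT) : \sum_j V j ord0 ^+ 2 = 0.
  by apply: H => k _; rewrite E; apply: sumr_ge0 => j _; exact: sqr_ge0.
move=> h; have /eqP := h (fun j _ => sqr_ge0 _).
by rewrite sqrf_eq0 => /eqP; rewrite [X in _ * X]mxE => ->; rewrite mulr0.
Qed.

(* Samples i and n + i share the label i, so the blocks of samples read at distinct
   steps are independent. *)
Definition pair_label n (i : 'I_(n + n)) : nat := (i %% n)%N.

Lemma pair_label_lshift n (i : 'I_n) : pair_label (lshift n i) = i.
Proof. by rewrite /pair_label /= modn_small. Qed.

Lemma pair_label_rshift n (i : 'I_n) : pair_label (rshift n i) = i.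
Proof. by rewrite /pair_label /= modnDl modn_small. Qed.

Section filtered_covariates.
Context {d : measure_display} {Omega : measurableType d} {R : realType}
  (P : probability Omega R) {n p : nat}.
Variables (x : 'I_(n + n) -> Omega -> vec R p) (b : R).
Hypotheses (p_gt0 : (0 < p)%N) (pn : (p <= n)%N) (b_gt0 : 0 < b).
Hypotheses (mx : forall i, measurable_fun setT (x i))
  (indx : mutually_independent P x) (isox : forall i, isotropic P (x i)).

(** Indices k >= n get the zero vector: the barrier procedure runs on infinite sequences, but only
    the first n terms matter. *)
Definition diff_sequence (w : Omega) (k : nat) : 'cV[R]_p :=
  oapp (diff_covariates (x^~ w)) 0 (insub k : option 'I_n).

Lemma diff_sequenceE w (i : 'I_n) :
  diff_sequence w i = diff_covariates (x^~ w) i.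
Proof. by rewrite /diff_sequence valK. Qed.

(** With this starting level the potential is at most p / (b n) <= 1 / b as soon as p <= n. *)
Let b0 := b * n%:R.

Let n_gt0 : (0 < n)%N. Proof. exact: leq_trans pn. Qed.

Let b0_gt0 : 0 < b0. Proof. by rewrite mulr_gt0// ltr0n. Qed.

Let past := past x (@pair_label n).
Let present := present x (@pair_label n).

Lemma measurable_diff_sequence k :
  measurable_mx (T := g_sigma_algebraType (present k))
    (fun w => diff_sequence w k).
Proof.
rewrite /diff_sequence; case: insubP => [i _ ik|_]; last exact: measurable_mx_cst.
apply/measurable_mxZ/measurable_mxB; apply: measurable_vec_mx.
  by apply: measurable_generated_by; rewrite inE pair_label_lshift -ik.
by apply: measurable_generated_by; rewrite inE pair_label_rshift -ik.
Qed.

Let posdef_bar w k := @posdef_barrier R p b0 b (diff_sequence w) b0_gt0 (ltW b_gt0) k.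

Lemma measurable_kept_moment k :
  measurable_mx (T := g_sigma_algebraType (past k))
    (fun w => kept_moment b0 b (diff_sequence w) k).
Proof.
elim: k => [|k IH]; first exact: measurable_mx_cst.
have mA : measurable_mx (T := g_sigma_algebraType (past k.+1))
    (fun w => kept_moment b0 b (diff_sequence w) k).
  apply: (measurable_mx_comp IH); apply: measurable_fun_sub_sigma_algebra.
  by apply: sub_sigma_algebra2; exact: sub_past.
have my : measurable_mx (T := g_sigma_algebraType (past k.+1))
    (fun w => diff_sequence w k).
  apply: (measurable_mx_comp (measurable_diff_sequence (k := k))).
  apply: measurable_fun_sub_sigma_algebra.
  by apply: sub_sigma_algebra2; exact: present_sub_past.
apply: measurable_mx_if => //; last first.
  by apply: measurable_mxD => //; apply: measurable_mxM => //; exact: measurable_mx_tr.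
apply: measurable_keep => //.
- by move=> w; apply: posdef_unitmx; exact: posdef_bar.
- by apply: measurable_mxB => //; exact: measurable_mx_cst.
Qed.

Lemma measurable_barrier k :
  measurable_mx (T := g_sigma_algebraType (past k))
    (fun w => barrier b0 b (diff_sequence w) k).
Proof.
by apply: measurable_mxB; [exact: measurable_mx_cst|exact: measurable_kept_moment].
Qed.

(** The exponential of the discard indicator, in decoupled form: the barrier is computed from the
    past copy, the tested covariate from the present copy. *)
Let g k (u : g_sigma_algebraType (past k) * g_sigma_algebraType (present k)) : R :=
  if keep b (barrier b0 b (diff_sequence u.1) k) (diff_sequence u.2 k)
  then 1 else expR 1.

Let mg k :
  measurable_fun [set: g_sigma_algebraType (past k) * g_sigma_algebraType (present k)]
    (@g k).
Proof.
apply: measurable_fun_ifT => //.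
apply: measurable_keep.
- by move=> u; apply: posdef_unitmx; exact: posdef_bar.
- exact: (measurable_mx_comp (measurable_barrier (k := k)) measurable_fst).
- exact: (measurable_mx_comp (measurable_diff_sequence (k := k)) measurable_snd).
Qed.

(* A failed test forces q >= 1, while E x x^T = I bounds the mean of the quadratic
   form q, given the past, by 2 tr Q <= 8 / b. *)
Let step_bound k : (k < n)%N -> forall w,
  (\int[P]_w' (@g k (w, w'))%:E <= (expR (24 / b))%:E)%E.
Proof.
move=> kn w; set M := barrier b0 b (diff_sequence w) k.
have pM : posdef M by exact: posdef_bar.
set V := invmx M; have pV : posdef V := posdef_inv pM.
have tVV : 0 < \tr (V *m V) by exact: mxtrace_sqr_gt0.
have sV := proj1 pV.
(* If the second half of the test fails, 2 x'V^2 x > b tr V^2, so c x'V^2 x > 1. The coefficient 2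
   of V in [Q] plays the same role for the first half. *)
pose c := 2 / (b * \tr (V *m V)).
have c_gt0 : 0 < c by rewrite divr_gt0// mulr_gt0.
pose Q := 2 *: V + c *: (V *m V).
have dVV u : 0 <= dot u (V *m V *m u).
  by rewrite -mulmxA dot_mulmx sV; exact: dot_ge0.
have dV u : 0 <= dot u (V *m u) by exact: (proj2 (posdefW pV)).
have QE u : dot u (Q *m u) = 2 * dot u (V *m u) + c * dot u (V *m V *m u).
  by rewrite mulmxDl dotDr -!scalemxAl !dotZr.
have pQ : possemidef Q.
  split; first by rewrite linearD /= !linearZ /= trmx_mul sV.
  move=> u; rewrite QE; apply: addr_ge0; apply: mulr_ge0 => //; exact: ltW.
pose i := Ordinal kn.
pose q (w' : Omega) := dot ((Num.sqrt 2)^-1 *: (x (lshift n i) w' - x (rshift n i) w'))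
  (Q *m ((Num.sqrt 2)^-1 *: (x (lshift n i) w' - x (rshift n i) w'))).
have mq : measurable_fun [set: Omega] q.
  have my : measurable_mx (fun w' => (Num.sqrt 2)^-1 *: (x (lshift n i) w' - x (rshift n i) w')).
    by apply/measurable_mxZ/measurable_mxB; exact: measurable_vec_mx.
  by apply: measurable_dot => //; apply: measurable_mxM => //; exact: measurable_mx_cst.
have q0 w' : 0 <= q w' by exact: (proj2 pQ).
(* The constant 3 comes from e <= 4 = 1 + 3. *)
have gq w' : @g k (w, w') <= 1 + 3 * q w'.
  rewrite /g /= (_ : diff_sequence w' k = diff_covariates (x^~ w') i); last first.
    by rewrite -diff_sequenceE.
  rewrite -/M; case: ifPn => [_|]; first by rewrite lerDl mulr_ge0.
  rewrite /keep -/V negb_and -!ltNge => H.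
  have -> : q w' = 2 * dot (diff_covariates (x^~ w') i) (V *m diff_covariates (x^~ w') i)
    + c * dot (diff_covariates (x^~ w') i) (V *m V *m diff_covariates (x^~ w') i).
    by rewrite -QE.
  have h1 := dV (diff_covariates (x^~ w') i).
  have h2 : 0 <= c * dot (diff_covariates (x^~ w') i) (V *m V *m diff_covariates (x^~ w') i).
    by apply: mulr_ge0 => //; exact: ltW.
  have h3 := @expR1_le4 R.
  suff : 1 <= 2 * dot (diff_covariates (x^~ w') i) (V *m diff_covariates (x^~ w') i)
    + c * dot (diff_covariates (x^~ w') i) (V *m V *m diff_covariates (x^~ w') i) by lra.
  case/orP: H => H; first by lra.
  suff : 1 <= c * dot (diff_covariates (x^~ w') i) (V *m V *m diff_covariates (x^~ w') i) by lra.
  by rewrite /c mulrAC ler_pdivlMr ?mulr_gt0// mul1r ltW.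
apply: (@le_trans _ _ (\int[P]_w' (1%:E + 3%:E * (q w')%:E))%E).
  apply: ge0_le_integral => //.
  - by move=> w' _; rewrite lee_fin /g; case: ifP => // _; exact: expR_ge0.
  - apply/measurable_EFinP.
    have := measurable_fun_pair2 w (mg (k := k)) => h.
    exact: (measurable_comp _ _ h (measurable_sub_sigma_algebra
      (generated_by_measurable mx (J := [set i | pair_label i == k]%SET)))).
  - apply: emeasurable_funD; first exact: measurable_cst.
    by apply/measurable_EFinP; apply: measurable_funM => //; exact: measurable_cst.
  - by move=> w' _; rewrite -EFinM -EFinD lee_fin.
rewrite ge0_integralD//; last 2 first.
- by move=> w' _; rewrite -EFinM lee_fin mulr_ge0.
- by apply/measurable_EFinP; apply: measurable_funM => //; exact: measurable_cst.
rewrite integral_cst//= mul1e probability_setT ge0_integralZl//; last 2 first.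
- exact/measurable_EFinP.
- by move=> w' _; rewrite lee_fin.
have iq : (\int[P]_w' (q w')%:E <= (2 * \tr Q)%:E)%E.
  apply: integral_quadratic_form_diff => //; exact: measurable_vec_mx.
have tQ : \tr Q = 2 * \tr V + 2 / b.
  rewrite linearD /= !linearZ /= /c; congr (_ + _).
  by rewrite invfM mulrA divfK// gt_eqF.
have tV : \tr V <= 1 / b.
  apply: le_trans (mxtrace_inv_barrier _ b0_gt0 (ltW b_gt0) k) _.
  rewrite /b0 invfM mulrCA div1r ler_piMr ?invr_ge0 ?(ltW b_gt0)//.
  by rewrite ler_pdivrMr ?ltr0n// mul1r ler_nat.
(* Since tr V <= 1 / b, tr Q <= 4 / b; the mean is at most 1 + 24 / b <= exp (24 / b). *)
apply: (@le_trans _ _ (1%:E + 3%:E * (2 * \tr Q)%:E)%E).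
  by rewrite leeD2l// lee_wpmul2l.
rewrite -EFinM -EFinD lee_fin; apply: le_trans (expR_ge1Dx _).
rewrite lerD2l tQ; move: tV; rewrite div1r.
by rewrite [24 / b]mulrC [2 / b]mulrC; move: (b^-1) => e; lra.
Qed.

Definition discarded (w : Omega) : R :=
  \sum_(k < n) (~~ kept b0 b (diff_sequence w) k)%:R.

Lemma expR_discarded w : expR (discarded w) = \prod_(k < n) @g k (w, w).
Proof.
rewrite /discarded expR_sum; apply: eq_bigr => k _; rewrite /g /kept /=.
by case: ifP => //= _; rewrite expR0.
Qed.

Lemma measurable_discarded : measurable_fun [set: Omega] discarded.
Proof.
apply: measurable_sum => k.
have -> : (fun w => (~~ kept b0 b (diff_sequence w) k)%:R : R) =
    (fun w => if kept b0 b (diff_sequence w) k then 0 else 1).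
  by apply/funext => w; case: kept.
apply: measurable_fun_ifT => //.
have mO C : <<s past k.+1 >> C -> measurable C.
  move: C; apply: smallest_sub; first exact: sigma_algebra_measurable.
  exact: generated_by_measurable.
have mid : measurable_fun [set: Omega] (id : Omega -> g_sigma_algebraType (past k.+1)).
  by move=> _ B mB; rewrite setTI; exact: mO.
apply: measurable_keep.
- by move=> u; apply: posdef_unitmx; exact: posdef_bar.
- have h : measurable_fun [set: g_sigma_algebraType (past k.+1)]
      (id : g_sigma_algebraType (past k.+1) -> g_sigma_algebraType (past k)).
    apply: measurable_fun_sub_sigma_algebra.
    by apply: sub_sigma_algebra2; exact: sub_past.
  exact: (measurable_mx_comp (measurable_barrier (k := k)) (measurableT_comp h mid)).
- have h : measurable_fun [set: g_sigma_algebraType (past k.+1)]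
      (id : g_sigma_algebraType (past k.+1) -> g_sigma_algebraType (present k)).
    apply: measurable_fun_sub_sigma_algebra.
    by apply: sub_sigma_algebra2; exact: present_sub_past.
  exact: (measurable_mx_comp (measurable_diff_sequence (k := k)) (measurableT_comp h mid)).
Qed.

Lemma discarded_tail (t : R) :
  (P [set w | (t <= discarded w)%R] <= (expR (24 / b * n%:R - t))%:E)%E.
Proof.
rewrite expRD; apply: chernoff_bound; first exact: measurable_discarded.
under eq_integral do rewrite expR_discarded.
have := @sequential_product_le _ _ _ _ P _ _ x (@pair_label n) mx indx g mg _
  (fun=> expR (24 / b)) n step_bound.
rewrite prodr_const card_ord -expRM_natr; apply.
by move=> k u; rewrite /g; case: ifP => // _; exact: expR_ge0.
Qed.

End filtered_covariates.

(** * Stability and moment bounds *)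

Lemma sqr_avg_le (R : realType) (I : finType) (A : {set I}) (a : I -> R) :
  (#|A|%:R^-1 * \sum_(i in A) a i) ^+ 2 <= #|A|%:R^-1 * \sum_(i in A) a i ^+ 2.
Proof.
set k : R := #|A|%:R; set m := k^-1 * _.
have [k0|kn0] := eqVneq k 0.
  by rewrite /m k0 invr0 !mul0r expr0n.
have kgt0 : 0 < k by rewrite lt_def kn0 ler0n.
have : 0 <= \sum_(i in A) (a i - m) ^+ 2 by apply: sumr_ge0 => i _; exact: sqr_ge0.
have -> : \sum_(i in A) (a i - m) ^+ 2 =
    \sum_(i in A) a i ^+ 2 - 2 * m * (\sum_(i in A) a i) + k * m ^+ 2.
  rewrite mulr_sumr -sumrB (_ : k * _ = \sum_(i in A) m ^+ 2); last first.
    by rewrite sumr_const mulr_natl.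
  by rewrite -big_split /=; apply: eq_bigr => i _; ring.
have -> : \sum_(i in A) a i = k * m by rewrite /m mulrA divff// mul1r.
by move=> h; rewrite ler_pdivlMl//; lra.
Qed.

Section operator_norm.
Context {R : realType} {p : nat}.
Implicit Types (M N : 'M[R]_p) (u v : 'cV[R]_p).

(** The Frobenius norm is such a constant. A finite bound is what makes the [sup] in [opnorm] a true
    supremum. *)
Lemma norm2_mulmx_bound N : exists2 c, 0 <= c & forall v, norm2 (N *m v) <= c * norm2 v.
Proof.
pose F := \sum_i dot (row i N)^T (row i N)^T.
have F0 : 0 <= F by apply: sumr_ge0 => i _; exact: dot_ge0.
exists (Num.sqrt F) => [|v]; first by exact: sqrtr_ge0.
rewrite norm2_le ?mulr_ge0 ?sqrtr_ge0 ?norm2_ge0// exprMn sqr_sqrtr// norm2_sq.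
rewrite dotE mulr_suml; apply: ler_sum => i _.
have -> : (N *m v) i 0 = dot (row i N)^T v by rewrite /dot trmxK -row_mul [RHS]mxE.
by rewrite -expr2 cauchy_schwarz.
Qed.

Lemma norm2_mulmx_le N v : norm2 (N *m v) <= opnorm N * norm2 v.
Proof.
have [->|v0] := eqVneq v 0; first by rewrite mulmx0 norm2_0 mulr0.
have nv := norm2_gt0 v0.
rewrite -ler_pdivrMr//.
have -> : norm2 (N *m v) / norm2 v = norm2 (N *m ((norm2 v)^-1 *: v)).
  by rewrite -scalemxAr norm2Z mulrC ger0_norm// invr_ge0 norm2_ge0.
apply: ub_le_sup.
  have [c c0 Nc] := norm2_mulmx_bound N; exists c => _ [u /= u1 <-].
  by apply: le_trans (Nc u) _; rewrite ler_piMr.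
exists ((norm2 v)^-1 *: v) => //=.
by rewrite norm2Z ger0_norm ?invr_ge0 ?norm2_ge0// mulVf// gt_eqF.
Qed.

Lemma opnorm_le N c : (forall v, norm2 v <= 1 -> norm2 (N *m v) <= c) -> opnorm N <= c.
Proof.
move=> Nc; apply: ge_sup; last by move=> _ [v /= v1 <-]; exact: Nc.
by exists (norm2 (N *m 0)); exists 0 => //=; rewrite norm2_0.
Qed.

(** Cauchy-Schwarz for the form M between u = M v and v: |u|^4 <= (u.Mu)(v.Mv) <= c |u|^2 c
    |v|^2. *)
Lemma norm2_possemidef_le M c : possemidef M -> 0 <= c ->
  (forall v, dot v (M *m v) <= c * dot v v) ->
  forall v, norm2 (M *m v) <= c * norm2 v.
Proof.
move=> pM c0 Mc v; rewrite norm2_le ?mulr_ge0 ?norm2_ge0// exprMn norm2_sq.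
set u := M *m v; have [->|u0] := eqVneq u 0.
  by rewrite dot0l mulr_ge0 ?sqr_ge0 ?dot_ge0.
have du := dot_gt0 u0.
have := cauchy_schwarz_form u v pM; rewrite -/u => h.
rewrite -(ler_pM2l du) -expr2; apply: le_trans h _.
have -> : dot u u * (c ^+ 2 * dot v v) = (c * dot u u) * (c * dot v v) by ring.
by apply: ler_pM; rewrite ?(proj2 pM) ?Mc.
Qed.

End operator_norm.

Section stability_vs_moment_bound.
Context {R : realType} {n p : nat}.
Implicit Types (T : 'I_n -> 'cV[R]_p) (A : {set 'I_n}) (v : 'cV[R]_p).

Lemma dot_emp_second_moment T A v :
  dot v (emp_second_moment 0 T A *m v) =
  #|A|%:R^-1 * \sum_(i in A) dot (T i) v ^+ 2.
Proof.
rewrite /emp_second_moment -scalemxAl dotZr mulmx_suml dot_sumr; congr (_ * _).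
apply: eq_bigr => i _; rewrite subr0 -mulmxA (mx11_scalar (_^T *m v)).
by rewrite mul_mx_scalar dotZr -/(dot (T i) v) (dotC v) expr2.
Qed.

Lemma possemidef_emp_second_moment T A : possemidef (emp_second_moment 0 T A).
Proof.
split.
  rewrite /emp_second_moment linearZ /= linear_sum /=; congr (_ *: _).
  by apply: eq_bigr => i _; rewrite trmx_mul trmxK.
move=> v; rewrite dot_emp_second_moment mulr_ge0 ?invr_ge0//.
by apply: sumr_ge0 => i _; exact: sqr_ge0.
Qed.

(* Stability is only asked for a radius delta exceeding the moment constant c, so
   neither closeness to the mean nor closeness to the identity carries content. *)
Lemma stable_of_moment_bound T A (c eps delta : R) :
  0 < eps -> eps < 1 / 2 -> 0 <= c -> 1 + c <= delta ->
  (forall v, \sum_(i in A) dot (T i) v ^+ 2 <= c * #|A|%:R * dot v v) ->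
  stable eps delta 0 1 T A.
Proof.
move=> e0 e1 c0 cd TA; split=> //; first by lra.
move=> A' A'A hA'.
(* A' keeps at least half of A, so renormalizing the moments by its size costs at most a factor
   2. *)
have cA' v : #|A'|%:R^-1 * \sum_(i in A') dot (T i) v ^+ 2 <= 2 * c * dot v v.
  have [k0|k0] := eqVneq (#|A'|%:R : R) 0.
    by rewrite k0 invr0 mul0r !mulr_ge0// dot_ge0.
  have kp : 0 < #|A'|%:R :> R by rewrite lt_def k0 ler0n.
  rewrite ler_pdivrMl//; apply: (@le_trans _ _ (\sum_(i in A) dot (T i) v ^+ 2)).
    rewrite [leRHS](big_setID A') /= (finset.setIidPr A'A) lerDl.
    by apply: sumr_ge0 => i _; exact: sqr_ge0.
  apply: le_trans (TA v) _.
  rewrite (_ : #|A'|%:R * _ = c * (2 * #|A'|%:R) * dot v v); last by ring.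
  apply: ler_wpM2r; first exact: dot_ge0.
  apply: ler_wpM2l => //.
  have : 0 <= #|A|%:R :> R by []. nra.
rewrite !mul1r !expr1n; split.
  rewrite subr0 norm2_le; last by lra.
  set m := emp_mean T A'.
  (* The mean is tested against itself: Jensen gives |m|^4 <= 2 c |m|^2, and 2 c <= (1 + c)^2 <=
     delta^2. *)
  have E : dot m m = #|A'|%:R^-1 * \sum_(i in A') dot (T i) m.
    rewrite {1}/m /emp_mean dotZl; congr (_ * _).
    by rewrite dotC dot_sumr; apply: eq_bigr => i _; rewrite dotC.
  have h : dot m m ^+ 2 <= 2 * c * dot m m.
    by rewrite {1}E; apply: le_trans (sqr_avg_le _ _) (cA' m).
  have m0 := dot_ge0 m.
  have : dot m m <= 2 * c.
    rewrite leNgt; apply/negP => hm; have : 0 < dot m m by lra.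
    nra.
  nra.
apply: opnorm_le => v v1.
rewrite mulmxBl mul1mx; apply: le_trans (norm2_triangle _ _) _.
rewrite norm2N.
have h : norm2 (emp_second_moment 0 T A' *m v) <= 2 * c * norm2 v.
  apply: norm2_possemidef_le; [exact: possemidef_emp_second_moment|lra|].
  by move=> u; rewrite dot_emp_second_moment.
apply: (@le_trans _ _ (2 * c + 1)).
  have := norm2_ge0 v; nra.
rewrite ler_pdivlMr//; nra.
Qed.

(** Stability is applied to A' = A: the second moment is the identity plus a matrix of norm at most
    delta^2 / eps. *)
Lemma moment_bound_of_stable T A (eps delta : R) : (0 < #|A|)%N ->
  stable eps delta 0 1 T A ->
  forall v, \sum_(i in A) dot (T i) v ^+ 2 <=
    (1 + delta ^+ 2 / eps) * #|A|%:R * dot v v.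
Proof.
move=> A0 [e0 e1 _ /(_ A (fintype.subxx _))].
have kp : 0 < #|A|%:R :> R by rewrite ltr0n.
rewrite ler_piMl//; last by lra.
rewrite !expr1n !mul1r => /(_ isT)[_ h] v.
have := dot_emp_second_moment T A v.
set M := emp_second_moment 0 T A in h * => E.
rewrite -[leLHS](mulVKf (lt0r_neq0 kp)) -E mulrAC mulrC ler_pM2r//.
have -> : M = 1%:M + (M - 1%:M) by rewrite addrCA subrr addr0.
rewrite mulmxDl dotDr mul1mx mulrDl mul1r lerD2l.
apply: le_trans (ler_norm _) _; apply: le_trans (cauchy_schwarz_norm2 _ _) _.
apply: (@le_trans _ _ (norm2 v * (delta ^+ 2 / eps * norm2 v))).
  apply: ler_wpM2l; first exact: norm2_ge0.
  apply: le_trans (norm2_mulmx_le _ _) _.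
  by apply: ler_wpM2r; [exact: norm2_ge0|exact: h].
by rewrite -norm2_sq expr2 mulrCA.
Qed.

End stability_vs_moment_bound.

(** * Euclidean nets *)

Section net.
Context {R : realType}.

Lemma sum_expRN_le2 m : \sum_(a < m) expR (- a%:R) <= 2 :> R.
Proof.
apply: (@le_trans _ _ (2 - 2 * (1 / 2) ^+ m)); last first.
  by rewrite lerBlDr lerDl mulr_ge0// exprn_ge0//; lra.
elim: m => [|m IH]; first by rewrite big_ord0 expr0; lra.
rewrite big_ord_recr /=; have : expR (- m%:R) <= (1 / 2) ^+ m :> R.
  rewrite expRN -[m%:R]mul1r expRM_natr -exprVn lerXn2r ?nnegrE ?invr_ge0 ?expR_ge0//.
  rewrite div1r lef_pV2 ?posrE ?expR_gt0//.
  by apply: le_trans (expR_ge1Dx 1); lra.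
by rewrite exprS; lra.
Qed.

(* The indicator of (weight <= L) is at most exp (L - weight), and the sum of
   exp (- weight) factorizes over the coordinates. *)
Lemma card_weight_le p m (L : R) :
  #|[set f : {ffun 'I_p -> bool * 'I_m} |
      \sum_j (f j).2%:R <= L]%SET|%:R <= expR (L + 2 * p%:R).
Proof.
rewrite -sum1_card natr_sum.
pose F (c : bool * 'I_m) : R := expR (- c.2%:R).
apply: (@le_trans _ _ (\sum_(f : {ffun 'I_p -> bool * 'I_m})
    expR L * \prod_j F (f j))).
  rewrite [leLHS]big_mkcond; apply: ler_sum => f _; rewrite inE.
  rewrite /F -expR_sum -expRD sumrN; case: ifPn => [fL|_]; last exact: expR_ge0.
  by rewrite -[leLHS]expR0 ler_expR subr_ge0.
rewrite -mulr_sumr expRD; apply: ler_wpM2l; first exact: expR_ge0.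
rewrite -(bigA_distr_bigA (fun (j : 'I_p) c => F c)) prodr_const card_ord.
rewrite expRM_natr; apply: lerXn2r; rewrite ?nnegrE ?expR_ge0//.
  by apply: sumr_ge0 => c _; exact: expR_ge0.
(* Each of the two signs contributes at most 2 per coordinate, and 2 * 2 <= e^2: this is the 2 in
   the exponent. *)
rewrite -(pair_bigA _ (fun (s : bool) (a : 'I_m) => F (s, a))) /=.
rewrite big_bool /= /F /=; have h := sum_expRN_le2 m.
apply: (@le_trans _ _ (2 * 2)); first by lra.
have -> : 2 = 1 + 1 :> R by lra.
rewrite expRD; apply: ler_pM; rewrite ?addr_ge0//; exact: expR_ge1Dx.
Qed.

Lemma dot_sum_norm_le p (v : 'cV[R]_p) :
  \sum_j `|v j 0| <= Num.sqrt p%:R * norm2 v.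
Proof.
have := cauchy_schwarz_norm2 (const_mx 1) (\col_j `|v j 0|).
rewrite dotE ger0_norm; last by apply: sumr_ge0 => j _; rewrite !mxE mul1r.
under eq_bigr do rewrite !mxE mul1r.
move=> h; apply: le_trans h _; rewrite /norm2 !dotE.
rewrite (_ : \sum_j const_mx 1 j 0 * _ = p%:R); last first.
  under eq_bigr do rewrite mxE mulr1.
  by rewrite sumr_const card_ord.
rewrite (_ : \sum_j _ * _ = \sum_j v j 0 * v j 0)//.
by apply: eq_bigr => j _; rewrite !mxE -normrM -expr2 ger0_norm ?sqr_ge0.
Qed.

(* Rounding the coordinates of v towards 0 to multiples of kappa / sqrt p; the
   l1 bound on v limits the total weight of the rounded points. *)
Lemma euclidean_net p (kappa : R) : (0 < p)%N -> 0 < kappa ->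
  exists2 N : seq 'cV[R]_p, (size N)%:R <= expR ((1 / kappa + 2) * p%:R) &
    forall v, norm2 v <= 1 -> exists2 u, u \in N & norm2 (v - u) <= kappa.
Proof.
move=> p0 k0; have pR : 0 < p%:R :> R by rewrite ltr0n.
(* For mesh h = kappa / sqrt p and a vector of l1 norm at most sqrt p, the total weight is at most
   sqrt p / h = p / kappa. The same bound on a single weight allows the finite range m. *)
set L : R := p%:R / kappa; pose m := (Num.truncn L).+1.
have sp0 : 0 < Num.sqrt (p%:R : R) by rewrite sqrtr_gt0.
pose h : R := kappa / Num.sqrt p%:R.
have h0 : 0 < h by rewrite divr_gt0.
have L0 : 0 <= L by rewrite divr_ge0// ltW.
pose G := [set f : {ffun 'I_p -> bool * 'I_m} | \sum_j (f j).2%:R <= L]%SET.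
pose pt (f : {ffun 'I_p -> bool * 'I_m}) : 'cV[R]_p :=
  \col_j ((-1) ^+ (f j).1 * (h * (f j).2%:R)).
exists [seq pt f | f <- enum G].
  rewrite size_map -cardE; apply: le_trans (card_weight_le _ _ _) _.
  by rewrite ler_expR [in leRHS]mulrDl lerD2r /L div1r mulrC.
move=> v v1.
have sL : \sum_j `|v j 0| / h <= L.
  rewrite -mulr_suml ler_pdivrMr//; apply: le_trans (dot_sum_norm_le v) _.
  have -> : L * h = Num.sqrt p%:R.
    rewrite /L /h -{1}[p%:R]sqr_sqrtr ?ler0n// expr2.
    by field; rewrite !gt_eqF.
  by rewrite ler_piMr// sqrtr_ge0.
have a0 j : 0 <= `|v j 0| / h by rewrite divr_ge0// ltW.
have aL j : `|v j 0| / h <= L.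
  apply: le_trans sL; rewrite (bigD1 j)//= lerDl; apply: sumr_ge0 => i _; exact: a0.
pose a j := Num.truncn (`|v j 0| / h).
have am j : (a j < m)%N by rewrite ltnS le_truncn.
pose f : {ffun 'I_p -> bool * 'I_m} := [ffun j => (v j 0 < 0, Ordinal (am j))].
have fE j : `|v j 0 - pt f j 0| <= h.
  rewrite !mxE ffunE /=.
  have /andP[h1 h2] := truncn_itv (a0 j).
  have h3 : (a j)%:R * h <= `|v j 0| by rewrite -ler_pdivlMr.
  have h4 : `|v j 0| <= (a j)%:R * h + h.
    by rewrite -[X in _ + X]mul1r -mulrDl -ler_pdivrMr// natr1 ltW.
  case: ltP h3 h4 => vj; rewrite ?(ltr0_norm vj) ?(ger0_norm vj) => h3 h4.
    by rewrite expr1 mulN1r opprK ler_norml; apply/andP; split; lra.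
  by rewrite expr0 mul1r ler_norml; apply/andP; split; lra.
exists (pt f).
  apply/mapP; exists f => //; rewrite mem_enum inE.
  apply: le_trans sL; apply: ler_sum => j _; rewrite ffunE /=.
  by have /andP[] := truncn_itv (a0 j).
rewrite norm2_le ?(ltW k0)// dotE.
apply: (@le_trans _ _ (\sum_(j < p) h ^+ 2)).
  apply: ler_sum => j _; rewrite -expr2 -real_normK ?num_real//.

  by rewrite lerXn2r ?nnegrE ?(ltW h0)//; have := fE j; rewrite !mxE.
rewrite sumr_const card_ord -mulr_natl /h expr_div_n sqr_sqrtr ?ler0n//.
by rewrite mulrC divfK// gt_eqF.
Qed.

End net.

(** * Small-ball probability *)

Section small_ball.
Context {d : measure_display} {Omega : measurableType d} {R : realType}
  (P : probability Omega R).

(** In place of Cauchy-Schwarz, integrate the pointwise bound Y <= m / 4 + c Y^2 + kappa m 1_A with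
    c = 1 / (4 kappa m): off A the first term suffices, on A it is the inequality of the means. This
    leaves m <= m / 2 + kappa m P(A). *)
Lemma paley_zygmund (Y : Omega -> R) (m kappa : R) :
  measurable_fun [set: Omega] Y -> (forall w, 0 <= Y w) -> 0 < m -> 0 < kappa ->
  (\int[P]_w (Y w)%:E = m%:E)%E ->
  (\int[P]_w (Y w ^+ 2)%:E <= (kappa * m ^+ 2)%:E)%E ->
  ((1 / (2 * kappa))%:E <= P [set w | (m / 4 <= Y w)%R])%E.
Proof.
move=> mY Y0 m0 k0 EY EY2.
set A := [set w | m / 4 <= Y w].
have mA : measurable A by exact: measurable_ge_set.
have pA : P A \is a fin_num by exact: fin_num_measure.
pose c := (4 * (kappa * m))^-1; have c0 : 0 < c by rewrite invr_gt0 !mulr_gt0.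
have h w : Y w <= m / 4 + c * Y w ^+ 2 + (kappa * m) * \1_A w.
  rewrite indicE; have [_|/negP wA] := boolP (w \in A).
    rewrite mulr1.
    have : 0 <= c * (Y w - 2 * (kappa * m)) ^+ 2 by rewrite mulr_ge0 ?sqr_ge0 ?ltW.
    have -> : c * (Y w - 2 * (kappa * m)) ^+ 2 = c * Y w ^+ 2 - Y w + kappa * m.
      by rewrite /c; field; rewrite ?gt_eqF.
    by lra.
  have : Y w < m / 4 by rewrite ltNge; apply/negP => H; apply: wA; rewrite inE.
  have : 0 <= c * Y w ^+ 2 by rewrite mulr_ge0 ?sqr_ge0 ?ltW.
  by rewrite mulr0 addr0; lra.
have : (m%:E <= (m / 4)%:E + c%:E * (kappa * m ^+ 2)%:E + (kappa * m)%:E * P A)%E.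
  rewrite -EY; apply: (@le_trans _ _ (\int[P]_w ((m / 4)%:E + c%:E * (Y w ^+ 2)%:E +
     (kappa * m)%:E * (\1_A w)%:E))%E).
    apply: ge0_le_integral => //.
    - by move=> w _; rewrite lee_fin.
    - exact/measurable_EFinP.
    - apply: emeasurable_funD; [apply: emeasurable_funD|].
      + exact: measurable_cst.
      + apply/measurable_EFinP; apply: measurable_funM; first exact: measurable_cst.
        exact: measurable_funX.
      + apply/measurable_EFinP; apply: measurable_funM; first exact: measurable_cst.
        exact: measurable_indic.
    - by move=> w _; rewrite -!EFinM -!EFinD lee_fin.
  have mY2 : measurable_fun [set: Omega] (fun w => (Y w ^+ 2)%:E).
    by apply/measurable_EFinP; exact: measurable_funX.
  have mcY2 : measurable_fun [set: Omega] (fun w => c%:E * (Y w ^+ 2)%:E)%E.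
    apply/measurable_EFinP; apply: measurable_funM; first exact: measurable_cst.
    exact: measurable_funX.
  have mi : measurable_fun [set: Omega] (fun w => (\1_A w : R)%:E).
    by apply/measurable_EFinP; exact: measurable_indic.
  have Y20 w : (0 <= c%:E * (Y w ^+ 2)%:E)%E.
    by rewrite -EFinM lee_fin mulr_ge0 ?sqr_ge0 ?ltW.
  rewrite ge0_integralD//; last 4 first.
  - by move=> w _; rewrite adde_ge0// lee_fin divr_ge0// ltW.
  - by apply: emeasurable_funD => //; exact: measurable_cst.
  - by move=> w _; rewrite -EFinM lee_fin mulr_ge0// mulr_ge0// ltW.
  - apply/measurable_EFinP; apply: measurable_funM; first exact: measurable_cst.
    exact: measurable_indic.
  rewrite ge0_integralD//; last first.
    by move=> w _; rewrite lee_fin divr_ge0// ltW.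
  rewrite ge0_integralZl//; last 2 first.
  - by move=> w _; rewrite lee_fin sqr_ge0.
  - by rewrite lee_fin ltW.
  rewrite ge0_integralZl//; last by rewrite lee_fin mulr_ge0// ltW.
  rewrite integral_indic// setIT integral_cst//= probability_setT mule1.
  by rewrite leeD2r// leeD2l// lee_wpmul2l// lee_fin ltW.
rewrite -(fineK pA) -!EFinM -!EFinD !lee_fin; move: (fine (P A)) => q.
have -> : c * (kappa * m ^+ 2) = m / 4 by rewrite /c; field; rewrite ?gt_eqF.
move=> hq; rewrite ler_pdivrMr ?mulr_gt0//.
have : m * 1 <= m * (q * (2 * kappa)) by lra.
by rewrite ler_pM2l.
Qed.

(** Along a unit vector isotropy makes the L2 norm equal to 1, so hypercontractivity bounds the L4
    norm by [C]; homogeneity does the rest. *)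
Lemma hypercontractive_fourth_moment p (C sigma : R) (x : Omega -> 'cV[R]_p) u :
  measurable_mx x -> isotropic P x -> hypercontractive P 4 sigma x -> sigma <= C ->
  (\int[P]_w (dot u (x w) ^+ 4)%:E <= (C ^+ 4 * dot u u ^+ 2)%:E)%E.
Proof.
move=> mx ix hx sC.
have [->|u0] := eqVneq u 0.
  under eq_integral do rewrite dot0l expr0n/=.
  by rewrite integral0 lee_fin dot0l expr0n/= mulr0.
have nu := norm2_gt0 u0; set v := (norm2 u)^-1 *: u.
have v1 : norm2 v = 1.
  by rewrite norm2Z ger0_norm ?invr_ge0 ?norm2_ge0// mulVf// gt_eqF.
have uv : u = norm2 u *: v by rewrite scalerA divff ?scale1r// gt_eqF.
have := hx v v1.
set N4 := Lnorm _ (_)%:E _; set N2 := Lnorm _ _ _ => h.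
have N21 : N2 = 1%E.
  rewrite /N2 Lnorm.unlock.
  rewrite (_ : integral _ _ _ = 1%E) ?poweR1r//.
  transitivity (\int[P]_w (dot v (x w) ^+ 2)%:E)%E; last first.
    by rewrite (integral_dot_sqr mx ix) -norm2_sq v1 expr1n.
  apply: eq_integral => w _.
  by rewrite /= powR_mulrn// real_normK ?num_real.
have hC : (N4 <= C%:E)%E.
  by apply: le_trans h _; rewrite N21 mule1 lee_fin.
have N40 : (0 <= N4)%E by exact: Lnorm_ge0.
have C0 : 0 <= C by rewrite -lee_fin; exact: le_trans hC.
have h4 : (\int[P]_w (dot v (x w) ^+ 4)%:E <= (C ^+ 4)%:E)%E.
  have -> : (\int[P]_w (dot v (x w) ^+ 4)%:E = poweR N4 4%:R)%E.
    rewrite poweR_Lnorm ?pnatr_eq0//; apply: eq_integral => w _.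
    rewrite /= powR_mulrn//; congr EFin.
    by rewrite -normrX ger0_norm// exprn_even_ge0.
  rewrite -powR_mulrn// -poweR_EFin; apply: gt0_ler_poweR => //;
    by rewrite in_itv /= leey andbT ?lee_fin.
have mX : measurable_fun [set: Omega] (fun w => dot v (x w) ^+ 4).
  by apply/measurable_funX/measurable_dot => //; exact: measurable_mx_cst.
have -> : (\int[P]_w (dot u (x w) ^+ 4)%:E =
    (dot u u ^+ 2)%:E * \int[P]_w (dot v (x w) ^+ 4)%:E)%E.
  rewrite -ge0_integralZl//; last 3 first.
  - exact/measurable_EFinP.
  - by move=> w _; rewrite lee_fin exprn_even_ge0.
  - by rewrite lee_fin sqr_ge0.
  apply: eq_integral => w _; rewrite -EFinM; congr EFin.
  by rewrite {1}uv dotZl exprMn -norm2_sq -exprM.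
by rewrite muleC [in leRHS]EFinM; apply: lee_wpmul2r => //; rewrite lee_fin sqr_ge0.
Qed.

Lemma integral_shift_sqr (b : Omega -> R) (s v : R) :
  measurable_fun [set: Omega] b -> (\int[P]_w (b w)%:E = 0)%E ->
  (\int[P]_w (b w ^+ 2)%:E = v%:E)%E ->
  (\int[P]_w ((s - b w) ^+ 2)%:E = (s ^+ 2 + v)%:E)%E.
Proof.
move=> mb Eb Eb2.
have ib2 : P.-integrable setT (EFin \o (fun w => b w ^+ 2)).
  apply/integrableP; split; first by apply/measurable_EFinP; exact: measurable_funX.
  by under eq_integral do rewrite /= ger0_norm ?sqr_ge0//; rewrite Eb2 ltry.
have ic c : P.-integrable setT (fun=> c%:E) by exact: finite_measure_integrable_cst.
have ib : P.-integrable setT (EFin \o b).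
  apply: (le_integrable _ _ _ (integrableD measurableT (ic 1) ib2)) => //.
    exact/measurable_EFinP.
  move=> w _ /=; rewrite lee_fin [leRHS]ger0_norm ?addr_ge0 ?sqr_ge0//.
  by rewrite ler_norml; apply/andP; split; nra.
transitivity (\int[P]_w ((s ^+ 2)%:E + ((- 2 * s)%:E * (EFin \o b) w + (b w ^+ 2)%:E)))%E.
  by apply: eq_integral => w _; rewrite /= -EFinM -!EFinD; congr EFin; ring.
rewrite integralD//; last by apply: integrableD => //; exact: integrableZl.
rewrite integralD//; last exact: integrableZl.
by rewrite integralZl// Eb Eb2 mule0 add0e integral_cst//= probability_setT mule1.
Qed.

(** Paley-Zygmund for the squared projection. Its mean is |u|^2, the cross term vanishing after
    freezing x1 because x2 is centred; its second moment is at most 4 C |u|^4, so kappa = 4 C. *)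
Lemma small_ball_diff p (C : R) (x1 x2 : Omega -> 'cV[R]_p)
    (C1 C2 : set (set Omega)) (u : 'cV[R]_p) :
  C1 `<=` measurable -> C2 `<=` measurable ->
  measurable_mx (T := g_sigma_algebraType C1) x1 ->
  measurable_mx (T := g_sigma_algebraType C2) x2 ->
  (forall A B, <<s C1 >> A -> <<s C2 >> B -> P (A `&` B) = (P A * P B)%E) ->
  isotropic P x1 -> isotropic P x2 ->
  (forall j, \int[P]_w (x2 w j 0)%:E = 0)%E ->
  (forall v, \int[P]_w (dot v (x1 w) ^+ 4)%:E <= (C * dot v v ^+ 2)%:E)%E ->
  (forall v, \int[P]_w (dot v (x2 w) ^+ 4)%:E <= (C * dot v v ^+ 2)%:E)%E ->
  0 < C -> u != 0 ->
  ((1 / (8 * C))%:E <=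
    P [set w | (dot u u / 4 <= dot ((Num.sqrt 2)^-1 *: (x1 w - x2 w)) u ^+ 2)%R])%E.
Proof.
move=> mC1 mC2 mx1 mx2 ind i1 i2 Ex2 f1 f2 C0 u0.
have m1 : measurable_mx x1 := measurable_mx_comp mx1 (measurable_sub_sigma_algebra mC1).
have m2 : measurable_mx x2 := measurable_mx_comp mx2 (measurable_sub_sigma_algebra mC2).
have md (T : measurableType _) (x : T -> 'cV[R]_p) : measurable_mx x ->
    measurable_fun [set: T] (fun w => dot u (x w)).
  by move=> mx; apply: measurable_dot => //; exact: measurable_mx_cst.
have md1 := md _ _ _ m1; have md2 := md _ _ _ m2.
have Edot : (\int[P]_w (dot u (x2 w))%:E = 0)%E.
  have E w : ((dot u (x2 w))%:E = \sum_j (u j 0)%:E * (x2 w j 0)%:E)%E.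
    by rewrite dotE -sumEFin; apply: eq_bigr => j _; rewrite EFinM.
  have ij j : P.-integrable setT (EFin \o (fun w => x2 w j 0)).
    have ic : P.-integrable setT (fun=> 1%:E) by exact: finite_measure_integrable_cst.
    have h := integrableD measurableT ic (integrable_coordM m2 i2 j j).
    apply: (le_integrable _ _ _ h) => //; first exact/measurable_EFinP.
    move=> w _ /=; rewrite lee_fin -expr2 [leRHS]ger0_norm ?addr_ge0 ?sqr_ge0//.
    by rewrite ler_norml; apply/andP; split; nra.
  under eq_integral do rewrite E.
  rewrite integral_sum//; last by move=> j; apply: integrableZl => //; exact: ij.
  by apply: big1 => j _; rewrite integralZl ?Ex2 ?mule0//; exact: ij.
pose f (q : g_sigma_algebraType C1 * g_sigma_algebraType C2) : \bar R :=
  ((dot u (x1 q.1) - dot u (x2 q.2)) ^+ 2)%:E.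
have Esq : (\int[P]_w ((dot u (x1 w) - dot u (x2 w)) ^+ 2)%:E = (2 * dot u u)%:E)%E.
  have mf : measurable_fun [set: g_sigma_algebraType C1 * g_sigma_algebraType C2] f.
    apply/measurable_EFinP/measurable_funX/measurable_funB.
      exact: (measurableT_comp (md _ _ _ mx1) measurable_fst).
    exact: (measurableT_comp (md _ _ _ mx2) measurable_snd).
  have f0 q : (0 <= f q)%E by rewrite lee_fin sqr_ge0.
  rewrite (freezing_sub mC1 mC2 mf f0 ind) /f /=.
  under eq_integral do rewrite (integral_shift_sqr _ md2 Edot (integral_dot_sqr m2 i2 u)).
  under eq_integral do rewrite EFinD.
  rewrite ge0_integralD//; last 3 first.
  - by move=> w _; rewrite lee_fin sqr_ge0.
  - by apply/measurable_EFinP; exact: measurable_funX.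
  - by move=> w _; rewrite lee_fin dot_ge0.
  rewrite (integral_dot_sqr m1 i1) integral_cst//= probability_setT mule1.
  by rewrite -EFinD; congr EFin; ring.
have YE w : dot ((Num.sqrt 2)^-1 *: (x1 w - x2 w)) u ^+ 2 =
    1 / 2 * (dot u (x1 w) - dot u (x2 w)) ^+ 2.
  rewrite dotC dotZr dotBr exprMn exprVn sqr_sqrtr//.
  by rewrite div1r.
under [X in (_ <= P X)%E]eq_set do rewrite YE.
have -> : 1 / (8 * C) = 1 / (2 * (4 * C)) by congr (_ / _); ring.
have mD : measurable_fun [set: Omega] (fun w => dot u (x1 w) - dot u (x2 w)).
  exact: measurable_funB.
apply: (paley_zygmund (kappa := 4 * C)) => //.
- by apply: measurable_funM; [exact: measurable_cst|exact: measurable_funX].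
- by move=> w; rewrite mulr_ge0 ?sqr_ge0.
- exact: dot_gt0.
- by rewrite mulr_gt0.
- under eq_integral do rewrite EFinM.
  rewrite ge0_integralZl//; last 2 first.
  + by apply/measurable_EFinP; exact: measurable_funX.
  + by move=> w _; rewrite lee_fin sqr_ge0.
  by rewrite Esq -EFinM; congr EFin; lra.
- apply: (@le_trans _ _ (\int[P]_w (2%:E * (dot u (x1 w) ^+ 4)%:E +
      2%:E * (dot u (x2 w) ^+ 4)%:E))%E).
    apply: ge0_le_integral => //.
    + by move=> w _; rewrite lee_fin sqr_ge0.
    + apply/measurable_EFinP/measurable_funX/measurable_funM; first exact: measurable_cst.
      exact: measurable_funX.
    + by apply: emeasurable_funD; apply/measurable_EFinP/measurable_funM;
        [exact: measurable_cst|exact: measurable_funX|exact: measurable_cst|exact: measurable_funX].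
    + move=> w _; rewrite -!EFinM -EFinD lee_fin.
      move: (dot u (x1 w)) (dot u (x2 w)) => a b.
      have h1 := sqr_ge0 (a + b); have h2 := sqr_ge0 (a ^+ 2 - b ^+ 2).
      have h3 : (a - b) ^+ 2 <= 2 * (a ^+ 2 + b ^+ 2) by lra.
      have h4 : ((a - b) ^+ 2) ^+ 2 <= (2 * (a ^+ 2 + b ^+ 2)) ^+ 2.
        by rewrite lerXn2r ?nnegrE ?sqr_ge0// mulr_ge0// addr_ge0 ?sqr_ge0.
      have -> : a ^+ 4 = (a ^+ 2) ^+ 2 by rewrite -exprM.
      have -> : b ^+ 4 = (b ^+ 2) ^+ 2 by rewrite -exprM.
      rewrite exprMn; lra.
  rewrite ge0_integralD//; last 4 first.
  + by move=> w _; rewrite -EFinM lee_fin mulr_ge0// exprn_even_ge0.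
  + by apply/measurable_EFinP/measurable_funM; [exact: measurable_cst|exact: measurable_funX].
  + by move=> w _; rewrite -EFinM lee_fin mulr_ge0// exprn_even_ge0.
  + by apply/measurable_EFinP/measurable_funM; [exact: measurable_cst|exact: measurable_funX].
  rewrite !ge0_integralZl//; last 4 first.
  + by apply/measurable_EFinP; exact: measurable_funX.
  + by move=> w _; rewrite lee_fin exprn_even_ge0.
  + by apply/measurable_EFinP; exact: measurable_funX.
  + by move=> w _; rewrite lee_fin exprn_even_ge0.
  rewrite (_ : (4 * C * _)%:E =
    (2%:E * (C * dot u u ^+ 2)%:E + 2%:E * (C * dot u u ^+ 2)%:E)%E); last first.
    by rewrite -!EFinM -EFinD; congr EFin; ring.
  by apply: leeD; apply: lee_wpmul2l.
Qed.

End small_ball.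

(** * Pairs of independent samples *)

Section independent_products.
Context {d d' : measure_display} {Omega : measurableType d} {R : realType}
  (P : probability Omega R) {S : measurableType d'} {n : nat}.
Variable X : 'I_(n + n) -> Omega -> S.
Hypotheses (mX : forall i, measurable_fun setT (X i))
  (iX : mutually_independent P X).

Definition pair_block (i : 'I_n) := present X (@pair_label n) i.

Lemma pair_block_measurable i : pair_block i `<=` measurable.
Proof. exact: generated_by_measurable. Qed.

Lemma measurable_pair_block_lshift i :
  measurable_fun [set: g_sigma_algebraType (pair_block i)] (X (lshift n i)).
Proof. by apply: measurable_generated_by; rewrite inE pair_label_lshift. Qed.

Lemma measurable_pair_block_rshift i :
  measurable_fun [set: g_sigma_algebraType (pair_block i)] (X (rshift n i)).
Proof. by apply: measurable_generated_by; rewrite inE pair_label_rshift. Qed.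

(** The sequential bound for factors that depend on the present pair only; the factor is 1 at steps
    beyond n. *)
Lemma integral_prod_pair_blocks_le (h : 'I_n -> Omega -> R) (m : 'I_n -> R) :
  (forall i, measurable_fun [set: g_sigma_algebraType (pair_block i)] (h i)) ->
  (forall i w, 0 <= h i w) ->
  (forall i, (\int[P]_w (h i w)%:E <= (m i)%:E)%E) ->
  (\int[P]_w (\prod_i h i w)%:E <= (\prod_i m i)%:E)%E.
Proof.
move=> mh h0 hm.
pose g k (u : g_sigma_algebraType (past X (@pair_label n) k) *
    g_sigma_algebraType (present X (@pair_label n) k)) : R :=
  oapp (fun i => h i u.2) 1 (insub k : option 'I_n).
pose m' k : R := oapp m 1 (insub k : option 'I_n).
have := @sequential_product_le _ _ _ _ P _ _ X (@pair_label n) mX iX g _ _ m' n.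
have -> : \prod_(k < n) m' k = \prod_i m i.
  by apply: eq_bigr => i _; rewrite /m' valK.
under eq_integral do under eq_bigr do rewrite /g valK /=.
apply.
- move=> k; rewrite /g; case: insubP => [i _ ik|_]; last exact: measurable_cst.
  subst k; exact: (measurableT_comp (mh i) measurable_snd).
- by move=> k u; rewrite /g; case: insubP => /=.
- move=> k kn w; rewrite /g /m'; case: insubP => [i _ _|/negP//] /=.
  exact: hm.
Qed.

End independent_products.

(** * Chernoff bounds for the number of pairs realizing an event *)

Section counting.
Context {d d' : measure_display} {Omega : measurableType d} {R : realType}
  (P : probability Omega R) {S : measurableType d'} {n : nat}.
Variable X : 'I_(n + n) -> Omega -> S.
Hypotheses (mX : forall i, measurable_fun setT (X i))
  (iX : mutually_independent P X).
Variable A : 'I_n -> set Omega.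
Hypothesis mA : forall i, <<s pair_block X i >> (A i).

Lemma pair_block_set_measurable i : measurable (A i).
Proof.
have : <<s pair_block X i >> `<=` @measurable d Omega.
  apply: smallest_sub; first exact: sigma_algebra_measurable.
  exact: pair_block_measurable.
exact.
Qed.

Definition occurrences (w : Omega) : R := \sum_i \1_(A i) w.

Lemma measurable_occurrences : measurable_fun [set: Omega] occurrences.
Proof.
by apply: measurable_sum => i; apply: measurable_indic; exact: pair_block_set_measurable.
Qed.

Lemma occurrencesE w : occurrences w = #|[set i | `[< A i w >]]%SET|%:R.
Proof.
rewrite -sum1_card natr_sum [RHS]big_mkcond /=; apply: eq_bigr => i _.
rewrite indicE inE; case: asboolP => Ai; first by rewrite mem_set.
by rewrite memNset.
Qed.

Lemma integral_expR_indic (s : R) i :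
  (\int[P]_w (expR (s * \1_(A i) w))%:E =
   1 + (expR s - 1)%:E * P (A i))%E.
Proof.
have mAi := pair_block_set_measurable i.
have iA : P.-integrable setT (EFin \o (\1_(A i) : Omega -> R)) by exact: integrable_indic.
transitivity (\int[P]_w (1%:E + (expR s - 1)%:E * (EFin \o \1_(A i)) w))%E.
  apply: eq_integral => w _; rewrite /= -EFinM -EFinD; congr EFin.
  by rewrite indicE; case: (w \in A i); rewrite ?mulr0 ?expR0 ?mulr1; ring.
rewrite integralD//; last 2 first.
- exact: finite_measure_integrable_cst.
- exact: integrableZl.
rewrite integralZl// integral_cst//= probability_setT mule1.
by rewrite integral_indic// setIT.
Qed.

Lemma expR_occurrences (s : R) w :
  expR (s * occurrences w) = \prod_i expR (s * \1_(A i) w).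
Proof. by rewrite /occurrences mulr_sumr expR_sum. Qed.

Lemma measurable_expR_indic (s : R) i :
  measurable_fun [set: g_sigma_algebraType (pair_block X i)]
    (fun w => expR (s * \1_(A i) w) : R).
Proof.
have h : measurable_fun [set: g_sigma_algebraType (pair_block X i)]
    (fun w => s * \1_(A i) w : R).
  apply: measurable_funM; first exact: measurable_cst.
  by apply: measurable_indic; exact: mA.
by apply: (measurableT_comp _ h); exact: measurable_expR.
Qed.

(** Chernoff at parameter 1: each factor has mean at most 1 + (e - 1) q <= 1 + 3 q <= exp (3 q). *)
Lemma occurrences_upper_tail (q t : R) :
  (forall i, P (A i) <= q%:E)%E ->
  (P [set w | (t <= occurrences w)%R] <= (expR (3 * q * n%:R - t))%:E)%E.
Proof.
move=> Aq; rewrite expRD; apply: chernoff_bound; first exact: measurable_occurrences.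
under eq_integral do rewrite -[occurrences _]mul1r expR_occurrences.
rewrite expRM_natr -[X in _ ^+ X]card_ord -prodr_const.
apply: (integral_prod_pair_blocks_le mX iX).
- by move=> i; exact: measurable_expR_indic.
- by move=> i w; exact: expR_ge0.
- move=> i; rewrite integral_expR_indic; have := Aq i.
  have mAi := pair_block_set_measurable i.
  have fA : P (A i) \is a fin_num by exact: fin_num_measure.
  rewrite -(fineK fA) -EFinM -EFinD !lee_fin => h.
  have h0 : 0 <= fine (P (A i)) by exact: fine_ge0.
  have := @expR_ge1Dx R (3 * q); have := @expR1_le4 R; nra.
Qed.

(** Chernoff at parameter -1: each factor has mean at most 1 - q / 2 <= exp (- q / 2), and the
    threshold q n / 4 uses up half of that exponent. *)
Lemma occurrences_lower_tail (q : R) :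
  (forall i, q%:E <= P (A i))%E ->
  (P [set w | (occurrences w <= q / 4 * n%:R)%R] <= (expR (- (q / 4 * n%:R)))%:E)%E.
Proof.
move=> Aq.
have -> : [set w | occurrences w <= q / 4 * n%:R] =
    [set w | - (q / 4 * n%:R) <= - 1 * occurrences w].
  by apply/seteqP; split => w /=; rewrite mulN1r lerN2.
have -> : expR (- (q / 4 * n%:R)) = expR (- (q / 2) * n%:R) * expR (- - (q / 4 * n%:R)).
  by rewrite -expRD; congr expR; lra.
apply: chernoff_bound.
  by apply: measurable_funM; [exact: measurable_cst|exact: measurable_occurrences].
under eq_integral do rewrite expR_occurrences.
rewrite expRM_natr -[X in _ ^+ X]card_ord -prodr_const.
apply: (integral_prod_pair_blocks_le mX iX).
- by move=> i; exact: measurable_expR_indic.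
- by move=> i w; exact: expR_ge0.
- move=> i; rewrite integral_expR_indic; have := Aq i.
  have mAi := pair_block_set_measurable i.
  have fA : P (A i) \is a fin_num by exact: fin_num_measure.
  rewrite -(fineK fA) -EFinM -EFinD !lee_fin => h.
  have h0 : 0 <= fine (P (A i)) by exact: fine_ge0.
  have h1 : expR (- 1) <= 1 / 2 :> R.
    have := @expR_ge1Dx R 1; have := expRxMexpNx_1 (1 : R).
    have := @expR_gt0 R (-1); nra.
  have [q0|q0] := leP 0 q.
    have := @expR_ge1Dx R (- (q / 2)); nra.
  have := @expR_ge1Dx R (- (q / 2)); have := @expR_gt0 R (-1); nra.
Qed.

End counting.

(** * Clipped symmetric noise *)

Section clip.
Context {R : realType}.
Implicit Types g t : R.

(** The projection onto [-g, g], which is the derivative of the Huber loss. *)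
Definition clip g t : R := Num.max (- g) (Num.min g t).

Lemma clip_norm g t : 0 <= g -> `|clip g t| <= g.
Proof.
move=> g0; rewrite ler_norml /clip; apply/andP; split.
  by rewrite le_max lexx.
by rewrite ge_max ge_min lexx /= andbT; lra.
Qed.

Lemma clip_id g t : `|t| <= g -> clip g t = t.
Proof.
rewrite ler_norml => /andP[h1 h2]; rewrite /clip (min_idPr h2).
exact/max_idPr.
Qed.

Lemma clip_gt g t : 0 <= g -> g <= t -> clip g t = g.
Proof. by move=> g0 gt; rewrite /clip (min_idPl gt); apply/max_idPr; lra. Qed.

Lemma clip_lt g t : 0 <= g -> t <= - g -> clip g t = - g.
Proof.
move=> g0 gt; rewrite /clip (@min_r _ _ g t); last by lra.
exact/max_idPl.
Qed.

Lemma clipN g t : 0 <= g -> clip g (- t) = - clip g t.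
Proof.
move=> g0; have [tg|] := lerP `|t| g.
  by rewrite !clip_id// normrN.
rewrite lter_normr => /orP[h|h].
  have -> : clip g t = g by apply: clip_gt => //; lra.
  by apply: clip_lt => //; lra.
have -> : clip g (- t) = g by apply: clip_gt => //; lra.
by rewrite (clip_lt g0) ?opprK//; lra.
Qed.

Lemma measurable_clip g : measurable_fun [set: R] (clip g).
Proof.
apply: measurable_maxr; first exact: measurable_cst.
by apply: measurable_minr; [exact: measurable_cst|exact: measurable_id].
Qed.

(* A crude form of 2 cosh s <= 2 exp (s^2 / 2), which suffices here. *)
Lemma expR_sym_le (s : R) : expR s + expR (- s) <= 2 * expR (2 * s ^+ 2).
Proof.
wlog s0 : s / 0 <= s => [h|].
  have [/h//|s0] := leP 0 s.
  have := h (- s); rewrite opprK sqrrN addrC; apply; lra.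
(* For s <= 1/2, exp s <= 1 / (1 - s) and exp (-s) <= 1 / (1 + s) add up to 2 / (1 - s^2) <= 2 (1 +
   2 s^2). For larger s, already s <= 2 s^2. *)
have [sh|sh] := leP s (1 / 2).
  have e1 : expR s <= (1 - s)^-1.
    rewrite -[expR s]invrK -expRN lef_pV2 ?posrE ?expR_gt0//; last by lra.
    by have := @expR_ge1Dx R (- s); lra.
  have e2 : expR (- s) <= (1 + s)^-1.
    rewrite expRN lef_pV2 ?posrE ?expR_gt0//; last by lra.
    exact: expR_ge1Dx.
  have e3 := @expR_ge1Dx R (2 * s ^+ 2).
  apply: le_trans (lerD e1 e2) _.
  have -> : (1 - s)^-1 + (1 + s)^-1 = 2 * (1 - s ^+ 2)^-1.
    by field; apply/and3P; split; apply/eqP; nra.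
  rewrite ler_pM2l//; apply: le_trans e3.
  rewrite -[leLHS]mul1r ler_pdivrMr; last by nra.
  have t1 : s ^+ 2 <= 1 / 4 by nra.
  by move: (sqr_ge0 s) t1; move: (s ^+ 2) => t t0 t1; nra.
have h1 : expR s <= expR (2 * s ^+ 2) by rewrite ler_expR; nra.
have h2 : expR (- s) <= expR (2 * s ^+ 2) by rewrite ler_expR; nra.
lra.
Qed.

End clip.

Section noise.
Context {d : measure_display} {Omega : measurableType d} {R : realType}
  (P : probability Omega R) {n : nat}.
Variable z : 'I_(n + n) -> Omega -> R.
Hypothesis iidz : iid P z.
Local Notation I := 'I_(n + n).

Let mz i : measurable_fun setT (z i). Proof. by have [] := iidz. Qed.
Let indz : mutually_independent P z. Proof. by have [] := iidz. Qed.

(** Both joint laws are the same product measure. Exchanging i and j makes the differenced noise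
    symmetric; moving to another pair transfers the hypothesis on the first two samples to all
    pairs. *)
Lemma iid_pair_law (i j k l : I) (f : R * R -> \bar R) :
  i != j -> k != l -> measurable_fun [set: R * R] f -> (forall u, 0 <= f u)%E ->
  (\int[P]_w f (z i w, z j w) = \int[P]_w f (z k w, z l w))%E.
Proof.
move=> ij kl mf f0.
pose Z (a : I) : {mfun Omega >-> R} := HB.pack (z a) (@isMeasurableFun.Build _ _ _ _ _ (mz a)).
have mZZ (a b : I) : measurable_fun setT (fun w => (z a w, z b w)).
  by apply/measurable_fun_pair.
pose ZZ (a b : I) : {mfun Omega >-> (R * R)%type} :=
  HB.pack (fun w => (z a w, z b w)) (@isMeasurableFun.Build _ _ _ _ _ (mZZ a b)).
have [_ _ idz] := iidz.
have law (a b : I) : a != b -> (\int[P]_w f (z a w, z b w) =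
    \int[distribution P (Z i) \x distribution P (Z j)]_u f u)%E.
  move=> ab.
  transitivity (\int[distribution P (ZZ a b)]_u f u)%E.
    by rewrite ge0_integral_distribution.
  apply: eq_measure_integral => C mC _.
  apply/esym; apply: product_measure_unique => // A B mA mB.
  rewrite /distribution /pushforward /=.
  pose F (c : I) := if c == a then A else B.
  have := indz [set a; b]%SET (B := F).
  have -> : \bigcap_(c in [set` [set a; b]%SET]) (z c @^-1` F c) =
      z a @^-1` A `&` z b @^-1` B.
    apply/seteqP; split => [w H|w [wA wB] c /=].
      split; first by have := H a; rewrite /F eqxx /= !inE eqxx; exact.
      by have := H b; rewrite /F eq_sym (negbTE ab) /= !inE eqxx orbT; exact.
    rewrite !inE /F => /orP[/eqP ->|/eqP ->]; first by rewrite eqxx.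
    by rewrite eq_sym (negbTE ab).
  rewrite big_setU1 ?inE//= big_set1 /F eqxx (eq_sym b a) (negbTE ab).
  rewrite (idz a i)// (idz b j)//; apply.
  by move=> c; case: ifP.
by rewrite (law _ _ ij) (law _ _ kl).
Qed.

Lemma lshift_neq_rshift (i : 'I_n) : lshift n i != rshift n i.
Proof. by rewrite eq_lrshift. Qed.

Definition diff_noise (w : Omega) (i : 'I_n) : R :=
  (z (lshift n i) w - z (rshift n i) w) / Num.sqrt 2.

Lemma measurable_diff_noise i :
  measurable_fun [set: g_sigma_algebraType (pair_block z i)] (diff_noise ^~ i).
Proof.
apply: measurable_funM; last exact: measurable_cst.
apply: measurable_funB.
  exact: measurable_pair_block_lshift.
exact: measurable_pair_block_rshift.
Qed.

(** Symmetrization: exchanging the two samples flips the sign of the clipped noise, so twice the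
    integral is that of exp s + exp (-s) with |s| <= |c| g. *)
Lemma integral_expR_clip_noise (g c : R) i : 0 <= g ->
  (\int[P]_w (expR (c * clip g (diff_noise w i)))%:E <=
   (expR (2 * (c * g) ^+ 2))%:E)%E.
Proof.
move=> g0.
pose f (u : R * R) : \bar R := (expR (c * clip g ((u.1 - u.2) / Num.sqrt 2)))%:E.
have mf : measurable_fun [set: R * R] f.
  apply/measurable_EFinP.
  have h : measurable_fun [set: R * R] (fun u : R * R => (u.1 - u.2) / Num.sqrt 2).
    apply: measurable_funM; last exact: measurable_cst.
    by apply: measurable_funB; [exact: measurable_fst|exact: measurable_snd].
  have h2 := measurableT_comp (measurable_clip g) h.
  have h3 : measurable_fun [set: R * R] (fun u : R * R => c * clip g ((u.1 - u.2) / Num.sqrt 2)).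
    by apply: measurable_funM; first exact: measurable_cst.
  by apply: (measurableT_comp _ h3); exact: measurable_expR.
have f0 u : (0 <= f u)%E by rewrite lee_fin expR_ge0.
have ir := lshift_neq_rshift i.
have ri : rshift n i != lshift n i by rewrite eq_sym.
have sym := iid_pair_law ir ri mf f0.
have fE w : f (z (lshift n i) w, z (rshift n i) w) =
    (expR (c * clip g (diff_noise w i)))%:E by [].
have fE' w : f (z (rshift n i) w, z (lshift n i) w) =
    (expR (- (c * clip g (diff_noise w i))))%:E.
  rewrite /f /=; congr (expR _)%:E.
  by rewrite -mulrN -clipN// /diff_noise -mulNr opprB.
have mff (a b : I) : measurable_fun [set: Omega] (fun w => f (z a w, z b w)).
  have h : measurable_fun [set: Omega] (fun w => (z a w, z b w)).
    by apply/measurable_fun_pair.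
  exact: (measurableT_comp mf h).
set E := (\int[P]_w f (z (lshift n i) w, z (rshift n i) w))%E in sym.
have E0 : (0 <= E)%E by exact: integral_ge0.
suff : (E + E <= (2 * expR (2 * (c * g) ^+ 2))%:E)%E.
  rewrite -[X in (X <= _)%E -> _]/(E + E)%E -[X in (_ -> X <= _)%E]/E.
  case: E E0 {sym} => [e| |]//.
  by rewrite -EFinD !lee_fin; lra.
rewrite {2}sym -ge0_integralD//.
apply: (@le_trans _ _ (\int[P]_w (cst (2 * expR (2 * (c * g) ^+ 2))%:E) w)%E); last first.
  by rewrite integral_cst//= probability_setT mule1.
apply: ge0_le_integral => //.
- by move=> w _; apply: adde_ge0.
- exact: emeasurable_funD.
- move=> w _; rewrite fE fE' -EFinD lee_fin.
  apply: le_trans (expR_sym_le _) _; rewrite ler_pM2l// ler_expR ler_pM2l//.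
  rewrite !exprMn; apply: ler_wpM2l; first exact: sqr_ge0.
  rewrite -real_normK ?num_real// lerXn2r ?nnegrE//.
  exact: clip_norm.
Qed.

Lemma clip_noise_tail (g v t : R) (a : 'I_n -> R) : 0 < g -> 0 < v -> 0 < t ->
  \sum_i a i ^+ 2 <= v ->
  (P [set w | (t <= \sum_i a i * clip g (diff_noise w i))%R] <=
   (expR (- (t ^+ 2 / (8 * g ^+ 2 * v))))%:E)%E.
Proof.
move=> g0 v0 t0 av.
(* The minimizer of 2 s^2 g^2 v - s t, with value - t^2 / (8 g^2 v). *)
pose s := t / (4 * g ^+ 2 * v).
have gv : 0 < g ^+ 2 * v by rewrite mulr_gt0// exprn_gt0.
have s0 : 0 < s by rewrite divr_gt0// -mulrA mulr_gt0.
have mh i : measurable_fun [set: g_sigma_algebraType (pair_block z i)]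
    (fun w => s * a i * clip g (diff_noise w i) : R).
  apply: measurable_funM; first exact: measurable_cst.
  exact: (measurableT_comp (measurable_clip g) (measurable_diff_noise (i := i))).
have mhO i : measurable_fun [set: Omega] (fun w => a i * clip g (diff_noise w i)).
  apply: measurable_funM; first exact: measurable_cst.
  have mD : measurable_fun [set: Omega] (diff_noise ^~ i).
    apply: measurable_funM; last exact: measurable_cst.
    exact: measurable_funB.
  exact: (measurableT_comp (measurable_clip g) mD).
have -> : [set w | t <= \sum_i a i * clip g (diff_noise w i)] =
    [set w | s * t <= s * \sum_i a i * clip g (diff_noise w i)].
  by apply/seteqP; split => w /=; rewrite ler_pM2l.
have -> : expR (- (t ^+ 2 / (8 * g ^+ 2 * v))) =
    expR (2 * (s * g) ^+ 2 * v) * expR (- (s * t)).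
  by rewrite -expRD; congr expR; rewrite /s; field; rewrite !gt_eqF.
apply: chernoff_bound.
  by apply: measurable_funM; [exact: measurable_cst|exact: measurable_sum].
apply: (@le_trans _ _ (\prod_i expR (2 * (s * a i * g) ^+ 2))%:E).
  have E w : expR (s * \sum_i a i * clip g (diff_noise w i)) =
      \prod_i expR (s * a i * clip g (diff_noise w i)).
    by rewrite mulr_sumr expR_sum; apply: eq_bigr => i _; rewrite mulrA.
  under eq_integral do rewrite E.
  apply: (integral_prod_pair_blocks_le mz indz).
  - by move=> i; apply: (measurableT_comp _ (mh i)); exact: measurable_expR.
  - by move=> i w; exact: expR_ge0.
  - by move=> i; apply: integral_expR_clip_noise; exact: ltW.
rewrite -expR_sum lee_fin ler_expR.
have -> : \sum_i 2 * (s * a i * g) ^+ 2 = 2 * (s * g) ^+ 2 * \sum_i a i ^+ 2.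
  by rewrite mulr_sumr; apply: eq_bigr => i _; ring.
by apply: ler_wpM2l => //; rewrite mulr_ge0// sqr_ge0.
Qed.

(** All pairs have the same law, and dividing by sqrt 2 turns the threshold g / sqrt 2 into g /
    2. *)
Lemma large_noise_prob (g q : R) (k l : I) : k != l ->
  (P [set w | (g / Num.sqrt 2 <= `|z k w - z l w|)%R] <= q%:E)%E ->
  forall i, (P [set w | (g / 2 <= `|diff_noise w i|)%R] <= q%:E)%E.
Proof.
move=> kl hq i.
pose B : set (R * R) := [set u | g / Num.sqrt 2 <= `|u.1 - u.2|].
have mB : measurable B.
  have h : measurable_fun [set: R * R] (fun u : R * R => `|u.1 - u.2|).
    apply: (@measurableT_comp _ _ _ _ _ _ (@Num.norm _ R)) => //.
    by apply: measurable_funB; [exact: measurable_fst|exact: measurable_snd].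
  exact: (@measurable_ge_set _ (R * R)%type _ _ _ h).
pose f (u : R * R) : \bar R := (\1_B u)%:E.
have mf : measurable_fun [set: R * R] f.
  by apply/measurable_EFinP; exact: measurable_indic.
have f0 u : (0 <= f u)%E by rewrite lee_fin.
have PE (a b : I) : (\int[P]_w f (z a w, z b w) =
    P [set w | (g / Num.sqrt 2 <= `|z a w - z b w|)%R])%E.
  have mab : measurable_fun [set: Omega] (fun w => (z a w, z b w)).
    by apply/measurable_fun_pair.
  have mS : measurable [set w | g / Num.sqrt 2 <= `|z a w - z b w|].
    by have := mab measurableT _ mB; rewrite setTI.
  rewrite -[in RHS](setIT [set w | _]) -integral_indic//.
have -> : [set w | g / 2 <= `|diff_noise w i|] =
    [set w | g / Num.sqrt 2 <= `|z (lshift n i) w - z (rshift n i) w|].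
  have s2 : 0 < Num.sqrt 2 :> R by rewrite sqrtr_gt0.
  apply/seteqP; split => w /=; rewrite /diff_noise normrM normfV (gtr0_norm s2);
    rewrite ler_pdivlMr// (_ : g / 2 * Num.sqrt 2 = g / Num.sqrt 2)//;
    rewrite -[in RHS](mulfK (lt0r_neq0 s2) g) -[RHS]mulrA -invfM -expr2 sqr_sqrtr//;
    by rewrite mulrAC.
by rewrite -PE (iid_pair_law (lshift_neq_rshift i) kl mf f0) PE.
Qed.

End noise.

(** * Empirical Huber loss *)

Lemma differentiable_norm_remainder (R : realType) (V W : normedModType R)
    (f : V -> W) (df : {linear V -> W}) (b : V) (K : R) : continuous df ->
  (forall h, `|f (b + h) - f b - df h| <= K * `|h| ^+ 2) ->
  differentiable f b /\ 'd f b = df :> (V -> W).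
Proof.
move=> cdf fK.
have H : f \o shift b = cst (f b) + df +o_ 0 id.
  apply/eqaddoP => e e0.
  pose L := `|K| + 1; have L0 : 0 < L by rewrite ltr_wpDl.
  near=> h => /=.
  have -> : (f \o shift b - (cst (f b) + df)) h = f (b + h) - f b - df h.
    by rewrite !fctE /= opprD addrA (addrC h).
  apply: le_trans (fK h) _.
  rewrite expr2 mulrA; apply: ler_wpM2r => //.
  apply: (@le_trans _ _ (L * `|h|)).
    by apply: ler_wpM2r => //; rewrite (le_trans (ler_norm K))// lerDl.
  rewrite mulrC -ler_pdivlMr//.
  by near: h; apply: nbhs0_le; rewrite divr_gt0.
have E := diff_unique cdf H.
by split=> //; apply/diff_locallyP; rewrite E.
Unshelve. all: by end_near.
Qed.

Section quadratic_remainder.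
Context {R : realType} {p : nat}.

Lemma dot_linear (g : 'cV[R]_p) : linear (dot g : 'cV[R]_p -> R^o).
Proof. by move=> a u v; rewrite dotDr dotZr. Qed.

Lemma continuous_dot (g : 'cV[R]_p) : continuous (dot g : 'cV[R]_p -> R^o).
Proof.
have -> : (dot g : 'cV[R]_p -> R^o) = fun u => \sum_j g j 0 * u j 0.
  by apply/funext => u; exact: dotE.
apply: continuous_big => [|j _ u]; first exact: add_continuous.
apply: (@continuousM _ _ (fun=> g j 0) (fun v : 'cV[R]_p => v j 0)).
  exact: cst_continuous.
exact: coord_continuous.
Qed.

(** Differentiability refers to the sup norm, the remainder bounds to the Euclidean one; this
    converts between them. *)
Lemma dot_le_sup_norm (h : 'cV[R]_p) : dot h h <= p%:R * `|h| ^+ 2.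
Proof.
rewrite dotE -[p in p%:R]card_ord mulr_natl -sumr_const; apply: ler_sum => j _.
rewrite -expr2 -real_normK ?num_real// lerXn2r ?nnegrE//.
rewrite [leRHS]mx_normrE.
exact: (le_bigmax _ (fun i : 'I_p * 'I_1 => `|h i.1 i.2|) (j, 0)).
Qed.

Lemma differentiable_quadratic_remainder (f : 'cV[R]_p -> R^o) (g b : 'cV[R]_p) (K : R) :
  (forall h, `|f (b + h) - f b - dot g h| <= K * dot h h) ->
  differentiable f b /\ forall v, 'D_v f b = dot g v.
Proof.
move=> fK.
pose df : {linear 'cV[R]_p -> R^o} :=
  HB.pack (dot g : 'cV[R]_p -> R^o) (GRing.isLinear.Build _ _ _ _ _ (dot_linear g)).
have cdf : continuous df by exact: continuous_dot.
have [D E] : differentiable f b /\ 'd f b = df :> ('cV[R]_p -> R^o).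
  apply: (differentiable_norm_remainder (K := `|K| * p%:R) cdf) => h.
  apply: le_trans (fK h) _; apply: le_trans (ler_wpM2r (dot_ge0 h) (ler_norm K)) _.
  by rewrite -mulrA; apply: ler_wpM2l => //; exact: dot_le_sup_norm.
by split=> // v; rewrite deriveE// E.
Qed.

Lemma grad_quadratic_remainder (f : 'cV[R]_p -> R) (g b : 'cV[R]_p) (K : R) :
  (forall h, `|f (b + h) - f b - dot g h| <= K * dot h h) ->
  grad f b = g.
Proof.
move=> /differentiable_quadratic_remainder[_ Df]; apply/colP => j; rewrite mxE Df.
rewrite dotE (bigD1 j)//= big1 ?addr0 => [|i ij]; first by rewrite mxE !eqxx mulr1.
by rewrite mxE (negbTE ij) mulr0.
Qed.

End quadratic_remainder.

Section huber.
Context {R : realType}.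
Variable g : R.
Hypothesis g0 : 0 < g.
Implicit Types s t r : R.

Let clip_cases t : [\/ `|t| <= g /\ clip g t = t,
  [/\ g < t, `|t| = t & clip g t = g] | [/\ g < - t, `|t| = - t & clip g t = - g]].
Proof.
have g_gt0 := g0.
have [tg|] := lerP `|t| g; first by constructor 1; rewrite clip_id.
rewrite lter_normr => /orP[h|h].
  have {}h : g < t := h.
  constructor 2; split=> //; first by rewrite ger0_norm//; lra.
  by apply: clip_gt; lra.
have {}h : g < - t := h.
constructor 3; split=> //; first by rewrite ltr0_norm//; lra.
by apply: clip_lt; lra.
Qed.

(** The Huber loss is the supremum of s t - s^2 / 2 over |s| <= g; the clipped value attains it. *)
Lemma huber_clip t : huber g t = clip g t * t - clip g t ^+ 2 / 2.
Proof.
have g_gt0 := g0.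
rewrite /huber; case: (clip_cases t) => [[h ->]|[h -> ->]|[h -> ->]].
- by rewrite h; lra.
- by rewrite leNgt h /=; lra.
- by rewrite leNgt h /=; lra.
Qed.

(** The Huber loss is also the infimal convolution of the half square and g |.|, again attained at
    the clipped value. The two formulas give convexity and smoothness without differentiating. *)
Lemma huber_clip_prox t : huber g t = clip g t ^+ 2 / 2 + g * `|t - clip g t|.
Proof.
have g_gt0 := g0.
rewrite /huber; case: (clip_cases t) => [[h ->]|[h -> ->]|[h -> ->]].
- by rewrite h subrr normr0 mulr0 addr0.
- by rewrite leNgt h /= ger0_norm; lra.
- by rewrite leNgt h /= opprK ltr0_norm; lra.
Qed.

Lemma huber_dual s t : `|s| <= g -> s * t - s ^+ 2 / 2 <= huber g t.
Proof.
have g_gt0 := g0.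
move=> sg; rewrite huber_clip_prox; set c := clip g t; set r := t - c.
have tE : t = c + r by rewrite /r addrCA subrr addr0.
have h1 : s * r <= g * `|r|.
  apply: le_trans (ler_norm _) _; rewrite normrM; exact: ler_wpM2r.
have := sqr_ge0 (s - c); rewrite {1}tE; nra.
Qed.

Lemma huber_tangent_le t t' : huber g t + clip g t * (t' - t) <= huber g t'.
Proof.
have g_gt0 := g0.
rewrite huber_clip; have := huber_dual t' (clip_norm t (ltW g0)).
by rewrite mulrBr; lra.
Qed.

(** 1-smoothness: with the supremum formula at t' and the infimum formula at t, what remains is the
    square of c + (t' - t) - c'. *)
Lemma huber_le_tangent t t' :
  huber g t' <= huber g t + clip g t * (t' - t) + (t' - t) ^+ 2 / 2.
Proof.
have g_gt0 := g0.
rewrite (huber_clip t') (huber_clip_prox t); set c := clip g t; set c' := clip g t'.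
set r := t - c.
have tE : t = c + r by rewrite /r addrCA subrr addr0.
have h1 : c' * r <= g * `|r|.
  apply: le_trans (ler_norm _) _; rewrite normrM; apply: ler_wpM2r => //.
  by apply: clip_norm; exact: ltW.
have := sqr_ge0 (c + (t' - t) - c'); nra.
Qed.

Lemma huber_quadratic t t' : `|t| <= g -> `|t'| <= g ->
  huber g t' = huber g t + clip g t * (t' - t) + (t' - t) ^+ 2 / 2.
Proof. have g_gt0 := g0; by move=> ht ht'; rewrite clip_id// /huber ht ht'; lra. Qed.

Lemma clip_lipschitz s t : `|clip g s - clip g t| <= `|s - t|.
Proof.
have g_gt0 := g0.
wlog st : s t / s <= t => [h|].
  have [/h//|/ltW ts] := leP s t.
  by rewrite distrC (distrC s); exact: h.
have h1 : Num.min g s <= clip g s by rewrite le_max lexx orbT.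
have h2 : - g <= clip g s by rewrite le_max lexx.
have h3 : Num.min g t <= Num.min g s + (t - s).
  rewrite ge_min; case: (leP g s) => _; apply/orP; [left|right]; lra.
have h4 : clip g t <= clip g s + (t - s).
  by rewrite {1}/clip ge_max; apply/andP; split; lra.
have h5 : Num.min g s <= Num.min g t by rewrite le_min ge_min lexx /= ge_min st orbT.
have h6 : clip g s <= clip g t.
  rewrite {1}/clip ge_max; apply/andP; split; first by rewrite le_max lexx.
  by rewrite le_max h5 orbT.
by rewrite distrC (distrC s) !ger0_norm; lra.
Qed.

End huber.

Section empirical_huber_objective.
Context {R : realType} {n p : nat}.
Variables (g : R) (x : 'I_n -> 'cV[R]_p) (y : 'I_n -> R) (A : {set 'I_n}).
Hypothesis g_gt0 : 0 < g.

Let f := empirical_huber g x y A.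

Definition huber_gradient (b : 'cV[R]_p) : 'cV[R]_p :=
  - (#|A|%:R^-1 *: \sum_(i in A) clip g (y i - dot (x i) b) *: x i).

Lemma dot_huber_gradient b h : dot (huber_gradient b) h =
  #|A|%:R^-1 * \sum_(i in A) clip g (y i - dot (x i) b) * - dot (x i) h.
Proof.
rewrite /huber_gradient dotNl dotZl dotC dot_sumr -mulrN -sumrN; congr (_ * _).
by apply: eq_bigr => i _; rewrite dotZr mulrN (dotC h).
Qed.

Let residualB b b' i :
  y i - dot (x i) b' - (y i - dot (x i) b) = - dot (x i) (b' - b).
Proof. by rewrite dotBr; ring. Qed.

Lemma empirical_huber_tangent_le b b' :
  f b + dot (huber_gradient b) (b' - b) <= f b'.
Proof.
rewrite dot_huber_gradient /f /empirical_huber -mulrDr -big_split /=.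
apply: ler_wpM2l; first by rewrite invr_ge0.
by apply: ler_sum => i _; rewrite -residualB; exact: huber_tangent_le.
Qed.

Lemma empirical_huber_le_tangent b b' :
  f b' <= f b + dot (huber_gradient b) (b' - b) +
    #|A|%:R^-1 * \sum_(i in A) dot (x i) (b' - b) ^+ 2 / 2.
Proof.
rewrite dot_huber_gradient /f /empirical_huber -!mulrDr -!big_split /=.
apply: ler_wpM2l; first by rewrite invr_ge0.
apply: ler_sum => i _; rewrite -[dot _ _ ^+ 2]sqrrN -residualB.
exact: huber_le_tangent.
Qed.

(** Terms whose residuals lie in the quadratic zone at both points contribute the exact second-order
    term; the others are bounded below by convexity. *)
Lemma empirical_huber_strong (alpha : R) b b' : (0 < #|A|)%N ->
  alpha * #|A|%:R * dot (b' - b) (b' - b) <=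
    \sum_(i in A | (`|y i - dot (x i) b| <= g) && (`|y i - dot (x i) b'| <= g))
      dot (x i) (b' - b) ^+ 2 ->
  f b + dot (huber_gradient b) (b' - b) + alpha / 2 * norm2 (b' - b) ^+ 2 <= f b'.
Proof.
move=> A0 H; have Ap : 0 < #|A|%:R :> R by rewrite ltr0n.
rewrite norm2_sq.
have -> : alpha / 2 * dot (b' - b) (b' - b) =
    #|A|%:R^-1 * (alpha * #|A|%:R * dot (b' - b) (b' - b) / 2).
  by field; rewrite gt_eqF.
rewrite dot_huber_gradient /f /empirical_huber -!mulrDr.
apply: ler_wpM2l; first by rewrite invr_ge0.
rewrite -big_split /=.
set S := \sum_(i in A | _) _ in H.
have H2 : alpha * #|A|%:R * dot (b' - b) (b' - b) / 2 <= S / 2.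
  by rewrite ler_pM2r.
apply: (le_trans (lerD (lexx _) H2)); rewrite /S.
rewrite mulr_suml [X in _ + X]big_mkcondr /= -big_split /=.
apply: ler_sum => i _; rewrite -residualB; case: ifPn => [/andP[h1 h2]|_].
  rewrite -[dot _ _ ^+ 2]sqrrN -residualB.
  by rewrite -(huber_quadratic g_gt0 h1 h2).
by rewrite addr0; exact: huber_tangent_le.
Qed.

Lemma empirical_huber_remainder b h :
  `|f (b + h) - f b - dot (huber_gradient b) h| <=
  (#|A|%:R^-1 * \sum_(i in A) dot (x i) (x i)) * dot h h.
Proof.
have h1 := empirical_huber_tangent_le b (b + h).
have h2 := empirical_huber_le_tangent b (b + h).
rewrite (addrC b h) addrK in h1 h2 *.
have h3 : #|A|%:R^-1 * \sum_(i in A) dot (x i) h ^+ 2 / 2 <=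
    (#|A|%:R^-1 * \sum_(i in A) dot (x i) (x i)) * dot h h.
  rewrite -mulrA; apply: ler_wpM2l; first by rewrite invr_ge0.
  rewrite mulr_suml; apply: ler_sum => i _.
  have := cauchy_schwarz (x i) h; have := sqr_ge0 (dot (x i) h); lra.
rewrite ler_norml; apply/andP; split; last by lra.
have : 0 <= (#|A|%:R^-1 * \sum_(i in A) dot (x i) (x i)) * dot h h.
  rewrite mulr_ge0 ?dot_ge0// mulr_ge0 ?invr_ge0//.
  by apply: sumr_ge0 => i _; exact: dot_ge0.
lra.
Qed.

Lemma grad_empirical_huber : grad f = huber_gradient.
Proof.
apply/funext => b; apply: grad_quadratic_remainder => h.
exact: empirical_huber_remainder.
Qed.

Lemma differentiable_empirical_huber b : differentiable (f : 'cV[R]_p -> R^o) b.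
Proof.
apply: (proj1 (differentiable_quadratic_remainder _)) => h.
exact: empirical_huber_remainder.
Qed.

Lemma continuous_clip : continuous (clip g).
Proof.
move=> t; apply/cvgrPdist_le => e e0; near=> s.
apply: le_trans (clip_lipschitz g_gt0 _ _) _.
by near: s; apply: cvgr_dist_le.
Unshelve. all: by end_near.
Qed.

Lemma continuous_huber_gradient : continuous huber_gradient.
Proof.
have h : continuous (fun b : 'cV[R]_p =>
    \sum_(i in A) clip g (y i - dot (x i) b) *: x i).
  apply: continuous_big => [|i _ b]; first exact: add_continuous.
  have hc : {for b, continuous (fun b : 'cV[R]_p => clip g (y i - dot (x i) b))}.
    apply: (@continuous_comp _ _ _ (fun b => y i - dot (x i) b) (clip g)).
      exact: (@continuousB _ R^o _ (fun=> y i) (dot (x i)) b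
        (@cst_continuous _ _ (y i) b) (@continuous_dot _ _ (x i) b)).
    exact: continuous_clip.
  exact: cvgZr_tmp hc.
move=> b; have h1 := @continuousZl_tmp _ _ _ _ (#|A|%:R^-1 : R) b (h b).
exact: (continuousN h1).
Qed.

Lemma continuously_differentiable_empirical_huber D :
  continuously_differentiable_on D f.
Proof.
split=> [b _|]; first exact: differentiable_empirical_huber.
rewrite grad_empirical_huber; apply: continuous_subspaceT.
exact: continuous_huber_gradient.
Qed.

(** Strong convexity is only assumed from [bstar] and inside the ball of radius r. On the sphere the
    loss exceeds its value at [bstar], and global convexity propagates this outwards, so a minimum
    over a compact box around the ball is global. *)
Lemma empirical_huber_argmin (bstar : 'cV[R]_p) (alpha r g0 : R) :
  0 < alpha -> 0 < r -> 0 <= g0 ->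
  norm2 (huber_gradient bstar) <= g0 -> 2 * g0 / alpha < r ->
  (forall b, norm2 (b - bstar) <= r ->
    f bstar + dot (huber_gradient bstar) (b - bstar) +
      alpha / 2 * norm2 (b - bstar) ^+ 2 <= f b) ->
  argmin f !=set0 /\ forall b, argmin f b -> norm2 (b - bstar) <= 2 * g0 / alpha.
Proof.
move=> a0 r0 g00 Gg gr H.
have near_bound b : norm2 (b - bstar) <= r -> f b <= f bstar ->
    norm2 (b - bstar) <= 2 * g0 / alpha.
  move=> /H h1 h2; set t := norm2 (b - bstar) in h1 *.
  have t0 : 0 <= t by exact: norm2_ge0.
  have := cauchy_schwarz_norm2 (huber_gradient bstar) (b - bstar).
  rewrite ler_norml -/t => /andP[h3 _].
  have h4 : norm2 (huber_gradient bstar) * t <= g0 * t by exact: ler_wpM2r.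
  have h5 : alpha / 2 * t ^+ 2 <= g0 * t by lra.
  rewrite ler_pdivlMr//; have [->|tn] := eqVneq t 0; first by rewrite mul0r; lra.
  have tp : 0 < t by rewrite lt_def tn.
  rewrite -(ler_pM2r tp); lra.
have far b : r < norm2 (b - bstar) -> f bstar < f b.
  move=> rb; set t := norm2 (b - bstar) in rb.
  have t0 : 0 < t by exact: lt_trans rb.
  pose s := r / t; have s0 : 0 < s by rewrite divr_gt0.
  have s1 : s < 1 by rewrite ltr_pdivrMr// mul1r.
  pose c := bstar + s *: (b - bstar).
  have cb : norm2 (c - bstar) = r.
    by rewrite /c addrAC subrr add0r norm2Z gtr0_norm// -/t divfK// gt_eqF.
  have fc : f bstar < f c.
    rewrite ltNge; apply/negP => /(near_bound _ _); rewrite cb lexx => /(_ isT).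
    by rewrite leNgt gr.
  (* Two tangents at the point c of the sphere: the comparison with [bstar] forces a positive slope
     in the direction of b, and the tangent towards b then gives f b > f c. *)
  have h1 := empirical_huber_tangent_le c bstar.
  have h2 := empirical_huber_tangent_le c b.
  have e1 : bstar - c = - s *: (b - bstar).
    by rewrite /c opprD addrA subrr add0r scaleNr.
  have e2 : b - c = (1 - s) *: (b - bstar).
    by rewrite /c opprD addrA scalerBl scale1r.
  move: h1 h2; rewrite e1 e2 !dotZr; set q := dot _ _ => h1 h2.
  nra.
have cf : continuous f.
  move=> b; have := differentiable_continuous (differentiable_empirical_huber b).
  exact.
(* A product of segments containing the Euclidean ball, transposed to rows so that the extreme value
   theorem applies. *)
pose box := [set v : 'rV[R]_p | forall j, `[bstar j 0 - r, bstar j 0 + r]%classic (v ord0 j)].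
have cbox : compact box.
  exact: (@rV_compact R p (fun j => `[bstar j 0 - r, bstar j 0 + r]%classic)
    (fun j => @segment_compact R _ _)).
have sbox : box bstar^T.
  by move=> j; rewrite /= in_itv /= mxE; apply/andP; split; lra.
have tr_cont : continuous (fun v : 'rV[R]_p => v^T : 'cV[R]_p).
  move=> v B /= /nbhs_ballP[e e0 eB]; apply/nbhs_ballP; exists e => // w [_ vw].
  by apply: eB; split=> // i j; rewrite !mxE; exact: vw.
have bne : box !=set0 by exists bstar^T.
have fcont : {within box, continuous (fun v : 'rV[R]_p => f v^T)}.
  apply: continuous_subspaceT => v.
  exact: (continuous_comp (tr_cont v) (@cf _)).
have [c _ cmin] := EVT_min_rV bne cbox fcont.
have in_box b : norm2 (b - bstar) <= r -> box b^T.
  move=> br j; rewrite /= in_itv /= mxE -ler_distl.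
  apply: le_trans br; rewrite -ler_sqr ?nnegrE ?norm2_ge0// norm2_sq dotE.
  rewrite real_normK ?num_real// (bigD1 j)//= !mxE -expr2 lerDl.
  by apply: sumr_ge0 => k _; rewrite -expr2 sqr_ge0.
have cstar : f c^T <= f bstar by have := cmin _ (mem_set sbox); rewrite trmxK.
split.
  exists c^T => b; have [br|rb] := leP (norm2 (b - bstar)) r.
    by have := cmin _ (mem_set (in_box _ br)); rewrite trmxK.
  exact: le_trans cstar (ltW (far _ rb)).
move=> b bmin; have fb := bmin bstar.
apply: near_bound => //; rewrite leNgt; apply/negP => /far.
by rewrite ltNge fb.
Qed.

End empirical_huber_objective.

(** * Deterministic guarantee *)

Section deterministic_analysis.
Context {R : realType} {n p : nat}.
Variables (x : 'I_n -> 'cV[R]_p) (z : 'I_n -> R) (A : {set 'I_n}).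
Variables (bstar : 'cV[R]_p) (g c0 B alpha rho : R).
Hypotheses (n_gt0 : (0 < n)%N) (g_gt0 : 0 < g) (c0_gt0 : 0 < c0)
  (c0_le1 : c0 <= 1) (B_ge1 : 1 <= B).
(** Small-ball indices contribute c0 / 128 per sample at a net point, hence c0 / 256 = 2 alpha after
    passing to the direction itself; the net error takes one alpha and leaves one. The relation
    between B and rho makes that error at most alpha. *)
Hypotheses (c0E : c0 = 512 * alpha) (BrhoE : B * rho = alpha).
Hypothesis card_A : (1 - c0 / 32) * n%:R <= #|A|%:R.
Hypothesis moment_A : forall v, \sum_(i in A) dot (x i) v ^+ 2 <= B * n%:R * dot v v.
Hypothesis small_ball_count : forall v, norm2 v = 1 ->
  exists2 u, norm2 (v - u) <= rho &
    c0 / 4 * n%:R <= #|[set i | 1 / 16 <= dot (x i) u ^+ 2]%SET|%:R.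
Hypothesis noise_count :
  #|[set i | g / 2 <= `|z i|]%SET|%:R <= c0 / 32 * n%:R.
Variable t : R.
Hypothesis gradient_bound : forall v, norm2 v <= 1 ->
  exists2 u, norm2 (v - u) <= 1 / 2 &
    \sum_(i in A) dot (x i) u * clip g (z i) <= t.
Hypotheses (t_ge0 : 0 <= t) (t_small : 8 * t / (n%:R * alpha) <= rho * g).

Let y i := dot (x i) bstar + z i.
Let f := empirical_huber g x y A.
Let N : R := n%:R.
Let N_gt0 : 0 < N. Proof. by rewrite ltr0n. Qed.

Let card_A_ge : N / 2 <= #|A|%:R.
Proof.
have h := card_A; have h1 := c0_le1; have h2 := N_gt0.
by apply: le_trans h; rewrite -/N; nra.
Qed.

Let card_A_gt0 : (0 < #|A|)%N.
Proof.
rewrite -(ltr0n R); have h := card_A_ge; have h2 := N_gt0.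
by apply: lt_le_trans h; lra.
Qed.

Let residualE b i : y i - dot (x i) b = z i - dot (x i) (b - bstar).
Proof. by rewrite /y dotBr; ring. Qed.

Let alpha_gt0 : 0 < alpha.
Proof. have h := c0_gt0; have h1 := c0E; lra. Qed.

Let B_gt0 : 0 < B. Proof. exact: lt_le_trans B_ge1. Qed.

Let rho_gt0 : 0 < rho.
Proof. by rewrite -(pmulr_rgt0 _ B_gt0) BrhoE. Qed.

Let rho_le : rho <= 1 / 512.
Proof.
have h1 : rho <= alpha by rewrite -BrhoE ler_peMl// ltW.
have h2 := c0_le1; have h3 := c0E; apply: le_trans h1 _; lra.
Qed.

(** A net of radius 1/2 recovers the norm of the sum up to a factor 2, and |A| >= N / 2 gives
    another 2. *)
Let gradient_small : norm2 (huber_gradient g x y A bstar) <= 4 * t / N.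
Proof.
set w : 'cV[R]_p := \sum_(i in A) clip g (y i - dot (x i) bstar) *: x i.
have wz u : dot u w = \sum_(i in A) dot (x i) u * clip g (z i).
  rewrite /w dot_sumr; apply: eq_bigr => i _; rewrite dotZr residualE subrr dot0r subr0.
  by rewrite mulrC dotC.
have w2t : norm2 w <= 2 * t.
  have [->|w0] := eqVneq w 0; first by rewrite norm2_0 mulr_ge0.
  have nw := norm2_gt0 w0; set v := (norm2 w)^-1 *: w.
  have v1 : norm2 v = 1.
    by rewrite norm2Z ger0_norm ?invr_ge0 ?norm2_ge0// mulVf// gt_eqF.
  have [|u uv ut] := @gradient_bound v; first by rewrite v1.
  have vw : dot v w = norm2 w.
    by rewrite /v dotZl -norm2_sq expr2 mulKf// gt_eqF.
  have := cauchy_schwarz_norm2 (v - u) w; rewrite ler_norml => /andP[_].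
  rewrite dotBl vw wz => h.
  have h2 : norm2 (v - u) * norm2 w <= 1 / 2 * norm2 w.
    by apply: ler_wpM2r => //; exact: norm2_ge0.
  lra.
rewrite /huber_gradient norm2N norm2Z -/w.
have Ap : 0 < #|A|%:R :> R by rewrite ltr0n.
rewrite ger0_norm ?invr_ge0// mulrC ler_pdivrMr//.
have h1 := card_A_ge; have h2 := t_ge0.
apply: le_trans w2t _.
apply: (@le_trans _ _ (4 * t / N * (N / 2))).
  by rewrite [leRHS](_ : _ = 2 * t)//; field; rewrite gt_eqF.
by apply: ler_wpM2l => //; rewrite divr_ge0 ?mulr_ge0// ltW.
Qed.

Let far (b : 'cV[R]_p) : {set 'I_n} :=
  [set i in A | g / 2 < `|dot (x i) (b - bstar)|]%SET.

(* Chebyshev's inequality for the empirical second moment. *)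
Let card_far b : norm2 (b - bstar) <= 2 * rho * g -> #|far b|%:R <= c0 / 32 * N.
Proof.
move=> br.
have h1 : #|far b|%:R * (g ^+ 2 / 4) <= B * N * (4 * rho ^+ 2 * g ^+ 2).
  apply: (@le_trans _ _ (\sum_(i in far b) dot (x i) (b - bstar) ^+ 2)).
    rewrite mulr_natl -sumr_const; apply: ler_sum => i; rewrite inE => /andP[_ gi].
    rewrite -[leRHS]real_normK ?num_real//.
    have -> : g ^+ 2 / 4 = (g / 2) ^+ 2 by rewrite expr_div_n; congr (_ / _); ring.
    by rewrite lerXn2r ?nnegrE ?(ltW gi)// divr_ge0// ltW.
  apply: (@le_trans _ _ (\sum_(i in A) dot (x i) (b - bstar) ^+ 2)).
    rewrite [leRHS](bigID (fun i => g / 2 < `|dot (x i) (b - bstar)|)) /=.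
    rewrite (eq_bigl (fun i => (i \in A) && (g / 2 < `|dot (x i) (b - bstar)|))).
      by rewrite lerDl; apply: sumr_ge0 => i _; exact: sqr_ge0.
    by move=> i; rewrite inE.
  apply: le_trans (moment_A _) _; apply: ler_wpM2l.
    by rewrite mulr_ge0 ?ltW.
  rewrite -norm2_sq; have -> : 4 * rho ^+ 2 * g ^+ 2 = (2 * rho * g) ^+ 2 by ring.
  apply: lerXn2r => //; rewrite nnegrE ?norm2_ge0//.
  by rewrite !mulr_ge0// ltW.
have g2 : 0 < g ^+ 2 by rewrite exprn_gt0.
have h2 : #|far b|%:R <= 16 * (B * rho) * rho * N.
  rewrite -(ler_pM2r (_ : 0 < g ^+ 2 / 4)) ?divr_gt0//.
  by apply: le_trans h1 _; rewrite le_eqVlt; apply/orP; left; apply/eqP; field.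
apply: le_trans h2 _; apply: ler_wpM2r; first exact: ltW.
rewrite BrhoE; have h3 := rho_le; have h4 := c0E; have h5 := alpha_gt0; nra.
Qed.

(** Counting: small-ball indices for the direction b' - b are numerous, and most of them are
    retained and have both residuals in the quadratic zone. *)
Let strong b b' : norm2 (b - bstar) <= 2 * rho * g -> norm2 (b' - bstar) <= 2 * rho * g ->
  f b + dot (huber_gradient g x y A b) (b' - b) + alpha / 2 * norm2 (b' - b) ^+ 2 <= f b'.
Proof.
move=> br br'; apply: empirical_huber_strong => //.
set good := (X in \sum_(i in A | X i) _).
set h := b' - b.
have [->|h0] := eqVneq h 0.
  by rewrite dot0l mulr0; apply: sumr_ge0 => i _; exact: sqr_ge0.
have nh := norm2_gt0 h0; pose v := (norm2 h)^-1 *: h.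
have v1 : norm2 v = 1.
  by rewrite norm2Z ger0_norm ?invr_ge0 ?norm2_ge0// mulVf// gt_eqF.
have hE : h = norm2 h *: v by rewrite scalerA divff ?scale1r// gt_eqF.
suff H : alpha * N <= \sum_(i in A | good i) dot (x i) v ^+ 2.
  rewrite [X in \sum_(i in A | good i) X i](_ : _ = fun i => dot h h * dot (x i) v ^+ 2).
    rewrite -mulr_sumr mulrC; apply: ler_wpM2l; first exact: dot_ge0.
    apply: le_trans H; apply: ler_wpM2l; first exact: ltW.
    by rewrite ler_nat -[leqRHS]card_ord max_card.
  by apply/funext => i; rewrite {1}hE dotZr exprMn norm2_sq.
have [u uv Lu] := small_ball_count v1.
set L := [set i | 1 / 16 <= dot (x i) u ^+ 2]%SET in Lu.
set Zb := [set i | g / 2 <= `|z i|]%SET.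
pose S := [set i in A | good i]%SET.
(* Off the exceptional sets the noise and both products are at most g / 2 in absolute value, so both
   residuals are at most g. *)
have sub : L \subset (L :&: S) :|: (~: A :|: (Zb :|: (far b :|: far b')))%SET.
  apply/fintype.subsetP => i iL; rewrite !inE.
  have [iA|//] := boolP (i \in A); rewrite ?orbT//=.
  have [iZ|iZ] := leP (g / 2) `|z i|; first by rewrite !orbT.
  have [ib|ib] := ltP (g / 2) `|dot (x i) (b - bstar)|; first by rewrite !orbT.
  have [ib'|ib'] := ltP (g / 2) `|dot (x i) (b' - bstar)|; first by rewrite !orbT.
  rewrite !orbF; move: iL; rewrite inE => -> /=.
  rewrite /good !residualE; apply/andP; split.
    by apply: le_trans (ler_normB _ _) _; lra.
  by apply: le_trans (ler_normB _ _) _; lra.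
have cardL : #|L|%:R <= #|(L :&: S)%SET|%:R +
    (#|(~: A)%SET|%:R + (#|Zb|%:R + (#|far b|%:R + #|far b'|%:R))) :> R.
  rewrite -!natrD ler_nat; apply: leq_trans (subset_leq_card sub) _.
  apply: leq_trans (leq_card_setU _ _) _; rewrite leq_add2l.
  apply: leq_trans (leq_card_setU _ _) _; rewrite leq_add2l.
  apply: leq_trans (leq_card_setU _ _) _; rewrite leq_add2l.
  exact: leq_card_setU.
have cardAC : #|(~: A)%SET|%:R <= c0 / 32 * N.
  have : #|A|%:R + #|(~: A)%SET|%:R = N by rewrite -natrD cardsC card_ord.
  have hA := card_A; rewrite -/N in hA; lra.
have cb := card_far br; have cb' := card_far br'.
have cz := noise_count; rewrite -/Zb -/N in cz; rewrite -/N in Lu.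
(* Four exceptional sets of size c0 N / 32 are removed from c0 N / 4. *)
have cardLS : c0 / 8 * N <= #|(L :&: S)%SET|%:R by lra.
have sumu : c0 / 128 * N <= \sum_(i in A | good i) dot (x i) u ^+ 2.
  apply: (@le_trans _ _ (\sum_(i in (L :&: S)%SET) dot (x i) u ^+ 2)).
    apply: (@le_trans _ _ (#|(L :&: S)%SET|%:R * (1 / 16))); first by lra.
    rewrite mulr_natl -sumr_const; apply: ler_sum => i.
    by rewrite !inE => /andP[].
  rewrite (eq_bigl (fun i => ((i \in A) && good i) && (i \in L))); last first.
    by move=> i; rewrite !inE andbC.
  rewrite big_mkcondr /=; apply: ler_sum => i _.
  by case: ifP => // _; exact: sqr_ge0.
have sumd : \sum_(i in A | good i) dot (x i) (v - u) ^+ 2 <= alpha * N.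
  apply: (@le_trans _ _ (\sum_(i in A) dot (x i) (v - u) ^+ 2)).
    rewrite big_mkcondr /=; apply: ler_sum => i _.
    by case: ifP => // _; exact: sqr_ge0.
  apply: le_trans (moment_A _) _; rewrite -norm2_sq -/N -BrhoE.
  have h1 : norm2 (v - u) ^+ 2 <= rho ^+ 2.
    by rewrite lerXn2r ?nnegrE ?norm2_ge0// ltW.
  have h2 := rho_le; have h3 := rho_gt0.
  have h4 : norm2 (v - u) ^+ 2 <= rho by nra.
  rewrite -mulrA [leRHS]mulrAC -!mulrA; apply: ler_wpM2l; first exact: ltW.
  by apply: ler_wpM2l => //; exact: ltW.
(* Passes from the net point u to the direction v by a^2 <= 2 c^2 + 2 (a - c)^2. *)
have : \sum_(i in A | good i) dot (x i) u ^+ 2 <=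
    2 * \sum_(i in A | good i) dot (x i) v ^+ 2 +
    2 * \sum_(i in A | good i) dot (x i) (v - u) ^+ 2.
  rewrite !mulr_sumr -big_split /=; apply: ler_sum => i _.
  rewrite dotBr; move: (dot (x i) u) (dot (x i) v) => a c.
  have := sqr_ge0 (a - 2 * c); lra.
have h5 : c0 * N = 512 * (alpha * N) by rewrite c0E mulrA.
lra.
Qed.

(** Strong convexity holds within 2 rho g of [bstar] and minimizers lie within rho g of it, so the
    ball of radius rho g around a minimizer is covered. *)
Lemma deterministic_guarantee :
  argmin f !=set0 /\
  forall b, argmin f b ->
    norm2 (b - bstar) <= 8 * t / (n%:R * alpha) /\
    strongly_convex_on alpha (eball b (rho * g)) f.
Proof.
have e : 2 * (4 * t / N) / alpha = 8 * t / (n%:R * alpha).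
  by rewrite -/N; field; rewrite !gt_eqF.
have rg : 0 < rho * g by rewrite mulr_gt0.
have [| | | |ne H] := @empirical_huber_argmin R n p g x y A g_gt0 bstar alpha
    (2 * rho * g) (4 * t / N) alpha_gt0 _ _ gradient_small.
- by rewrite -mulrA mulr_gt0.
- by rewrite divr_ge0 ?mulr_ge0// ltW.
- rewrite e; apply: le_lt_trans t_small _; lra.
- move=> b br; apply: strong => //.
  by rewrite subrr norm2_0 ltW// -mulrA mulr_gt0.
split=> // b bmin; have bb := H b bmin; rewrite e in bb; split=> //.
have inb c : eball b (rho * g) c -> norm2 (c - bstar) <= 2 * rho * g.
  rewrite /eball /= => cb; have -> : c - bstar = (c - b) + (b - bstar).
    by rewrite addrA subrK.
  apply: le_trans (norm2_triangle _ _) _; have := t_small; lra.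
split; first exact: continuously_differentiable_empirical_huber.
move=> c c' /inb hc /inb hc'; rewrite grad_empirical_huber//; exact: strong.
Qed.

End deterministic_analysis.

(** * Output of the filter *)

Section finite_valued_maps.
Context {d : measure_display} {T : measurableType d} {K : finType}.

(** Meant for G the retained set: an event about it splits over its finitely many values. *)
Lemma measurable_finite_valued (G : T -> K) (H : K -> set T) :
  (forall k, measurable (G @^-1` [set k])) -> (forall k, measurable (H k)) ->
  measurable [set t | H (G t) t].
Proof.
move=> mG mH.
have -> : [set t | H (G t) t] = \bigcup_(k in [set: K]) (G @^-1` [set k] `&` H k).
  apply/seteqP; split => [t Ht|t [k _ [/= <-]]//]; by exists (G t).
apply: fin_bigcup_measurable; first exact: finite_finset.
by move=> k _; exact: measurableI.
Qed.

End finite_valued_maps.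

Lemma measurable_sum_in (d : measure_display) (T : measurableType d)
    (R : realType) (I : finType) (A : {set I}) (h : I -> T -> R) :
  (forall i, measurable_fun [set: T] (h i)) ->
  measurable_fun [set: T] (fun t => \sum_(i in A) h i t).
Proof.
move=> mh; have -> : (fun t => \sum_(i in A) h i t) =
    (fun t => \sum_i (if i \in A then h i t else 0)).
  by apply/funext => t; exact: (big_mkcond (mem A) (h ^~ t)).
by apply: measurable_sum => i; case: (i \in A); [exact: mh|exact: measurable_cst].
Qed.

Lemma measurable_to_cylinders (d d' : measure_display) (T : measurableType d)
    (U : pointedType) (I : Type) (S : measurableType d') (phi : I -> U -> S)
    (f : T -> g_sigma_algebraType (cylinders phi)) :
  (forall i, measurable_fun [set: T] (fun t => phi i (f t))) ->
  measurable_fun [set: T] f.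
Proof.
move=> mf; apply: (@measurability _ _ T (g_sigma_algebraType (cylinders phi))
  setT f (cylinders phi)) => // _ [_ [i [B mB ->]] <-].
exact: mf.
Qed.

Section product_measure_bounds.
Context {d d' : measure_display} {Omega : measurableType d} {W : measurableType d'}
  {R : realType} (P : probability Omega R) (Q : probability W R).

Lemma product_measure_xsection_le (C : set (Omega * W)) (a : R) :
  measurable C -> (forall w, Q [set w' | C (w, w')] <= a%:E)%E ->
  ((P \x Q) C <= a%:E)%E.
Proof.
move=> mC Ca; rewrite /product_measure1 /=.
apply: (@le_trans _ _ (\int[P]_w (cst a%:E w))%E); last first.
  by rewrite integral_cst//= probability_setT mule1.
apply: ge0_le_integral => //.
  exact: measurable_fun_xsection.
move=> w _ /=; apply: le_trans (Ca w).
by rewrite (_ : xsection C w = [set w' | C (w, w')])//; apply/seteqP; split => w';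
  rewrite /xsection /= inE.
Qed.

(** Sections at a fixed seed serve the events of the sample; sections at a fixed sample serve the
    failure of the filter. *)
Lemma product_measure_ysection_le (C : set (Omega * W)) (a : R) :
  measurable C -> (forall w', P [set w | C (w, w')] <= a%:E)%E ->
  ((P \x Q) C <= a%:E)%E.
Proof.
move=> mC Ca.
have -> : ((P \x Q) C = (P \x^ Q) C)%E.
  by apply: product_measure_unique => //= A B mA mB; rewrite product_measure2E.
rewrite /product_measure2 /=.
apply: (@le_trans _ _ (\int[Q]_w (cst a%:E w))%E); last first.
  by rewrite integral_cst//= probability_setT mule1.
apply: ge0_le_integral => //.
  exact: measurable_fun_ysection.
move=> w' _ /=; apply: le_trans (Ca w').
by rewrite (_ : ysection C w' = [set w | C (w, w')])//; apply/seteqP; split => w;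
  rewrite /ysection /= inE.
Qed.

End product_measure_bounds.

(** A self-bounding supremum s, finite by Cauchy-Schwarz: net points have norm at most 5/4, so s <=
    2 (25/16) c + 2 s / 16, hence s <= 25 c / 7. *)
Lemma moment_bound_of_net (R : realType) (I : finType) (p : nat) (A : {set I})
    (x : I -> 'cV[R]_p) (c : R) (N : seq 'cV[R]_p) : 0 <= c ->
  (forall v, norm2 v <= 1 -> exists2 u, u \in N & norm2 (v - u) <= 1 / 4) ->
  (forall u, u \in N -> \sum_(i in A) dot (x i) u ^+ 2 <= c * dot u u) ->
  forall v, \sum_(i in A) dot (x i) v ^+ 2 <= 4 * c * dot v v.
Proof.
move=> c0 netN HN; pose S v := \sum_(i in A) dot (x i) v ^+ 2.
pose D := [set S v | v in [set v : 'cV[R]_p | norm2 v <= 1]].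
have SZ a v : S (a *: v) = a ^+ 2 * S v.
  by rewrite /S mulr_sumr; apply: eq_bigr => i _; rewrite dotZr exprMn.
have ubD : has_ubound D.
  exists (\sum_(i in A) dot (x i) (x i)) => _ [v /= v1 <-].
  apply: ler_sum => i _; apply: le_trans (cauchy_schwarz _ _) _.
  rewrite ler_piMr ?dot_ge0// -norm2_sq expr_le1 ?norm2_ge0//.
have S_le v : norm2 v <= 1 -> S v <= sup D.
  by move=> v1; apply: ub_le_sup => //; exists v.
have S_leZ v : S v <= sup D * dot v v.
  have [->|v0] := eqVneq v 0.
    rewrite dot0l mulr0 /S big1// => i _; by rewrite dot0r expr0n.
  have nv := norm2_gt0 v0.
  have -> : v = norm2 v *: ((norm2 v)^-1 *: v).
    by rewrite scalerA divff ?scale1r// gt_eqF.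
  rewrite SZ dotZl dotZr mulrA -expr2 mulrCA; apply: ler_wpM2l; first exact: sqr_ge0.
  rewrite dotZl dotZr mulrA -expr2 -norm2_sq exprVn mulVf ?mulr1; last first.
    by rewrite expf_eq0 /= gt_eqF.
  by apply: S_le; rewrite norm2Z ger0_norm ?invr_ge0 ?norm2_ge0// mulVf// gt_eqF.
have s0 : 0 <= sup D.
  apply: le_trans (S_le 0 _); last by rewrite norm2_0.
  by apply: sumr_ge0 => i _; exact: sqr_ge0.
suff s4c : sup D <= 4 * c.
  by move=> v; apply: le_trans (S_leZ v) _; apply: ler_wpM2r => //; exact: dot_ge0.
suff : sup D <= 25 / 8 * c + sup D / 8 by lra.
apply: ge_sup; first by exists (S 0); exists 0 => //=; rewrite norm2_0.
move=> _ [v /= v1 <-]; have [u uN uv] := netN v v1.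
have u54 : dot u u <= 25 / 16.
  have -> : 25 / 16 = (5 / 4) ^+ 2 :> R by lra.
  rewrite -norm2_le; last by lra.
  have -> : u = v - (v - u) by rewrite opprB addrCA subrr addr0.
  by apply: le_trans (norm2_triangle _ _) _; rewrite norm2N; lra.
have vu : dot (v - u) (v - u) <= 1 / 16.
  have -> : 1 / 16 = (1 / 4) ^+ 2 :> R by lra.
  by rewrite -norm2_le; lra.
have : S v <= 2 * S u + 2 * S (v - u).
  rewrite /S !mulr_sumr -big_split /=; apply: ler_sum => i _.
  rewrite dotBr; move: (dot (x i) u) (dot (x i) v) => a e.
  have := sqr_ge0 (2 * a - e); lra.
have := HN u uN; rewrite -/(S u); have := S_leZ (v - u).
have := dot_ge0 u; have := dot_ge0 (v - u); nra.
Qed.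

Section filter_output.
Context {R : realType} {n p : nat} {d : measure_display} {W : measurableType d}
  (Q : probability W R) (F : filter_type R n p W).
Variables (c1 c2 c3 c4 c5 C0min C0 e b : R).
Hypotheses (c2_gt0 : 0 < c2) (c3_gt0 : 0 < c3).
Hypotheses (n_gt0 : (0 < n)%N) (e_gt0 : 0 < e) (e_le : e <= 1 / 4) (b_gt0 : 0 < b).
Hypotheses (C0_gt1 : 1 < C0) (C0_ge : C0min <= C0) (C0e : C0 * e <= 1 / 4)
  (c2C0e : c2 * C0 * e <= 1 / 4) (c1e : c1 * e <= 1 / 2).
Hypotheses (guarantee : filter_guarantee Q c1 c2 c3 c4 c5 C0min F)
  (mF : filter_measurable F).

(** 1 + 4 b is what [stable_of_moment_bound] asks for, the moments being at most 4 b per kept point;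
    c2 / c3 makes the output parameters of the filter admissible. *)
Definition filter_radius : R := 1 + 4 * b + c2 / c3.

Definition filter_moment_constant : R :=
  1 + (c3 * filter_radius) ^+ 2 / (c2 * C0 * e).

Lemma measurable_filter_fiber T A : measurable [set w | F e T w = A].
Proof.
have h := measurable_xsection (T : points R n p) (@mF e A).
by rewrite (_ : [set w | _] = xsection [set Tw : points R n p * W | F e Tw.1 Tw.2 = A] T)//;
  apply/seteqP; split => w; rewrite /xsection /= inE.
Qed.

Lemma filter_moment_bound (T : 'I_n -> 'cV[R]_p) (S' : {set 'I_n}) :
  (1 - e) * n%:R <= #|S'|%:R ->
  (forall v, \sum_(i in S') dot (T i) v ^+ 2 <= 2 * b * n%:R * dot v v) ->
  ((1 - c4 * expR (- (c5 * (n%:R * e))))%:E <=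
   Q [set w | ((1 - c1 * e) * n%:R <= #|F e T w|%:R)%R /\
     forall v, (\sum_(i in F e T w) dot (T i) v ^+ 2 <=
       filter_moment_constant * n%:R * dot v v)%R])%E.
Proof.
move=> cS' mS'.
have N0 : 0 < n%:R :> R by rewrite ltr0n.
have he := e_gt0; have he4 := e_le; have hC := C0_gt1; have hb := b_gt0.
have r0 : 1 + 4 * b <= filter_radius by rewrite lerDl divr_ge0// ltW.
have st : stable (C0 * e) filter_radius 0 1 T S'.
  apply: (stable_of_moment_bound (c := 4 * b)) => //.
  - by rewrite mulr_gt0//; lra.
  - by have := C0e; lra.
  - by rewrite mulr_ge0// ltW.
  - move=> v; apply: le_trans (mS' v) _; apply: ler_wpM2r; first exact: dot_ge0.
    have h : n%:R / 2 <= #|S'|%:R :> R by apply: le_trans cS'; nra.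
    have b4 : 0 <= 4 * b by rewrite mulr_ge0// ltW.
    by have := ler_wpM2l b4 h; lra.
have cor : corrupted e T T.
  exists (1%g : {perm 'I_n}); rewrite (@eq_card _ _ predT) ?card_ord.
    by nra.
  by move=> i; apply: mem_set; rewrite /= perm1 eqxx.
have G := guarantee C0_gt1 C0_ge e_gt0 _ ltr01 _ _ cor cS' st.
apply: le_trans (G _ _ _) _.
- by lra.
- by have := c2C0e; lra.
- apply: (@le_trans _ _ (c3 * (c2 / c3))).
    rewrite mulrCA divff ?gt_eqF// mulr1 -mulrA ler_piMr//; first exact: ltW.
    by have := C0e; lra.
  by apply: ler_wpM2l; [exact: ltW|rewrite /filter_radius; lra].
have msets (H : {set 'I_n} -> Prop) : measurable [set w | H (F e T w)].
  apply: (@measurable_finite_valued _ _ _ (F e T) (fun A => [set _ | H A])).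
    by move=> A; exact: measurable_filter_fiber.
  move=> A; have [HA|HA] := pselect (H A).
    by rewrite (_ : [set _ | _] = setT)//; apply/seteqP; split.
  by rewrite (_ : [set _ | _] = set0)//; apply/seteqP; split.
apply: le_measure; rewrite ?inE.
- exact: (msets (fun A => ((1 - c1 * e) * n%:R <= #|A|%:R) /\
    stable (c2 * C0 * e) (c3 * filter_radius) 0 1 T A)).
- exact: (msets (fun A => ((1 - c1 * e) * n%:R <= #|A|%:R) /\
    forall v, \sum_(i in A) dot (T i) v ^+ 2 <=
      filter_moment_constant * n%:R * dot v v)).
move=> w [cA sA]; split=> // v.
have A0 : (0 < #|F e T w|)%N.
  rewrite -(ltr0n R); apply: lt_le_trans cA; rewrite mulr_gt0//.
  by have := c1e; lra.
apply: le_trans (moment_bound_of_stable A0 sA v) _.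
apply: ler_wpM2r; first exact: dot_ge0.
apply: ler_wpM2l.
  rewrite addr_ge0// divr_ge0 ?sqr_ge0// !mulr_ge0// ltW//; lra.
by rewrite ler_nat -[leqRHS]card_ord max_card.
Qed.

End filter_output.

Section kept_covariates.
Context {d : measure_display} {Omega : measurableType d} {R : realType} {n p : nat}.
Variables (x : 'I_(n + n) -> Omega -> vec R p) (b : R).
Hypotheses (n_gt0 : (0 < n)%N) (b_gt0 : 0 < b).

(** The constant is the barrier level after n steps, b n + b n. *)
Lemma kept_covariates_moment_bound (w : Omega) (e : R) :
  discarded x b w <= e * n%:R ->
  exists2 S' : {set 'I_n}, (1 - e) * n%:R <= #|S'|%:R &
    forall v, \sum_(i in S') dot (diff_covariates (x^~ w) i) v ^+ 2 <=
      2 * b * n%:R * dot v v.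
Proof.
move=> dw; pose k (i : 'I_n) := kept (b * n%:R) b (diff_sequence x w) i.
exists [set i | k i]%SET.
  have : #|[set i | k i]%SET|%:R + discarded x b w = n%:R.
    rewrite /discarded -sum1_card natr_sum [X in X + _]big_mkcond /= -big_split /=.
    rewrite (eq_bigr (fun=> 1)) ?sumr_const ?card_ord// => i _.
    by rewrite inE /k; case: kept; rewrite ?addr0 ?add0r.
  lra.
move=> v; have bn : 0 < b * n%:R by rewrite mulr_gt0// ltr0n.
have := @kept_moment_le R p (b * n%:R) b (diff_sequence x w) bn (ltW b_gt0) n v.
have -> : b * n%:R + b * n%:R = 2 * b * n%:R by ring.
apply: le_trans; rewrite le_eqVlt; apply/orP; left; apply/eqP.
by apply: eq_big => i; rewrite ?inE// diff_sequenceE.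
Qed.

End kept_covariates.

Section gradient_tail.
Context {d : measure_display} {Omega : measurableType d} {R : realType}
  (P : probability Omega R) {n p : nat}.
Variables (x : 'I_(n + n) -> Omega -> vec R p) (z : 'I_(n + n) -> Omega -> R).
Hypotheses (mx : forall i, measurable_fun setT (x i)) (iidz : iid P z)
  (xz : independent_families P x z).

Let mz i : measurable_fun setT (z i). Proof. by have [] := iidz. Qed.

Lemma cylinders_measurable (d' : measure_display) (S : measurableType d') (I : Type)
    (X : I -> Omega -> S) : (forall i, measurable_fun setT (X i)) ->
  cylinders X `<=` measurable.
Proof.
move=> mX _ [i [B mB ->]].
by rewrite -(setTI (_ @^-1` _)); exact: mX.
Qed.

Lemma measurable_cylinders (d' : measure_display) (S : measurableType d') (I : Type)
    (X : I -> Omega -> S) i :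
  measurable_fun [set: g_sigma_algebraType (cylinders X)] (X i).
Proof.
by move=> _ B mB; rewrite setTI; apply: sub_sigma_algebra; exists i; exists B.
Qed.

Lemma measurable_diff_covariates (d' : measure_display) (T : measurableType d')
    (X : 'I_(n + n) -> T -> vec R p) i : (forall j, measurable_fun [set: T] (X j)) ->
  measurable_mx (fun t => diff_covariates (X^~ t) i).
Proof.
by move=> mX; apply/measurable_mxZ/measurable_mxB; exact: measurable_vec_mx.
Qed.

(** The random set G depends on the covariates only. Freezing them leaves a clipped-noise sum with
    deterministic weights of square sum at most v, or an empty event. *)
Lemma gradient_event_tail (G : Omega -> {set 'I_n}) (u : 'cV[R]_p) (g v t : R) :
  0 < g -> 0 < v -> 0 < t ->
  (forall A, <<s cylinders x >> (G @^-1` [set A])) ->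
  (P [set w | (\sum_(i in G w) dot (diff_covariates (x^~ w) i) u ^+ 2 <= v)%R /\
     (t <= \sum_(i in G w) dot (diff_covariates (x^~ w) i) u * clip g (diff_noise z w i))%R]
   <= (expR (- (t ^+ 2 / (8 * g ^+ 2 * v))))%:E)%E.
Proof.
move=> g0 v0 t0 sG.
set Ox := g_sigma_algebraType (cylinders x).
set Oz := g_sigma_algebraType (cylinders z).
pose H (A : {set 'I_n}) : set (Ox * Oz) :=
  [set q | \sum_(i in A) dot (diff_covariates (x^~ q.1) i) u ^+ 2 <= v] `&`
  [set q | t <= \sum_(i in A) dot (diff_covariates (x^~ q.1) i) u *
                                clip g (diff_noise z q.2 i)].
pose V : set (Ox * Oz) := [set q | H (G q.1) q].
have mdx i : measurable_fun [set: Ox * Oz] (fun q : Ox * Oz => dot (diff_covariates (x^~ q.1) i) u).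
  have h : measurable_mx (T := Ox) (fun w => diff_covariates (x^~ w) i).
    by apply: measurable_diff_covariates => j; exact: measurable_cylinders.
  apply: measurable_dot; first exact: (measurable_mx_comp h measurable_fst).
  exact: measurable_mx_cst.
have mdz i : measurable_fun [set: Ox * Oz] (fun q : Ox * Oz => clip g (diff_noise z q.2 i)).
  have h : measurable_fun [set: Oz] (fun w : Oz => diff_noise z w i).
    apply: measurable_funM; last exact: measurable_cst.
    by apply: measurable_funB; exact: measurable_cylinders.
  exact: (measurableT_comp (measurable_clip g) (measurableT_comp h measurable_snd)).
have mV : measurable V.
  apply: (@measurable_finite_valued _ (Ox * Oz)%type _ (fun q => G q.1) H).
    move=> A.
    have := @measurable_fst _ _ Ox Oz measurableT _ (sG A).
    by rewrite setTI.
  move=> A; apply: measurableI.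
    apply: (@measurable_le_set _ (Ox * Oz)%type R).
    by apply: measurable_sum_in => i; exact: measurable_funX.
  apply: (@measurable_ge_set _ (Ox * Oz)%type R).
  by apply: measurable_sum_in => i; exact: measurable_funM.
pose f (q : Ox * Oz) : \bar R := (\1_V q)%:E.
have mf : measurable_fun [set: Ox * Oz] f.
  by apply/measurable_EFinP; exact: measurable_indic.
have f0 q : (0 <= f q)%E by rewrite lee_fin.
have mOx := cylinders_measurable mx; have mOz := cylinders_measurable mz.
have mdiag : measurable_fun [set: Omega] (fun w => (w, w) : Ox * Oz).
  apply/measurable_fun_pair; exact: measurable_sub_sigma_algebra.
have -> : [set w | (\sum_(i in G w) dot (diff_covariates (x^~ w) i) u ^+ 2 <= v)%R /\
     (t <= \sum_(i in G w) dot (diff_covariates (x^~ w) i) u * clip g (diff_noise z w i))%R]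
   = (fun w => (w, w) : Ox * Oz) @^-1` V by [].
have mpre : measurable ((fun w : Omega => (w, w) : Ox * Oz) @^-1` V).
  by have := mdiag measurableT _ mV; rewrite setTI.
rewrite -(setIT (_ @^-1` V)) -integral_indic//.
have -> : (\int[P]_w (\1_((fun w : Omega => (w, w) : Ox * Oz) @^-1` V) w)%:E =
    \int[P]_w f (w, w))%E by [].
rewrite (freezing_sub mOx mOz mf f0 xz).
apply: (@le_trans _ _ (\int[P]_w (cst (expR (- (t ^+ 2 / (8 * g ^+ 2 * v))))%:E w))%E); last first.
  by rewrite integral_cst//= probability_setT mule1.
apply: ge0_le_integral => //.
- by move=> w _; apply: integral_ge0.
- have h := measurable_frozen_integral_sub P mOz mf f0.
  exact: (measurableT_comp h (measurable_sub_sigma_algebra mOx)).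
move=> w _ /=.
(* Zero weights outside the retained set turn the sum into one over all indices. *)
pose a i := if i \in G w then dot (diff_covariates (x^~ w) i) u else 0.
have [av|av] := leP (\sum_(i in G w) dot (diff_covariates (x^~ w) i) u ^+ 2) v; last first.
  rewrite integral0_eq ?lee_fin ?expR_ge0// => w' _.
  by rewrite /f indicE memNset// => -[/= h _]; move: av; rewrite ltNge h.
have sa : \sum_i a i ^+ 2 <= v.
  apply: le_trans av; rewrite [leRHS]big_mkcond /=; apply: ler_sum => i _.
  by rewrite /a; case: ifP => //; rewrite expr0n.
apply: le_trans (clip_noise_tail iidz g0 v0 t0 sa).
have mT : measurable [set w' | t <= \sum_i a i * clip g (diff_noise z w' i)].
  apply: measurable_ge_set; apply: measurable_sum => i.
  apply: measurable_funM; first exact: measurable_cst.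
  apply: (measurableT_comp (measurable_clip g)).
  by apply: measurable_funM; [exact: measurable_funB|exact: measurable_cst].
rewrite -[X in (_ <= P X)%E]setIT -integral_indic//.
apply: ge0_le_integral => //.
- have h := measurable_fun_pair2 (w : Ox) mf.
  exact: (measurableT_comp h (measurable_sub_sigma_algebra mOz)).
- by apply/measurable_EFinP; exact: measurable_indic.
move=> w' _; rewrite lee_fin !indicE ler_nat; case: (boolP ((w, w') \in V)) => //.
rewrite inE => -[/= _ h]; rewrite mem_set//=; apply: le_trans h _.
rewrite [leLHS]big_mkcond /=; apply: ler_sum => i _.
by rewrite /a; case: ifP => //; rewrite mul0r.
Qed.

End gradient_tail.

(** * The main event *)

Lemma measure_bigsetU_le (d : measure_display) (T : measurableType d) (R : realType)
    (mu : probability T R) (I : eqType) (s : seq I) (Q : pred I) (A : I -> set T) (a : R) :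
  0 <= a -> (forall i, measurable (A i)) ->
  (forall i, Q i -> (mu (A i) <= a%:E)%E) ->
  (mu (\big[setU/set0]_(i <- s | Q i) A i) <= ((size s)%:R * a)%:E)%E.
Proof.
move=> a0 mA Aa; elim: s => [|i s IH]; first by rewrite big_nil measure0 mul0r.
have h : (mu (\big[setU/set0]_(i <- s | Q i) A i) <= ((size (i :: s))%:R * a)%:E)%E.
  by apply: le_trans IH _; rewrite lee_fin ler_wpM2r// ler_nat.
rewrite big_cons; case: ifP => // Qi.
apply: le_trans (measureU2 _ _ _) _ => //; first exact: bigsetU_measurable.
rewrite /= -natr1 mulrDl mul1r addrC EFinD; apply: leeD => //.
exact: Aa.
Qed.

Lemma mem_bigsetU (T : Type) (I : eqType) (s : seq I) (Q : pred I) (A : I -> set T) i t :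
  i \in s -> Q i -> A i t -> (\big[setU/set0]_(i <- s | Q i) A i) t.
Proof.
elim: s => // j s IH; rewrite inE => /orP[/eqP <-|/IH h] Qi Ai; rewrite big_cons.
  by rewrite Qi; left.
by case: ifP => _; [right; exact: h|exact: h].
Qed.

Section main_event.
Context {R : realType} {n p : nat} {d d' : measure_display}
  {Omega : measurableType d} (P : probability Omega R)
  {W : measurableType d'} (Q : probability W R)
  (F : filter_type R n p W)
  (x : 'I_(n + n) -> Omega -> vec R p) (z : 'I_(n + n) -> Omega -> R).
Variables (c1 c2 c3 c4 c5 C0min C0 e K4 g q t : R).
Hypotheses (c2_gt0 : 0 < c2) (c3_gt0 : 0 < c3).
Hypotheses (n_gt0 : (0 < n)%N) (p_gt0 : (0 < p)%N) (pn : (p <= n)%N).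
Hypotheses (e_gt0 : 0 < e) (e_le : e <= 1 / 4) (C0_gt1 : 1 < C0) (C0_ge : C0min <= C0)
  (C0e : C0 * e <= 1 / 4) (c2C0e : c2 * C0 * e <= 1 / 4) (c1e : c1 * e <= 1 / 2).
Hypotheses (mF : filter_measurable F)
  (guarantee : filter_guarantee Q c1 c2 c3 c4 c5 C0min F).
Hypotheses (mx : forall i, measurable_fun setT (x i))
  (indx : mutually_independent P x) (isox : forall i, isotropic P (x i))
  (meanx : forall i j, (\int[P]_w (x i w j 0%R)%:E = 0)%E)
  (K4_ge1 : 1 <= K4)
  (fourth : forall i v,
     (\int[P]_w (dot v (x i w) ^+ 4)%:E <= (K4 * dot v v ^+ 2)%:E)%E)
  (iidz : iid P z) (xz : independent_families P x z).
Let c0 : R := 1 / (8 * K4).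
(** Chosen so that 24 / b = e / 2: discarding e n covariates then has probability at most exp (- e n
    / 2). *)
Let b : R := 48 / e.
Let Bf := filter_moment_constant c2 c3 C0 e b.
Let B := 4 * Bf.
Variable rho : R.
Hypotheses (g_gt0 : 0 < g) (t_gt0 : 0 < t) (rho_gt0 : 0 < rho) (rho_le : rho <= 1 / 2).
(** The upper tail of the count has exponent 3 (c0 / 192) n - (c0 / 32) n = - (c0 / 64) n. *)
Hypothesis large_noise :
  forall i, (P [set w | (g / 2 <= `|diff_noise z w i|)%R] <= (c0 / 192)%:E)%E.
Hypotheses (q_discard : expR (- (e / 2 * n%:R)) <= q)
  (q_filter : c4 * expR (- (c5 * (n%:R * e))) <= q)
  (q_ball : expR ((1 / rho + 2) * p%:R) * expR (- (c0 / 4 * n%:R)) <= q)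
  (q_noise : expR (- (c0 / 64 * n%:R)) <= q)
  (q_grad : expR (4 * p%:R) * expR (- (t ^+ 2 / (8 * g ^+ 2 * (9 / 4 * (B * n%:R))))) <= q).

Let N_gt0 : 0 < n%:R :> R. Proof. by rewrite ltr0n. Qed.
Let K4_gt0 : 0 < K4. Proof. exact: lt_le_trans K4_ge1. Qed.
Let c0_gt0 : 0 < c0. Proof. by rewrite divr_gt0// mulr_gt0. Qed.
Let b_gt0 : 0 < b. Proof. by rewrite divr_gt0. Qed.
Let mz i : measurable_fun setT (z i). Proof. by have [] := iidz. Qed.
Let indz : mutually_independent P z. Proof. by have [] := iidz. Qed.

Let Bf_ge1 : 1 <= Bf.
Proof.
rewrite /Bf /filter_moment_constant lerDl divr_ge0 ?sqr_ge0// ltW// !mulr_gt0//.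
exact: lt_trans C0_gt1.
Qed.

Let Bf_ge0 : 0 <= Bf. Proof. exact: le_trans Bf_ge1. Qed.

Let q_ge0 : 0 <= q. Proof. apply: le_trans q_discard; exact: expR_ge0. Qed.

Let xd (w : Omega) (i : 'I_n) : 'cV[R]_p := diff_covariates (x^~ w) i.

Let ball_set (u : 'cV[R]_p) (i : 'I_n) : set Omega :=
  [set w | dot u u / 4 <= dot (xd w i) u ^+ 2].

Let ball_set_measurable u i : <<s pair_block x i >> (ball_set u i).
Proof.
have h : measurable_fun [set: g_sigma_algebraType (pair_block x i)]
    (fun w => dot (xd w i) u ^+ 2 : R).
  apply/measurable_funX/measurable_dot; last exact: measurable_mx_cst.
  apply/measurable_mxZ/measurable_mxB; apply: measurable_vec_mx.
    exact: measurable_pair_block_lshift.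
  exact: measurable_pair_block_rshift.
exact: (measurable_ge_set (dot u u / 4) h).
Qed.

Let ball_set_prob u i : u != 0 -> (c0%:E <= P (ball_set u i))%E.
Proof.
move=> u0.
have lr : lshift n i != rshift n i by exact: lshift_neq_rshift.
pose J1 := [set lshift n i]%SET; pose J2 := [set rshift n i]%SET.
have ind A1 A2 : <<s generated_by x J1 >> A1 -> <<s generated_by x J2 >> A2 ->
    P (A1 `&` A2) = (P A1 * P A2)%E.
  apply: mutually_independent_blocks => //.
  by apply/finset.setP => k; rewrite !inE; case: eqVneq => // ->; rewrite (negbTE lr).
apply: (small_ball_diff (generated_by_measurable mx (J := J1))
  (generated_by_measurable mx (J := J2)) _ _ ind (isox _) (isox _)
  (meanx _) (fourth _) (fourth _) K4_gt0 u0).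
  by apply: measurable_vec_mx; apply: measurable_generated_by; rewrite inE.
by apply: measurable_vec_mx; apply: measurable_generated_by; rewrite inE.
Qed.

Let noise_set (i : 'I_n) : set Omega := [set w | g / 2 <= `|diff_noise z w i|].

Let noise_set_measurable i : <<s pair_block z i >> (noise_set i).
Proof.
have h : measurable_fun [set: g_sigma_algebraType (pair_block z i)]
    (fun w => `|diff_noise z w i| : R).
  have h := measurable_diff_noise (z := z) (i := i).
  by apply: (@measurableT_comp _ _ _ _ _ _ (@Num.norm _ R)).
exact: (measurable_ge_set (g / 2) h).
Qed.

Let Fx (ww : Omega * W) : {set 'I_n} := F e (xd ww.1) ww.2.

Let measurable_points (d1 : measure_display) (T : measurableType d1)
    (X : 'I_(n + n) -> T -> vec R p) :
  (forall j, measurable_fun [set: T] (X j)) ->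
  measurable_fun [set: T] (fun w => diff_covariates (X^~ w) : points R n p).
Proof.
move=> mX; apply: measurable_to_cylinders => -[i j] /=.
exact: (measurable_diff_covariates i mX).
Qed.

Let Fx_fiber A : measurable (Fx @^-1` [set A]).
Proof.
have h : measurable_fun [set: Omega * W]
    (fun ww : Omega * W => (xd ww.1 : points R n p, ww.2)).
  apply/measurable_fun_pair; last exact: measurable_snd.
  exact: (measurableT_comp (measurable_points mx) measurable_fst).
by have := h measurableT _ (@mF e A); rewrite setTI.
Qed.

(** With the seed fixed the retained set is a function of the covariates, hence independent of the
    noise. *)
Let Fx_fiber_x w' A : <<s cylinders x >> ((fun w => Fx (w, w')) @^-1` [set A]).
Proof.
pose Ox := g_sigma_algebraType (cylinders x).
have h : measurable_fun [set: Ox] (fun w : Ox => (xd w : points R n p, w')).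
  apply/measurable_fun_pair; last exact: measurable_cst.
  by apply: measurable_points => j; exact: measurable_cylinders.
by have := h measurableT _ (@mF e A); rewrite setTI.
Qed.

Let measurable_xd i u :
  measurable_fun [set: Omega * W] (fun ww : Omega * W => dot (xd ww.1 i) u).
Proof.
apply: measurable_dot; last exact: measurable_mx_cst.
exact: (measurable_mx_comp (measurable_diff_covariates i mx) measurable_fst).
Qed.

Let measurable_noise i :
  measurable_fun [set: Omega * W] (fun ww : Omega * W => clip g (diff_noise z ww.1 i)).
Proof.
have h : measurable_fun [set: Omega] (fun w => diff_noise z w i).
  by apply: measurable_funM; [exact: measurable_funB|exact: measurable_cst].
exact: (measurableT_comp (measurable_clip g) (measurableT_comp h measurable_fst)).
Qed.

Let card_ok (A : {set 'I_n}) : Prop := (1 - c1 * e) * n%:R <= #|A|%:R.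

Let moment_set (A : {set 'I_n}) (u : 'cV[R]_p) : set (Omega * W) :=
  [set ww | \sum_(i in A) dot (xd ww.1 i) u ^+ 2 <= Bf * n%:R * dot u u].

Let moment_set_measurable A u : measurable (moment_set A u).
Proof.
apply: (@measurable_le_set _ (Omega * W)%type R).
by apply: measurable_sum_in => i; exact: measurable_funX.
Qed.

(** The moment bound is imposed on finitely many directions so that the event is visibly measurable;
    [moment_bound_of_net] recovers all directions. *)
Let good_filter (N : seq 'cV[R]_p) (A : {set 'I_n}) : set (Omega * W) :=
  [set _ | card_ok A] `&` \big[setI/setT]_(u <- N) moment_set A u.

Let good_filter_measurable N : measurable [set ww | good_filter N (Fx ww) ww].
Proof.
apply: measurable_finite_valued => A; first exact: Fx_fiber.
apply: measurableI.
  have [HA|HA] := pselect (card_ok A).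
    by rewrite (_ : [set _ | _] = setT)//; apply/seteqP; split.
  by rewrite (_ : [set _ | _] = set0)//; apply/seteqP; split.
by apply: bigsetI_measurable => u _; exact: moment_set_measurable.
Qed.

Let good_filterP N A ww : (card_ok A /\ forall u, u \in N -> moment_set A u ww) <->
  good_filter N A ww.
Proof.
have h : (forall u, u \in N -> moment_set A u ww) <->
    (\big[setI/setT]_(u <- N) moment_set A u) ww.
  elim: N => [|u N IH]; first by rewrite big_nil; split.
  rewrite big_cons; split => [H|[Hu /IH HN] v].
    split; first by apply: H; rewrite inE eqxx.
    by apply/IH => v vN; apply: H; rewrite inE vN orbT.
  by rewrite inE => /orP[/eqP ->//|]; exact: HN.
by split=> -[? H]; split=> //; apply/h.
Qed.

Let bad_discard : set (Omega * W) := [set ww | e * n%:R <= discarded x b ww.1].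

Let bad_discard_measurable : measurable bad_discard.
Proof.
apply: (@measurable_ge_set _ (Omega * W)%type R).
have h : measurable_fun [set: Omega] (discarded x b : Omega -> R).
  exact: measurable_discarded.
exact: (measurableT_comp h measurable_fst).
Qed.

Let bad_discard_prob : ((P \x Q) bad_discard <= q%:E)%E.
Proof.
apply: product_measure_ysection_le => // w'.
apply: le_trans (discarded_tail p_gt0 pn b_gt0 mx indx isox (e * n%:R)) _.
rewrite lee_fin; apply: le_trans q_discard; rewrite ler_expR.
rewrite (_ : 24 / b = e / 2); first by lra.
by rewrite /b; field; rewrite gt_eqF.
Qed.

(** Removing [bad_discard] lets the failure bound hold for every fixed sample: the section is empty
    where too many covariates are discarded, and elsewhere the guarantee applies. *)
Let bad_filter (N : seq 'cV[R]_p) : set (Omega * W) :=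
  ~` bad_discard `\` [set ww | good_filter N (Fx ww) ww].

Let bad_filter_measurable N : measurable (bad_filter N).
Proof. by apply: measurableD => //; exact: measurableC. Qed.

Let bad_filter_prob N : ((P \x Q) (bad_filter N) <= q%:E)%E.
Proof.
apply: product_measure_xsection_le => // w.
have [dw|dw] := leP (e * n%:R) (discarded x b w).
  rewrite (_ : [set w' | _] = set0) ?measure0 ?lee_fin//.
  by apply/seteqP; split => w' // -[]; rewrite /bad_discard /= dw.
have [S' cS' mS'] := kept_covariates_moment_bound n_gt0 b_gt0 (ltW dw).
have h := filter_moment_bound c2_gt0 c3_gt0 n_gt0 e_gt0 e_le b_gt0
  C0_gt1 C0_ge C0e c2C0e c1e guarantee mF cS' mS'.
set G := [set w' | _] in h.
have mG : measurable G.
  apply: (@measurable_finite_valued _ _ _ (F e (xd w)) (fun A => [set _ | card_ok A /\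
    forall v, \sum_(i in A) dot (xd w i) v ^+ 2 <= Bf * n%:R * dot v v])).
    by move=> A; exact: measurable_filter_fiber.
  move=> A; set H := (X in [set _ | X]); have [HA|HA] := pselect H.
    by rewrite (_ : [set _ | _] = setT)//; apply/seteqP; split.
  by rewrite (_ : [set _ | _] = set0)//; apply/seteqP; split.
have sub : [set w' | bad_filter N (w, w')] `<=` ~` G.
  move=> w' [_ H] [G1 G2]; apply: H; apply/good_filterP; split=> // u _.
  exact: G2.
apply: (@le_trans _ _ (Q (~` G))).
  apply: le_measure => //; rewrite inE; last exact: measurableC.
  have := measurable_xsection w (bad_filter_measurable N).
  rewrite (_ : xsection _ _ = [set w' | bad_filter N (w, w')])//.
  by apply/seteqP; split => w'; rewrite /xsection /= inE.
rewrite probability_setC//.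
have fG : Q G \is a fin_num by exact: fin_num_measure.
move: h; rewrite -(fineK fG) -EFinB !lee_fin => h.
by apply: le_trans q_filter; lra.
Qed.

Let bad_ball (N : seq 'cV[R]_p) : set (Omega * W) :=
  \big[setU/set0]_(u <- N | u != 0)
    [set ww | occurrences (ball_set u) ww.1 <= c0 / 4 * n%:R].

Let occ_measurable u : measurable_fun [set: Omega * W]
  (fun ww : Omega * W => occurrences (ball_set u) ww.1 : R).
Proof.
have h : measurable_fun [set: Omega] (occurrences (ball_set u) : Omega -> R).
  exact: (measurable_occurrences mx (@ball_set_measurable u)).
exact: (measurableT_comp h measurable_fst).
Qed.

Let bad_ball_measurable N : measurable (bad_ball N).
Proof.
apply: bigsetU_measurable => u _.
exact: (@measurable_le_set _ (Omega * W)%type R).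
Qed.

Let bad_ball_prob (N : seq 'cV[R]_p) :
  (size N)%:R <= expR ((1 / rho + 2) * p%:R) -> ((P \x Q) (bad_ball N) <= q%:E)%E.
Proof.
move=> sN; apply: (@le_trans _ _ ((size N)%:R * expR (- (c0 / 4 * n%:R)))%:E); last first.
  rewrite lee_fin; apply: le_trans q_ball; apply: ler_wpM2r => //; exact: expR_ge0.
apply: (@measure_bigsetU_le _ (Omega * W)%type _ (P \x Q)%E).
- exact: expR_ge0.
- by move=> u; exact: (@measurable_le_set _ (Omega * W)%type R).
- move=> u u0; apply: product_measure_ysection_le => [|w'].
    exact: (@measurable_le_set _ (Omega * W)%type R).
  apply: (occurrences_lower_tail mx indx (@ball_set_measurable u)) => i.
  exact: ball_set_prob.
Qed.

Let bad_noise : set (Omega * W) :=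
  [set ww | c0 / 32 * n%:R <= occurrences noise_set ww.1].

Let bad_noise_measurable : measurable bad_noise.
Proof.
apply: (@measurable_ge_set _ (Omega * W)%type R).
have h : measurable_fun [set: Omega] (occurrences noise_set : Omega -> R).
  exact: (measurable_occurrences mz noise_set_measurable).
exact: (measurableT_comp h measurable_fst).
Qed.

Let bad_noise_prob : ((P \x Q) bad_noise <= q%:E)%E.
Proof.
apply: product_measure_ysection_le => // w'.
apply: le_trans (occurrences_upper_tail mz indz noise_set_measurable
  (q := c0 / 192) (c0 / 32 * n%:R) large_noise) _.
rewrite lee_fin; apply: le_trans q_noise; rewrite ler_expR; lra.
Qed.

(** The factor 9/4 is (3/2)^2: the net points that matter lie within 1/2 of the unit ball. *)
Let bad_gradient (N : seq 'cV[R]_p) : set (Omega * W) :=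
  \big[setU/set0]_(u <- N)
    [set ww | (\sum_(i in Fx ww) dot (xd ww.1 i) u ^+ 2 <= 9 / 4 * (B * n%:R))%R /\
      (t <= \sum_(i in Fx ww) dot (xd ww.1 i) u * clip g (diff_noise z ww.1 i))%R].

Let bad_gradient1_measurable u : measurable
  [set ww | (\sum_(i in Fx ww) dot (xd ww.1 i) u ^+ 2 <= 9 / 4 * (B * n%:R))%R /\
    (t <= \sum_(i in Fx ww) dot (xd ww.1 i) u * clip g (diff_noise z ww.1 i))%R].
Proof.
apply: (@measurable_finite_valued _ (Omega * W)%type _ Fx (fun A =>
  [set ww | \sum_(i in A) dot (xd ww.1 i) u ^+ 2 <= 9 / 4 * (B * n%:R)] `&`
  [set ww | t <= \sum_(i in A) dot (xd ww.1 i) u * clip g (diff_noise z ww.1 i)])).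
  by move=> A; exact: Fx_fiber.
move=> A; apply: measurableI.
  apply: (@measurable_le_set _ (Omega * W)%type R).
  by apply: measurable_sum_in => i; exact: measurable_funX.
apply: (@measurable_ge_set _ (Omega * W)%type R).
by apply: measurable_sum_in => i; exact: measurable_funM.
Qed.

Let bad_gradient_measurable N : measurable (bad_gradient N).
Proof. by apply: bigsetU_measurable => u _. Qed.

Let bad_gradient_prob (N : seq 'cV[R]_p) :
  (size N)%:R <= expR (4 * p%:R) :> R -> ((P \x Q) (bad_gradient N) <= q%:E)%E.
Proof.
move=> sN; set a := expR (- (t ^+ 2 / (8 * g ^+ 2 * (9 / 4 * (B * n%:R))))).
apply: (@le_trans _ _ ((size N)%:R * a)%:E); last first.
  rewrite lee_fin; apply: le_trans q_grad; apply: ler_wpM2r => //; exact: expR_ge0.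
apply: (@measure_bigsetU_le _ (Omega * W)%type _ (P \x Q)%E).
- exact: expR_ge0.
- by [].
move=> u _; apply: product_measure_ysection_le => // w'.
apply: (gradient_event_tail mx iidz xz (G := fun w => Fx (w, w'))) => //.
rewrite mulr_gt0// mulr_gt0// mulr_gt0//; exact: lt_le_trans Bf_ge1.
Qed.

Lemma main_event : exists E : set (Omega * W),
  [/\ measurable E, ((1 - 5 * q)%:E <= (P \x Q) E)%E &
    forall ww, E ww ->
      [/\ (1 - c1 * e) * n%:R <= #|Fx ww|%:R,
        forall v, \sum_(i in Fx ww) dot (xd ww.1 i) v ^+ 2 <= B * n%:R * dot v v,
        forall v, norm2 v = 1 -> exists2 u, norm2 (v - u) <= rho &
          c0 / 4 * n%:R <= #|[set i | 1 / 16 <= dot (xd ww.1 i) u ^+ 2]%SET|%:R,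
        #|[set i | g / 2 <= `|diff_noise z ww.1 i|]%SET|%:R <= c0 / 32 * n%:R &
        forall v, norm2 v <= 1 -> exists2 u, norm2 (v - u) <= 1 / 2 &
          \sum_(i in Fx ww) dot (xd ww.1 i) u * clip g (diff_noise z ww.1 i) <= t]].
Proof.
(* Radius rho is what the small-ball transfer tolerates, 1/2 suffices for the norm of the gradient,
   and 1/4 fits [moment_bound_of_net]. *)
have [N1 sN1 netN1] := euclidean_net p_gt0 rho_gt0.
have [N2 sN2 netN2] := @euclidean_net R p (1 / 2) p_gt0 ltac:(lra).
have [N4 _ netN4] := @euclidean_net R p (1 / 4) p_gt0 ltac:(lra).
have sN2' : (size N2)%:R <= expR (4 * p%:R) :> R.
  by apply: le_trans sN2 _; rewrite (_ : 1 / (1 / 2) + 2 = 4 :> R)//; lra.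
pose bad := bad_discard `|` (bad_filter N4 `|` (bad_ball N1 `|`
  (bad_noise `|` bad_gradient N2))).
have m4 : measurable (bad_noise `|` bad_gradient N2) by exact: measurableU.
have m3 : measurable (bad_ball N1 `|` (bad_noise `|` bad_gradient N2)) by exact: measurableU.
have m2 : measurable (bad_filter N4 `|` (bad_ball N1 `|` (bad_noise `|` bad_gradient N2))).
  exact: measurableU.
have mbad : measurable bad by exact: measurableU.
have pbad : ((P \x Q) bad <= (5 * q)%:E)%E.
  have -> : 5 * q = q + (q + (q + (q + q))) by ring.
  rewrite !EFinD /bad.
  apply: le_trans (measureU2 _ _ _) _ => //; apply: leeD; first exact: bad_discard_prob.
  apply: le_trans (measureU2 _ _ _) _ => //; apply: leeD; first exact: bad_filter_prob.
  apply: le_trans (measureU2 _ _ _) _ => //; apply: leeD; first exact: bad_ball_prob.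
  apply: le_trans (measureU2 _ _ _) _ => //; apply: leeD; first exact: bad_noise_prob.
  exact: bad_gradient_prob.
exists (~` bad); split; first exact: measurableC.
  have fb : ((P \x Q) bad)%E \is a fin_num.
    by rewrite ge0_fin_numE ?measure_ge0//; apply: le_lt_trans pbad (ltry _).
  have -> : ((P \x Q) (~` bad) = 1 - (P \x Q) bad)%E.
    exact: (@probability_setC _ (Omega * W)%type _ (P \x Q)%E).
  by move: pbad; rewrite -(fineK fb) -EFinB !lee_fin; lra.
move=> ww; rewrite /bad !setCU => -[H1 [H2 [H3 [H4 H5]]]].
have /good_filterP[cF mFN] : good_filter N4 (Fx ww) ww.
  by apply: contrapT => H; apply: H2; split.
have mFv v : \sum_(i in Fx ww) dot (xd ww.1 i) v ^+ 2 <= B * n%:R * dot v v.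
  have -> : B * n%:R = 4 * (Bf * n%:R) by rewrite /B mulrA.
  by apply: moment_bound_of_net netN4 mFN v; rewrite mulr_ge0.
split=> //.
- move=> v v1; have [u uN uv] := netN1 v ltac:(by rewrite v1).
  exists u => //.
  (* Net points near the unit sphere have norm at least 1/2, so the small-ball threshold |u|^2 / 4
     is at least 1/16. *)
  have nu : 1 / 2 <= norm2 u.
    have := norm2_triangle (v - u) u; rewrite subrK v1; have := rho_le; lra.
  have u0 : u != 0 by apply/eqP => u0; move: nu; rewrite u0 norm2_0; lra.
  have du : 1 / 16 <= dot u u / 4.
    by rewrite -norm2_sq; have := norm2_ge0 u; nra.
  have : c0 / 4 * n%:R <= occurrences (ball_set u) ww.1.
    rewrite leNgt; apply/negP => /ltW H; apply: H3.
    by apply: (mem_bigsetU (A := fun u =>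
      [set ww | occurrences (ball_set u) ww.1 <= c0 / 4 * n%:R]) uN u0).
  rewrite occurrencesE => H; apply: le_trans H _; rewrite ler_nat.
  apply: subset_leq_card; apply/fintype.subsetP => i; rewrite !inE => /asboolP.
  by rewrite /ball_set /= => /asboolP h; exact: le_trans du h.
- have : occurrences noise_set ww.1 <= c0 / 32 * n%:R.
    by rewrite leNgt; apply/negP => /ltW.
  rewrite occurrencesE; apply: le_trans; rewrite ler_nat.
  apply: subset_leq_card; apply/fintype.subsetP => i; rewrite !inE => H.
  by apply/asboolP; rewrite /noise_set /=; apply/asboolP.
- move=> v v1; have [u uN uv] := netN2 v v1; exists u => //.
  rewrite leNgt; apply/negP => /ltW H; apply: H5.
  apply: (mem_bigsetU (A := fun u => [set ww | _ /\ _]) uN) => //; split=> //.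
  apply: le_trans (mFv u) _; rewrite mulrC; apply: ler_wpM2r.
    by rewrite mulr_ge0 ?ltW// mulr_gt0//; exact: lt_le_trans Bf_ge1.
  rewrite -norm2_sq (_ : 9 / 4 = (3 / 2) ^+ 2); last by lra.
  rewrite lerXn2r ?nnegrE ?norm2_ge0//.
  have -> : u = v - (v - u) by rewrite opprB addrCA subrr addr0.
  by apply: le_trans (norm2_triangle _ _) _; rewrite norm2N; lra.
Qed.

End main_event.

(** * Sample size and conclusion *)

Lemma expR_half_le2 (R : realType) : expR (1 / 2) <= 2 :> R.
Proof.
have h : expR (1 / 2) * expR (1 / 2) = expR 1 :> R.
  by rewrite -expRD; congr expR; lra.
have := @expR1_le4 R; rewrite -h => h1; have := @expR_gt0 R (1 / 2); nra.
Qed.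

Lemma ln_ge_half (R : realType) (r : R) : 2 <= r -> 1 / 2 <= ln r.
Proof.
move=> r2; rewrite -ler_expR lnK ?posrE; last by lra.
exact: le_trans (expR_half_le2 R) r2.
Qed.

Lemma iid_fst (d d1 d2 : measure_display) (Omega : measurableType d) (R : realType)
    (P : probability Omega R) (S1 : measurableType d1) (S2 : measurableType d2)
    (I : finType) (X : I -> Omega -> S1) (Y : I -> Omega -> S2) :
  iid P (fun i w => (X i w, Y i w)) ->
  (forall i, measurable_fun setT (X i)) /\ mutually_independent P X.
Proof.
move=> [mXY iXY _]; split.
  move=> i; exact: (measurableT_comp measurable_fst (mXY i)).
move=> J B mB.
have E i : (fun w => (X i w, Y i w)) @^-1` (B i `*` setT) = X i @^-1` B i.
  by apply/seteqP; split => w //= -[].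
have := iXY J (fun i => B i `*` setT) (fun i => measurableX (mB i) measurableT).
rewrite (eq_bigcapr (fun i (_ : [set` J] i) => E i)) => ->.
by apply: eq_bigr => i _; rewrite E.
Qed.

Lemma isotropic_covariates (d : measure_display) (Omega : measurableType d)
    (R : realType) (P : probability Omega R) p (x : Omega -> 'cV[R]_p) :
  (forall j k, ('E_P[(fun w => (x w *m (x w)^T) j k)] =
     ((1%:M : 'M[R]_p) j k)%:E)%E) -> isotropic P x.
Proof.
move=> h j k; rewrite -h unlock; apply: eq_integral => w _.
by rewrite !mxE big_ord1 !mxE.
Qed.

Lemma diff_responses_linear_model (R : realType) n p (x : 'I_(n + n) -> 'cV[R]_p)
    (z : 'I_(n + n) -> R) (beta : 'cV[R]_p) i :
  diff_responses (fun j => dot (x j) beta + z j) i =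
  dot (diff_covariates x i) beta + (z (lshift n i) - z (rshift n i)) / Num.sqrt 2.
Proof. by rewrite /diff_responses dotZl dotBl; ring. Qed.

Section sample_size.
Context {R : realType}.
Variables (c0 e c4 c5 B alpha rho M l N p : R).
Hypotheses (c0_gt0 : 0 < c0) (e_gt0 : 0 < e) (c4_gt0 : 0 < c4) (c5_gt0 : 0 < c5)
  (B_gt0 : 0 < B) (alpha_gt0 : 0 < alpha) (rho_gt0 : 0 < rho)
  (M_gt0 : 0 < M).

(** The terms ensure, in order, p <= n, that the exponent of the net of radius rho is at most c0 n /
    8, and that the gradient is small enough for the strongly convex ball. *)
Definition sample_ratio : R :=
  1 + 8 * (1 / rho + 2) / c0 + 7 * M * B / (rho * alpha) ^+ 2.

(** The entries serve the gradient, the discarded covariates, the filter, and lastly both the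
    small-ball and the noise counts. *)
Definition deviation_ratio : R :=
  Num.min (1 / (2 * sample_ratio))
    (Num.min (e / 6) (Num.min (c5 * e / (3 + 2 * c4)) (c0 / 192))).

Lemma sample_ratio_ge1 : 1 <= sample_ratio.
Proof.
rewrite /sample_ratio -addrA lerDl addr_ge0// divr_ge0 ?sqr_ge0 ?(ltW c0_gt0)//.
  by rewrite mulr_ge0// addr_ge0// divr_ge0// ltW.
by rewrite ltW// !mulr_gt0.
Qed.

Lemma deviation_ratio_gt0 : 0 < deviation_ratio.
Proof.
have h := lt_le_trans ltr01 sample_ratio_ge1.
have h4 := c4_gt0; have he := e_gt0; have hc := c0_gt0.
rewrite !lt_min; apply/and4P; split; [|lra| |lra].
  by rewrite divr_gt0// mulr_gt0.
by rewrite divr_gt0 ?mulr_gt0//; lra.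
Qed.

Hypotheses (l_ge : 1 / 2 <= l) (lN : l <= deviation_ratio * N) (p_ge1 : 1 <= p)
  (pN : sample_ratio * p <= N).

Let N_gt0 : 0 < N.
Proof. by apply: lt_le_trans pN; rewrite mulr_gt0// (lt_le_trans ltr01)// sample_ratio_ge1. Qed.

Let l_le a : deviation_ratio <= a -> l <= a * N.
Proof. by move=> ha; apply: le_trans lN _; rewrite ler_wpM2r// ltW. Qed.

Lemma p_le_sample : p <= N.
Proof.
apply: le_trans pN; rewrite ler_peMl ?sample_ratio_ge1//.
by apply: le_trans p_ge1.
Qed.

Lemma discard_exponent : expR (- (e / 2 * N)) <= expR (- (3 * l)).
Proof.
rewrite ler_expR lerN2; have : l <= e / 6 * N.
  by apply: l_le; rewrite /deviation_ratio !ge_min lexx ?orbT.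
lra.
Qed.

(** The prefactor is absorbed in the exponential: l >= 1/2 gives c4 <= exp (2 c4 l). *)
Lemma filter_exponent : c4 * expR (- (c5 * (N * e))) <= expR (- (3 * l)).
Proof.
have h : l <= c5 * e / (3 + 2 * c4) * N.
  by apply: l_le; rewrite /deviation_ratio !ge_min lexx ?orbT.
have h4 := c4_gt0; have hl := l_ge.
have d0 : 0 < 3 + 2 * c4 by lra.
have h1 : (3 + 2 * c4) * l <= c5 * (N * e).
  move: h; rewrite mulrAC ler_pdivlMr//; lra.
have h2 : c4 <= expR (2 * c4 * l).
  apply: le_trans (expR_ge1Dx _); nra.
apply: (@le_trans _ _ (expR (2 * c4 * l) * expR (- (c5 * (N * e))))).
  by apply: ler_wpM2r => //; exact: expR_ge0.
by rewrite -expRD ler_expR; lra.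
Qed.

Let l_c0 : l <= c0 / 192 * N.
Proof. by apply: l_le; rewrite /deviation_ratio !ge_min lexx ?orbT. Qed.

Lemma noise_exponent : expR (- (c0 / 64 * N)) <= expR (- (3 * l)).
Proof. rewrite ler_expR lerN2; have := l_c0; lra. Qed.

Lemma ball_exponent :
  expR ((1 / rho + 2) * p) * expR (- (c0 / 4 * N)) <= expR (- (3 * l)).
Proof.
rewrite -expRD ler_expR; have h := l_c0; have hN := N_gt0; have hc := c0_gt0.
have h1 : 8 * (1 / rho + 2) / c0 * p <= N.
  apply: le_trans pN; apply: ler_wpM2r; first exact: le_trans p_ge1.
  rewrite /sample_ratio addrAC lerDr addr_ge0// divr_ge0 ?sqr_ge0//.
  by rewrite ltW// !mulr_gt0.
have h2 : 8 * ((1 / rho + 2) * p) <= N * c0.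
  move: h1; rewrite mulrAC ler_pdivrMr//; lra.
have h3 : 0 <= c0 * N by rewrite mulr_ge0// ltW.
lra.
Qed.

(** The square of the smallness condition on t in the deterministic part, up to common factors. The
    7 in [sample_ratio] is 4 + 3, from L p <= N and L l <= N. *)
Lemma gradient_size : M * B * (4 * p + 3 * l) <= (rho * alpha) ^+ 2 * N.
Proof.
have L1 := sample_ratio_ge1; set L := sample_ratio in L1.
have L0 : 0 < L by exact: lt_le_trans L1.
have h1 : l <= 1 / (2 * L) * N.
  by apply: l_le; rewrite /deviation_ratio !ge_min lexx.
have h2 : L * (4 * p + 3 * l) <= 7 * N.
  have : L * l <= N.
    move: h1; rewrite mul1r mulrC ler_pdivlMr ?mulr_gt0//.
    have hl := l_ge; nra.
  have := pN; rewrite -/L; lra.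
have ra : 0 < (rho * alpha) ^+ 2 by rewrite exprn_gt0// mulr_gt0.
have h3 : 7 * M * B <= L * (rho * alpha) ^+ 2.
  rewrite -ler_pdivrMr// /L /sample_ratio lerDr addr_ge0// divr_ge0 ?(ltW c0_gt0)//.
  by rewrite mulr_ge0// addr_ge0// divr_ge0// ltW.
have h4 : 0 <= 4 * p + 3 * l by have := p_ge1; have := l_ge; lra.
rewrite -(ler_pM2l L0).
have h5 := ler_wpM2l (ltW (mulr_gt0 M_gt0 B_gt0)) h2.
have h6 := ler_wpM2l (ltW N_gt0) h3.
lra.
Qed.

End sample_size.

Theorem theorem3p6 (R : realType)
    (c1 c2 c3 c4 c5 C0min : R)
    (hc1 : 0 < c1) (hc2 : 0 < c2) (hc3 : 0 < c3) (hc4 : 0 < c4) (hc5 : 0 < c5)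
    (C : R) :
  exists cstar0 eps0 : R, [/\ 0 < cstar0, 0 < eps0 &
  forall cstar eps' : R,
    0 < cstar -> cstar <= cstar0 -> 0 < eps' -> eps' <= eps0 ->
  exists ctau Cn K alpha rho : R,
    [/\ 0 < ctau, 0 < Cn, 0 < K, 0 < alpha & 0 < rho] /\
  forall (n p : nat) (d d' : measure_display)
    (Omega : measurableType d) (P : probability Omega R)
    (W : measurableType d') (Q : probability W R)
    (F : filter_type R n p W)
    (x : 'I_(n + n) -> Omega -> vec R p)
    (y z : 'I_(n + n) -> Omega -> R)
    (betastar : 'cV[R]_p) (sigmax4 tau gamma : R),
    (0 < n)%N -> (0 < p)%N ->
    filter_measurable F ->
    filter_guarantee Q c1 c2 c3 c4 c5 C0min F ->
    iid P (fun i w => (x i w, y i w)) ->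
    (forall i w, y i w = dot (x i w) betastar + z i w) ->
    (forall i j, ('E_P[(fun w => x i w j 0%R)] = 0)%E) ->
    (forall i j k,
       ('E_P[(fun w => (x i w *m (x i w)^T) j k)] = ((1%:M : 'M[R]_p) j k)%:E)%E) ->
    (forall i, hypercontractive P 4 sigmax4 (x i)) ->
    sigmax4 <= C ->
    iid P z ->
    independent_families P x z ->
    (forall i, ('E_P[z i] = 0)%E) ->
    0 < tau -> tau < 1 ->
    ln (1 / tau) / n%:R <= ctau ->
    0 < gamma ->
    (forall i j : 'I_(n + n), i = 0%N :> nat -> j = 1%N :> nat ->
       (P [set w | (gamma / Num.sqrt 2 <= `|z i w - z j w|)%R] <= cstar%:E)%E) ->
    Cn * (p%:R * ln p%:R) <= n%:R ->
  exists E : set (Omega * W),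
    [/\ measurable E,
        ((1 - 2 * tau)%:E <= (P \x Q)%E E)%E &
        forall w, E w ->
          let xs i := x i w.1 in
          let ys i := y i w.1 in
          huber_regression_with_filtering F gamma eps' xs ys w.2 !=set0 /\
          forall betahat,
            huber_regression_with_filtering F gamma eps' xs ys w.2 betahat ->
            norm2 (betahat - betastar) <=
              K * (gamma * (Num.sqrt (p%:R / n%:R)
                            + Num.sqrt (ln (1 / tau) / n%:R))) /\
            strongly_convex_on alpha (eball betahat (rho * gamma))
              (filtered_huber_loss F gamma eps' xs ys w.2)]].
Proof.
(* The maximum with 1 gives K4 >= 1, hence c0 <= 1/8. *)
pose Ch : R := Num.max C 1; have Ch1 : 1 <= Ch by rewrite le_max lexx orbT.
pose K4 := Ch ^+ 4; have K41 : 1 <= K4 by exact: exprn_ege1.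
have K40 : 0 < K4 by exact: lt_le_trans K41.
pose c0 : R := 1 / (8 * K4).
have c00 : 0 < c0 by rewrite divr_gt0// mulr_gt0.
have c01 : c0 <= 1 / 8.
  by rewrite /c0 ler_pdivrMr ?mulr_gt0//; lra.
pose C0 : R := Num.max C0min 1 + 1.
have C0max : 1 <= Num.max C0min 1 by rewrite le_max lexx orbT.
have C0gt1 : 1 < C0 by rewrite /C0; lra.
have C0ge : C0min <= C0.
  have : C0min <= Num.max C0min 1 by rewrite le_max lexx.
  by rewrite /C0; lra.
have C00 : 0 < C0 by lra.
(* The last three bounds keep the stability parameters before and after filtering below 1/2, and
   make the share of indices lost by the filter at most c0 / 32. *)
pose eps0 : R := Num.min (1 / 4) (Num.min (1 / (4 * C0))
  (Num.min (1 / (4 * (c2 * C0))) (c0 / (32 * c1)))).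
exists (c0 / 192), eps0; split.
- lra.
- have c2C00 : 0 < c2 * C0 by exact: mulr_gt0.
  rewrite !lt_min; apply/and4P; split; first lra.
  + by rewrite divr_gt0// mulr_gt0.
  + by rewrite divr_gt0// mulr_gt0.
  + by rewrite divr_gt0// mulr_gt0// ltr0n.
move=> cstar e cs0 cs e0; rewrite !le_min => /and4P[e1 e2 e3 e4].
have C0e : C0 * e <= 1 / 4.
  by move: e2; rewrite ler_pdivlMr ?mulr_gt0//; lra.
have c2C0e : c2 * C0 * e <= 1 / 4.
  by move: e3; rewrite ler_pdivlMr ?mulr_gt0//; lra.
have c1e : c1 * e <= c0 / 32.
  by move: e4; rewrite ler_pdivlMr ?mulr_gt0 ?ltr0n//; lra.
pose B : R := 4 * filter_moment_constant c2 c3 C0 e (48 / e).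
have B1 : 1 <= B.
  rewrite /B /filter_moment_constant mulrDr mulr1.
  have : 0 <= (c3 * filter_radius c2 c3 (48 / e)) ^+ 2 / (c2 * C0 * e).
    by rewrite divr_ge0 ?sqr_ge0// ltW// !mulr_gt0.
  lra.
have B0 : 0 < B by exact: lt_le_trans B1.
(* 1152 = 8^2 * 18, with 8 from the error bound 8 t / (n alpha) and 18 from the choice of t. *)
pose M : R := 1152; have M0 : 0 < M by rewrite /M ltr0n.
pose alpha := c0 / 512; have a0 : 0 < alpha by rewrite /alpha; lra.
pose rho := alpha / B; have r0 : 0 < rho by rewrite divr_gt0.
have r12 : rho <= 1 / 2.
  have : rho <= alpha by rewrite /rho ler_pdivrMr// ler_peMr// ltW.
  rewrite /alpha; lra.
pose L := sample_ratio c0 B alpha rho M.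
pose ctau := deviation_ratio c0 e c4 c5 B alpha rho M.
have L1 : 1 <= L by exact: sample_ratio_ge1.
have ctau0 : 0 < ctau by exact: deviation_ratio_gt0.
(* With a and c the two square roots of the rate, 8 t / (n alpha) = (8 / alpha) g sqrt (18 B (4 a^2
   + 3 c^2)), and the root of 4 a^2 + 3 c^2 is at most 2 (a + c). *)
pose K := 16 / alpha * Num.sqrt (18 * B).
have s18 : 0 < Num.sqrt (18 * B) by rewrite sqrtr_gt0 mulr_gt0.
exists ctau, (2 * L), K, alpha, rho; split.
  split=> //; first by rewrite mulr_gt0// (lt_le_trans ltr01 L1).
  by rewrite mulr_gt0// divr_gt0.
move=> n p d d' Omega P W Q F x y z bstar sigma tau g n0 p0 mF gF iidxy ymodel.
move=> Ex Exx hx sC iidz xz _ tau0 tau1 ltau g0 noise Cn.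
(* For tau >= 1/2 the probability bound is void, and otherwise 5 tau^3 <= 2 tau. *)
have [tau2|tau2] := leP (1 / 2) tau.
  exists set0; split=> //; first by rewrite measure0 lee_fin; lra.
have N0 : 0 < n%:R :> R by rewrite ltr0n.
pose l := ln (1 / tau).
have expl : expR (- l) = tau.
  by rewrite expRN /l lnK ?posrE ?divr_gt0// div1r invrK.
have l12 : 1 / 2 <= l.
  by apply: ln_ge_half; rewrite (ler_pdivlMr _ _ tau0); clear -tau2; lra.
have lN : l <= ctau * n%:R by rewrite -ler_pdivrMr.
have p1 : 1 <= p%:R :> R by rewrite ler1n.
have L0 : 0 < L by exact: lt_le_trans L1.
(* For p >= 2, ln p >= 1/2 gives the claim. For p = 1 the logarithm vanishes, and n >= L follows
   from 1/2 <= l <= n / (2 L). *)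
have pN : L * p%:R <= n%:R.
  have [p2|p2] := leqP 2 p.
    apply: le_trans Cn; rewrite mulrAC -mulrA mulrCA.
    have := @ln_ge_half R p%:R; rewrite ler_nat => /(_ p2) lnp.
    have h : 0 <= L * p%:R by rewrite mulr_ge0// ltW.
    by clear -h lnp; nra.
  have -> : p = 1%N by apply/eqP; rewrite eqn_leq p0 andbT.
  have h : ctau <= 1 / (2 * L) by rewrite /ctau /deviation_ratio ge_min lexx.
  have h2 : ctau * (2 * L) <= 1 by rewrite -ler_pdivlMr// mulr_gt0.
  rewrite mulr1; have h3 : l * (2 * L) <= ctau * n%:R * (2 * L).
    by rewrite ler_pM2r// mulr_gt0.
  by clear -N0 l12 L0 h2 h3; nra.
have pn : (p <= n)%N.
  rewrite -(ler_nat R).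
  by apply: (p_le_sample (c0 := c0) (B := B) (alpha := alpha) (rho := rho) (M := M)).
have [mx indx] := iid_fst iidxy.
have isox i : isotropic P (x i) by exact: isotropic_covariates.
have meanx i j : (\int[P]_w (x i w j 0%R)%:E = 0)%E.
  by rewrite -(Ex i j) unlock.
have fourth i v : (\int[P]_w (dot v (x i w) ^+ 4)%:E <= (K4 * dot v v ^+ 2)%:E)%E.
  have sCh : sigma <= Ch by rewrite le_max sC.
  exact: (hypercontractive_fourth_moment v (measurable_vec_mx (mx i)) (isox i) (hx i) sCh).
have nn0 : (0 < n + n)%N by rewrite addn_gt0 n0.
have nn1 : (1 < n + n)%N by exact: (leq_add n0 n0).
have large : forall i, (P [set w | (g / 2 <= `|diff_noise z w i|)%R] <= (c0 / 192)%:E)%E.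
  apply: (large_noise_prob iidz (k := Ordinal nn0) (l := Ordinal nn1)) => //.
  by apply: le_trans (noise _ _ _ _) _ => //; rewrite lee_fin.
(* Makes the gradient exponent equal to 4 p + 3 l, as 8 * 9/4 = 18: the net of exp (4 p) points is
   paid for and exp (- 3 l) = tau^3 remains. *)
pose t := g * Num.sqrt (18 * B * n%:R * (4 * p%:R + 3 * l)).
have pl0 : 0 < 4 * p%:R + 3 * l by clear -p1 l12; lra.
have Y0 : 0 < 18 * B * n%:R * (4 * p%:R + 3 * l).
  by apply: mulr_gt0 => //; apply: mulr_gt0 => //; apply: mulr_gt0.
have t0 : 0 < t by rewrite mulr_gt0// sqrtr_gt0.
have t2 : t ^+ 2 = g ^+ 2 * (18 * B * n%:R * (4 * p%:R + 3 * l)).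
  by rewrite exprMn sqr_sqrtr// ltW.
have q_grad : expR (4 * p%:R) * expR (- (t ^+ 2 / (8 * g ^+ 2 * (9 / 4 * (B * n%:R)))))
    <= expR (- (3 * l)).
  rewrite t2 -expRD ler_expR.
  rewrite [X in - X](_ : _ = 4 * p%:R + 3 * l); first by clear; lra.
  by field; rewrite !gt_eqF.
have c1e2 : c1 * e <= 1 / 2.
  by clear -c1e c01; lra.
have [E [mE PE HE]] := main_event hc2 hc3 n0 p0 pn e0 e1 C0gt1 C0ge C0e c2C0e
  c1e2 mF gF mx indx isox meanx K41 fourth iidz xz g0 t0 r0 r12 large
  (discard_exponent c00 B0 r0 M0 lN p1 pN)
  (filter_exponent c00 hc4 B0 r0 M0 l12 lN p1 pN)
  (ball_exponent c00 B0 r0 M0 lN p1 pN)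
  (noise_exponent c00 B0 r0 M0 lN p1 pN) q_grad.
exists E; split=> //.
  apply: le_trans PE; rewrite lee_fin.
  have -> : expR (- (3 * l)) = tau ^+ 3.
    by rewrite -expl -expRM_natl; congr expR; ring.
  by clear -tau0 tau2; nra.
move=> ww Eww xs ys.
have [cA mA sb nc gb] := HE ww Eww.
have loss : filtered_huber_loss F g e xs ys ww.2 =
    empirical_huber g (diff_covariates xs)
      (fun i => dot (diff_covariates xs i) bstar + diff_noise z ww.1 i)
      (F e (diff_covariates xs) ww.2).
  rewrite /filtered_huber_loss; congr empirical_huber; apply/funext => i.
  rewrite -(diff_responses_linear_model xs (z^~ ww.1)); congr diff_responses.
  by apply/funext => j; rewrite /ys ymodel.
have t_small : 8 * t / (n%:R * alpha) <= rho * g.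
  have h := gradient_size c00 B0 a0 r0 M0 l12 lN p1 pN.
  have na : 0 < n%:R * alpha by exact: mulr_gt0.
  have rg : 0 < rho * g by exact: mulr_gt0.
  rewrite (ler_pdivrMr _ _ na) -ler_sqr ?nnegrE; last 2 first.
  - by apply: mulr_ge0; [rewrite ler0n|exact: ltW].
  - by apply: ltW; exact: mulr_gt0.
  rewrite exprMn t2.
  have -> : (rho * g * (n%:R * alpha)) ^+ 2 =
    g ^+ 2 * (n%:R * ((rho * alpha) ^+ 2 * n%:R)) by ring.
  have -> : 8 ^+ 2 * (g ^+ 2 * (18 * B * n%:R * (4 * p%:R + 3 * l))) =
    g ^+ 2 * (n%:R * (M * B * (4 * p%:R + 3 * l))) by rewrite /M; ring.
  by rewrite (ler_pM2l (exprn_gt0 2 g0)) (ler_pM2l N0).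
have cA' : (1 - c0 / 32) * n%:R <= #|F e (diff_covariates xs) ww.2|%:R.
  by apply: le_trans cA; rewrite (ler_pM2r N0) lerB.
have c0le1 : c0 <= 1 by clear -c01; lra.
have c0E : c0 = 512 * alpha by rewrite /alpha; clear; lra.
have BrhoE : B * rho = alpha by rewrite /rho mulrC divfK// gt_eqF.
have [ne H] := deterministic_guarantee bstar n0 g0 c00 c0le1 B1 c0E BrhoE cA' mA sb nc gb
  (ltW t0) t_small.
rewrite /huber_regression_with_filtering loss; split=> // b /H[h1 h2]; split=> //.
apply: le_trans h1 _.
have na : 0 < n%:R * alpha by exact: mulr_gt0.
rewrite (ler_pdivrMr _ _ na).
set a := Num.sqrt (p%:R / n%:R); set c := Num.sqrt (l / n%:R).
have a20 : 0 <= a by exact: sqrtr_ge0.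
have c20 : 0 <= c by exact: sqrtr_ge0.
have l0 : 0 <= l by clear -l12; lra.
have a2 : p%:R = a ^+ 2 * n%:R by rewrite sqr_sqrtr ?divr_ge0// divfK// gt_eqF.
have c2' : l = c ^+ 2 * n%:R by rewrite sqr_sqrtr ?divr_ge0 ?(ltW N0)// divfK// gt_eqF.
have -> : K * (g * (a + c)) * (n%:R * alpha) =
    8 * (g * (Num.sqrt (18 * B) * (2 * (a + c) * n%:R))).
  by rewrite /K; field; rewrite gt_eqF.
rewrite ler_pM2l// ler_pM2l//.
have Z0 : 0 <= Num.sqrt (18 * B) * (2 * (a + c) * n%:R).
  by rewrite !mulr_ge0 ?addr_ge0// ltW.
rewrite -[leRHS]ger0_norm// -sqrtr_sqr ler_wsqrtr// exprMn sqr_sqrtr; last first.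
  by rewrite ltW// mulr_gt0.
have B18 : 0 < 18 * B by exact: mulr_gt0.
rewrite -[leLHS]mulrA (ler_pM2l B18) a2 c2'.
have key : 4 * a ^+ 2 + 3 * c ^+ 2 <= (2 * (a + c)) ^+ 2 by clear -a20 c20; nra.
have := ler_wpM2r (sqr_ge0 n%:R) key; clear; lra.
Qed.
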